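(* Let $\xi$ be a model, $h\ge0$, let $\phi\in\mathcal{C}$ minimize $P_{h,\xi}$ on $\mathcal{C}$ and $\eta\in\mathcal{K}_{h,\xi}$ maximize $D$ on $\mathcal{K}_{h,\xi}$. Then: (1) (a) there is $c>0$ with $c\le\phi$ on $[0,1]$; (b) $\phi'\in L^\infty$. (2) (a) $\eta\in C^2([0,1])$; (b) $1/\sqrt{\eta''}\in C([0,1])$, its distributional derivative $(1/\sqrt{\eta''})'$ belongs to $L^1$ and is monotone decreasing, and its second distributional derivative satisfies $(1/\sqrt{\eta''})''=-\mu$ for some nonnegative Radon measure $\mu$ on $(0,1)$ with $\operatorname{supp}\mu\subset\{\xi=\eta\}$; (c) on the set $\{\xi=\eta\}$ one has $\eta'(t)=\xi'(t)$ and $\eta''(t)\ge\xi''(t)$; (d) $\eta'(1)=\xi'(1)$, and either $\eta(0)=\xi(0)$ or $\phi'(0)=0$. (3) $\phi''=(1/\sqrt{\eta''})''=-\mu$ as distributions on $(0,1)$, and $\mu$ is a finite measure.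
   Context: A model is $\xi(t)=\sum_{p\ge2}\beta_p^2t^p$, real $\beta_p$ not all zero, with $\xi(1+\epsilon)<\infty$ for some $\epsilon>0$. $\mathcal{C}$ is the set of $\phi\in C([0,1])$ with $\phi\ge0$, non-increasing and concave; $P_{h,\xi}(\phi)=\int_0^1(\xi''\phi+1/\phi)dx+h^2\phi(0)$. For $\phi\in\mathcal{C}$, $\phi'(0)=\lim_{t\to0^+}(\phi(t)-\phi(0))/t$. $\mathcal{K}_{h,\xi}$ is the set of convex $\eta\in C([0,1])$ with $\eta\ge\xi$, $\eta(1)=\xi(1)$, $\eta'(0)=\xi'(0)-h^2$ (one-sided derivatives at endpoints); $\eta''$ is the distributional second derivative (a nonnegative measure on $(0,1)$), $\eta''_{ac}$ its absolutely continuous density, and $D(\eta)=2\int_0^1\sqrt{\eta''_{ac}}\,dx$. Minimizers of $P_{h,\xi}$ and maximizers of $D$ exist. *)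

(* Defs.v *)
From HB Require Import structures.
From mathcomp Require Import all_boot all_order all_algebra.
From mathcomp Require Import all_classical all_reals all_analysis.
Set Implicit Arguments. Unset Strict Implicit. Unset Printing Implicit Defensive.
Import Order.TTheory GRing.Theory Num.Theory.
Import numFieldNormedType.Exports.
Local Open Scope classical_set_scope.
Local Open Scope ring_scope.

Section Defs.
Variable R : realType.
Local Notation leb := (@lebesgue_measure R).

Definition xi (beta : nat -> R) (t : R) : R :=
  limn (fun n => \sum_(2 <= p < n) (beta p ^+ 2 * t ^+ p)).

Definition is_model (beta : nat -> R) : Prop :=
  (exists p, (2 <= p)%N /\ beta p != 0) /\
  (exists eps : R, 0 < eps /\
     cvgn (fun n => \sum_(2 <= p < n) (beta p ^+ 2 * (1 + eps) ^+ p))).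

Definition xi1 beta : R -> R := derive1 (xi beta).
Definition xi2 beta : R -> R := derive1 (derive1 (xi beta)).

Definition deriv01 (f : R -> R) (x l : R) : Prop :=
  (fun y => (f y - f x) / (y - x)) @ within [set y | 0 <= y <= 1 /\ y != x] (nbhs x)
    --> l.

Definition C2_01 (f f1 f2 : R -> R) : Prop :=
  {within `[0%R, 1%R], continuous f} /\
  {within `[0%R, 1%R], continuous f1} /\ {within `[0%R, 1%R], continuous f2} /\
  (forall x, 0 <= x <= 1 -> deriv01 f x (f1 x) /\ deriv01 f1 x (f2 x)).

Definition test_fun (psi : R -> R) : Prop :=
  (forall (n : nat) (x : R), derivable (iter n (fun f : R -> R => derive1 f) psi) x 1) /\
  (exists a b : R, 0 < a /\ a <= b /\ b < 1 /\
     forall x, ~ (a <= x <= b) -> psi x = 0).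

Definition distr_deriv (f g : R -> R) : Prop :=
  forall psi, test_fun psi ->
    (\int[leb]_(x in `]0%R, 1%R[) (f x * derive1 psi x)%:E =
     - \int[leb]_(x in `]0%R, 1%R[) (g x * psi x)%:E)%E.

Definition distr_deriv2_neg (f : R -> R) (mu : {measure set R -> \bar R}) : Prop :=
  forall psi, test_fun psi ->
    (\int[leb]_(x in `]0%R, 1%R[) (f x * derive1 (derive1 psi) x)%:E =
     - \int[mu]_(x in `]0%R, 1%R[) (psi x)%:E)%E.

Definition radon01 (mu : {measure set R -> \bar R}) : Prop :=
  mu (~` `]0%R, 1%R[) = 0%E /\
  (forall a b : R, 0 < a -> b < 1 -> (mu `[a%R, b%R]%classic < +oo)%E).

Definition msupport (mu : {measure set R -> \bar R}) : set R :=
  [set x | forall U : set R, open U -> U x -> (0 < mu U)%E].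

Definition einv (r : R) : \bar R := if r == 0 then +oo%E else (r^-1)%:E.

Definition Cset (phi : R -> R) : Prop :=
  {within `[0%R, 1%R], continuous phi} /\
  (forall x, 0 <= x <= 1 -> 0 <= phi x) /\
  (forall x y, 0 <= x -> x <= y -> y <= 1 -> phi y <= phi x) /\
  (forall x y t, 0 <= x <= 1 -> 0 <= y <= 1 -> 0 <= t <= 1 ->
     t * phi x + (1 - t) * phi y <= phi (t * x + (1 - t) * y)).

Definition Pfun (beta : nat -> R) (h : R) (phi : R -> R) : \bar R :=
  (\int[leb]_(x in `[0%R, 1%R]) ((xi2 beta x * phi x)%:E + einv (phi x))
   + (h ^+ 2 * phi 0)%:E)%E.

Definition is_Pmin beta h phi : Prop :=
  Cset phi /\ forall psi, Cset psi -> (Pfun beta h phi <= Pfun beta h psi)%E.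

Definition Kset (beta : nat -> R) (h : R) (eta : R -> R) : Prop :=
  {within `[0%R, 1%R], continuous eta} /\
  (forall x y t, 0 <= x <= 1 -> 0 <= y <= 1 -> 0 <= t <= 1 ->
     eta (t * x + (1 - t) * y) <= t * eta x + (1 - t) * eta y) /\
  (forall x, 0 <= x <= 1 -> xi beta x <= eta x) /\
  eta 1 = xi beta 1 /\
  deriv01 eta 0 (xi1 beta 0 - h ^+ 2).

(* g is the density of the absolutely continuous part of the distributional
   second derivative eta'' (a nonnegative measure on (0,1)):
   eta'' = g dx + nu_s with nu_s singular w.r.t. Lebesgue measure *)
Definition ac_density (eta g : R -> R) : Prop :=
  measurable_fun (`]0%R, 1%R[ : set R) g /\ (forall x, 0 < x < 1 -> 0 <= g x) /\
  exists (nus : {measure set R -> \bar R}) (N : set R),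
    measurable N /\ (N `<=` `]0%R, 1%R[) /\ leb N = 0%E /\
    nus (~` N) = 0%E /\
    (forall a b : R, 0 < a -> b < 1 ->
       (\int[leb]_(x in `[a%R, b%R]) (g x)%:E < +oo)%E /\ (nus `[a%R, b%R]%classic < +oo)%E) /\
    (forall psi, test_fun psi ->
      (\int[leb]_(x in `]0%R, 1%R[) (eta x * derive1 (derive1 psi) x)%:E =
       (\int[leb]_(x in `]0%R, 1%R[) (g x * psi x)%:E)
       + (\int[nus]_(x in `]0%R, 1%R[) (psi x)%:E))%E).

Definition Dval (g : R -> R) : \bar R :=
  (2%:E * \int[leb]_(x in `]0%R, 1%R[) (Num.sqrt (g x))%:E)%E.

Definition is_Dmax beta h eta : Prop :=
  Kset beta h eta /\
  exists g, ac_density eta g /\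
    forall eta2 g2, Kset beta h eta2 -> ac_density eta2 g2 -> (Dval g2 <= Dval g)%E.

End Defs.

(* Main.v *)
Require Import Defs.
From HB Require Import structures.
From mathcomp Require Import all_boot all_order all_algebra.
From mathcomp Require Import all_classical all_reals all_analysis.
From mathcomp Require Import measurable_realfun ring lra archimedean.
Import Order.TTheory GRing.Theory Num.Theory.
Import numFieldNormedType.Exports.
Local Open Scope classical_set_scope.
Local Open Scope ring_scope.
Set Implicit Arguments.
Unset Strict Implicit.

(* Perturbing a minimizer phi inside the cone of concave non-increasing functions
   gives the variational inequality J f >= 0 for every f in the cone, where
   J f = int (xi'' - 1/phi^2) f + h^2 f(0), with equality at f = phi and J 1 = 0.
   Let e0 be the function with e0'' = 1/phi^2, e0(1) = xi(1) and
   e0'(0) = xi'(0) - h^2.  Since the cone is generated by the constant 1 and by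
   the hinges f_s(x) = 1 - max(x, s), and J f_s = (e0 - xi)(s), the inequality
   says that e0 lies in K, and complementary slackness says that phi is affine
   wherever e0 > xi.  If eta is any element of K, with eta'' = g dx + nu_s, then
   pairing eta'' with phi and using g phi + 1/phi >= 2 sqrt g gives
   D(eta) <= 2 int 1/phi = D(e0); equality forces g = 1/phi^2 and nu_s = 0, so
   the maximizer is e0 and 1/sqrt(eta'') = phi.  Finally phi is Lipschitz at 1
   because xi'' is Lipschitz and e0 - xi vanishes to second order at its zeros,
   so the right slope of -phi is a bounded monotone function, and mu is its
   Stieltjes measure. *)

(** Three obstacles shape the argument. The expansion of [1 / phi], and the direction -1 in the
    cone, need [phi] bounded away from 0, while a finite value of the functional does not by itself
    exclude [phi 1 = 0]. The remedy is to compare [phi] with its dilations [phi (s * x)]: [phi] pays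
    at least [(1 - s) / phi s] on [[s, 1]], whereas the total cost of the dilation exceeds that of
    [phi] on [[0, s]] only by a multiple of [1 - s]. Next, [eta''] acts on smooth functions with
    compact support in (0, 1), and [phi] is neither smooth nor zero at the ends. So [eta''] is
    bounded from above on the generators of the cone only, through smoothed trapezoids; the slope of
    [eta] at 0 and the contact with [xi] at 1 supply the boundary terms, and positivity on the cone
    carries the bound to [phi]. Last, [phi] need not be differentiable everywhere, so its slope is
    handled by two-sided chord bounds, and integrations by parts against it by increments over fine
    partitions. A concave non-increasing function can be arbitrarily steep only near 1, which is why
    a Lipschitz bound at 1 suffices. *)

Section Calculus.
Context {R : realType}.
Local Notation leb := (@lebesgue_measure R).
Implicit Types (f g F : R -> R) (a b c k M : R).

(** * Integrals over segments, the fundamental theorem, extension by constants *)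

Definition intble a b f := leb.-integrable `[a, b] (EFin \o f).
Definition RI a b f : R := \int[leb]_(x in `[a, b]) f x.

Lemma cont_within f (A : set R) : continuous f -> {within A, continuous f}.
Proof. by move=> cf; apply: continuous_subspaceT. Qed.

Lemma within_intble a b f : {within `[a, b], continuous f} -> intble a b f.
Proof.
move=> cf; apply: continuous_compact_integrable => //; exact: segment_compact.
Qed.

Lemma cont_intble f a b : continuous f -> intble a b f.
Proof. by move=> cf; apply/within_intble/cont_within. Qed.

Lemma intble_bounded f a b M : measurable_fun (`[a, b] : set R) f ->
  (forall x, a <= x <= b -> `|f x| <= M) -> intble a b f.
Proof.
move=> mf fM.
have leb_fin : (leb (`[a, b] : set R) < +oo)%E.
  rewrite lebesgue_measure_itv /=; case: ifP => _; last exact: ltry.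
  by rewrite -EFinD ltry.
apply: measurable_bounded_integrable => //.
rewrite /bounded_near; near=> N => x /=; rewrite in_itv /= => xab.
apply: le_trans (fM _ xab) _.
by near: N; apply: nbhs_pinfty_ge; rewrite num_real.
Unshelve. all: by end_near. Qed.

Lemma RI_EFin a b f : intble a b f ->
  (\int[leb]_(x in `[a, b]) (f x)%:E = (RI a b f)%:E)%E.
Proof. by move=> fi; rewrite /RI /Rintegral fineK //; apply: integrable_fin_num. Qed.

Lemma int_oo a b f : intble a b f ->
  (\int[leb]_(x in `]a, b[) (f x)%:E = (RI a b f)%:E)%E.
Proof.
move=> fi; rewrite -RI_EFin //.
apply/esym/(@integral_itv_bndoo _ a b (EFin \o f) true false).
case/integrableP: fi => mf _; apply: measurable_funS mf => //.
by apply: subset_itvW.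
Qed.

Lemma RI_eq a b f g : (forall x, a <= x <= b -> f x = g x) -> RI a b f = RI a b g.
Proof. by move=> fg; apply: eq_Rintegral => x; rewrite inE /= in_itv /=; exact: fg. Qed.

Lemma intble_eq a b f g : (forall x, a <= x <= b -> f x = g x) ->
  intble a b f -> intble a b g.
Proof.
move=> fg; apply: eq_integrable => // x; rewrite inE /= in_itv /= => xab.
by rewrite fg.
Qed.

Lemma intbleD a b f g : intble a b f -> intble a b g -> intble a b (fun x => f x + g x).
Proof. by move=> fi gi; exact: (integrableD _ fi gi). Qed.

Lemma intbleB a b f g : intble a b f -> intble a b g -> intble a b (fun x => f x - g x).
Proof. by move=> fi gi; exact: (integrableB _ fi gi). Qed.

Lemma intbleZ a b k f : intble a b f -> intble a b (fun x => k * f x).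
Proof. by move=> fi; exact: (integrableZl _ k fi). Qed.

Lemma intble_cst a b k : intble a b (fun=> k).
Proof. apply: cont_intble => x; exact: cvg_cst. Qed.

Lemma RID a b f g : intble a b f -> intble a b g ->
  RI a b (fun x => f x + g x) = RI a b f + RI a b g.
Proof. by move=> fi gi; exact: RintegralD. Qed.

Lemma RIB a b f g : intble a b f -> intble a b g ->
  RI a b (fun x => f x - g x) = RI a b f - RI a b g.
Proof. by move=> fi gi; exact: RintegralB. Qed.

Lemma RIZ a b k f : intble a b f -> RI a b (fun x => k * f x) = k * RI a b f.
Proof. by move=> fi; exact: RintegralZl. Qed.

Lemma RI_cst a b k : a <= b -> RI a b (fun=> k) = k * (b - a).
Proof.
move=> ab; rewrite /RI Rintegral_cst //= lebesgue_measure_itv /= lte_fin.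
by case: ltgtP ab => //= -> _; rewrite subrr.
Qed.

Lemma RI_le a b f g : intble a b f -> intble a b g ->
  (forall x, a <= x <= b -> f x <= g x) -> RI a b f <= RI a b g.
Proof.
move=> fi gi fg; apply: le_Rintegral => // x /=; rewrite in_itv /=; exact: fg.
Qed.

Lemma RI_ge0 a b f : (forall x, a <= x <= b -> 0 <= f x) -> 0 <= RI a b f.
Proof. move=> fg; apply: Rintegral_ge0 => // x /=; rewrite in_itv /=; exact: fg. Qed.

Lemma RI_abs_le a b f M : a <= b -> intble a b f ->
  (forall x, a <= x <= b -> `|f x| <= M) -> `|RI a b f| <= M * (b - a).
Proof.
move=> ab fi fM.
have fiN : intble a b (fun x => `|f x|) by exact: (integrable_abse fi).
apply: (@le_trans _ _ (RI a b (fun x => `|f x|))); first exact: le_normr_Rintegral.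
rewrite -(RI_cst M ab); apply: RI_le => //; exact: intble_cst.
Qed.

Lemma RI_pt a f : RI a a f = 0.
Proof. by rewrite /RI set_itv1 Rintegral_set1. Qed.

Lemma RI_cat a b c f : a <= b -> b <= c -> intble a c f ->
  RI a c f = RI a b f + RI b c f.
Proof.
move=> ab bc fi.
have := @Rintegral_itvB R f (BLeft a) (BRight c) b fi.
rewrite !bnd_simp => /(_ ab bc).
rewrite Rintegral_itv_obnd_cbnd /RI; last first.
  apply: integrableS fi => //; apply: subset_itv; rewrite bnd_simp //.
by move=> <-; ring.
Qed.

Lemma RI_ftc f F a b : a <= b -> {within `[a, b], continuous f} ->
  {within `[a, b], continuous F} ->
  (forall x, a < x < b -> is_derive x 1 F (f x)) -> RI a b f = F b - F a.
Proof.
move=> ab cf cF dF; have [{}ab|ba|->] := ltgtP a b; last by rewrite RI_pt subrr.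
  2: by move: (lt_le_trans ba ab); rewrite ltxx.
rewrite /RI /Rintegral (@continuous_FTC2 _ f F a b) //.
- have [_ Fa Fb] := (continuous_within_itvP F ab).1 cF.
  split => // x; rewrite in_itv /= => /dF [] //.
- move=> x; rewrite in_itv /= => /dF [] _; rewrite derive1E //.
Qed.

Lemma is_derive_cont f (x l : R) : is_derive x 1 f l -> {for x, continuous f}.
Proof. by case=> df _; apply/differentiable_continuous/derivable1_diffP. Qed.

Lemma RI_ftc' f F a b : a <= b -> {within `[a, b], continuous f} ->
  (forall x, a <= x <= b -> is_derive x 1 F (f x)) -> RI a b f = F b - F a.
Proof.
move=> ab cf dF; apply: RI_ftc => //; last first.
  by move=> x /andP[ax xb]; apply: dF; rewrite !ltW.
apply: continuous_in_subspaceT => x; rewrite inE /= in_itv /= => /dF.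
exact: is_derive_cont.
Qed.

Lemma RI_eq0 a b f : a < b -> continuous f -> (forall x, a <= x <= b -> 0 <= f x) ->
  RI a b f = 0 -> forall x, a <= x <= b -> f x = 0.
Proof.
move=> ab cf f0 If0 x xab; apply/eqP; rewrite eq_le f0 // andbT leNgt.
apply/negP => fx0.
have /cvgrPdist_lt /(_ (f x / 2)) : f @ x --> f x by exact: cf.
rewrite divr_gt0 // => /(_ isT) [d /= d0 Hd].
pose l := Num.max a (x - d / 2); pose r := Num.min b (x + d / 2).
have [al lx xr rb] : [/\ a <= l, l <= x, x <= r & r <= b].
  rewrite /l /r; case/andP: xab => ax xb.
  rewrite le_max lexx ge_max ax ge_min lexx le_min xb; split=> //=; lra.
have lr : l < r.
  rewrite /l /r lt_min !gt_max; case/andP: xab => ax xb.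
  apply/andP; split; apply/andP; split; lra.
have h1 : f x / 2 * (r - l) <= RI l r f.
  rewrite -RI_cst; last exact: ltW.
  apply: RI_le; [exact: intble_cst|exact: cont_intble|] => y /andP[ly yr].
  have : `|f x - f y| < f x / 2.
    apply: Hd => /=; rewrite distrC ltr_distl.
    move: ly yr; rewrite /l /r ge_max le_min => /andP[_ h1] /andP[_ h2].
    by apply/andP; split; lra.
  by rewrite ltr_norml => /andP[]; lra.
have fi u v : intble u v f by exact: cont_intble.
have al' : 0 <= RI a l f.
  by apply: RI_ge0 => y /andP[? yl]; apply: f0; lra.
have rb' : 0 <= RI r b f.
  by apply: RI_ge0 => y /andP[? yl]; apply: f0; lra.
have : 0 < f x / 2 * (r - l) by rewrite mulr_gt0 ?divr_gt0 ?subr_gt0.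
have : RI a b f = RI a l f + (RI l r f + RI r b f).
  by rewrite (@RI_cat a l b) //; [rewrite (@RI_cat l r b) //; lra|lra].
lra.
Qed.

(* Subdividing [x, y] into n equal parts improves the bound by a factor n. *)
Lemma const_of_small (G A : R -> R) a b : a <= b ->
  (forall x y, a <= x -> x <= y -> y <= b -> `|G y - G x| <= (A y - A x) * (y - x)) ->
  G b = G a.
Proof.
move=> ab H; apply/eqP; rewrite -subr_eq0 -normr_le0.
suff Hn (n : nat) : `|G b - G a| * n.+1%:R <= (A b - A a) * (b - a).
  rewrite leNgt; apply/negP => G0.
  pose K := (A b - A a) * (b - a).
  have K0 : 0 <= K by apply: le_trans (Hn 0%N); rewrite mulr_ge0.
  have := Num.Theory.archi_boundP (divr_ge0 K0 (ltW G0)).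
  set m := Num.Def.archi_bound _ => hm.
  have := Hn m; rewrite -/K leNgt => /negP; apply.
  by rewrite mulrC -ltr_pdivrMr // (lt_trans hm) // ltr_nat.
pose p (i : nat) : R := a + i%:R * ((b - a) / n.+1%:R).
have n0 : 0 < n.+1%:R :> R by rewrite ltr0n.
have d0 : 0 <= (b - a) / n.+1%:R by rewrite divr_ge0 ?subr_ge0 // ltW.
have pS i : p i.+1 = p i + (b - a) / n.+1%:R by rewrite /p -natr1; ring.
have p0 : p 0%N = a by rewrite /p mul0r addr0.
have pn : p n.+1 = b by rewrite /p mulrCA mulfV ?gt_eqF // mulr1; ring.
have pa i : a <= p i by rewrite /p lerDl mulr_ge0.
have pb i : (i <= n.+1)%N -> p i <= b.
  by move=> ni; rewrite -pn /p lerD2l ler_wpM2r // ler_nat.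
have step i : (i <= n.+1)%N ->
    `|G (p i) - G a| <= (A (p i) - A a) * ((b - a) / n.+1%:R).
  elim: i => [_|i IH ni]; first by rewrite p0 !subrr normr0 mul0r.
  have pp : p i <= p i.+1 by rewrite pS lerDl.
  have := H (p i) (p i.+1) (pa i) pp (pb _ ni).
  rewrite {3}pS addrAC subrr add0r => h1.
  have h2 := IH (ltnW ni).
  rewrite (_ : G (p i.+1) - G a = (G (p i.+1) - G (p i)) + (G (p i) - G a)); last by ring.
  apply: le_trans (ler_normD _ _) _; apply: le_trans (lerD h1 h2) _.
  rewrite -mulrDl le_eqVlt; apply/orP; left; apply/eqP; congr (_ * _); ring.
by have := step n.+1 (leqnn _); rewrite pn mulrA ler_pdivlMr.
Qed.

(** Constant extension from [0, 1] to the line. The data are continuous only within [0, 1]; after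
    clamping, the lemmas on globally continuous functions apply, and integrals over [0, 1] do not
    change. *)
Definition clamp f x := f (Num.max 0 (Num.min x 1)).

Lemma clamp_id f x : 0 <= x <= 1 -> clamp f x = f x.
Proof. by case/andP=> x0 x1; rewrite /clamp (min_idPl x1) (max_idPr x0). Qed.

Lemma clamp_in (x : R) : 0 <= Num.max 0 (Num.min x 1) <= 1.
Proof. by rewrite le_max lexx ge_max ler01 ge_min lexx orbT. Qed.

Lemma clamp_cont f : {within `[0, 1], continuous f} -> continuous (clamp f).
Proof.
move=> /subspace_continuousP cf x; rewrite /clamp.
have cg : continuous (fun x : R => Num.max 0 (Num.min x 1)).
  move=> y; apply: (@continuous_max R R (cst 0) (id \min cst 1) y).
    exact: cvg_cst.
  apply: (@continuous_min R R id (cst 1) y); [exact: cvg_id|exact: cvg_cst].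
have := cf (Num.max 0 (Num.min x 1)); rewrite /= in_itv /= => /(_ (clamp_in x)) h.
apply: cvg_comp h => U [e /= e0 HU].
have := cg x; move/cvgrPdist_lt => /(_ e e0).
apply: filterS => y yx; apply: HU => //=; rewrite in_itv /=; exact: clamp_in.
Qed.

End Calculus.

(** * A smooth bump function with compact support *)

Section Mollifier.
Context {R : realType}.
Implicit Types (f g w : R -> R) (a b c d e k x y : R).

Lemma idD f g x a b : is_derive x 1 f a -> is_derive x 1 g b ->
  is_derive x 1 (fun y => f y + g y) (a + b).
Proof. by move=> fa gb; exact: is_deriveD. Qed.

Lemma idN f x a : is_derive x 1 f a -> is_derive x 1 (fun y => - f y) (- a).
Proof. by move=> fa; exact: is_deriveN. Qed.

Lemma idB f g x a b : is_derive x 1 f a -> is_derive x 1 g b ->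
  is_derive x 1 (fun y => f y - g y) (a - b).
Proof. by move=> fa gb; exact: is_deriveB. Qed.

Lemma idM f g x a b : is_derive x 1 f a -> is_derive x 1 g b ->
  is_derive x 1 (fun y => f y * g y) (a * g x + f x * b).
Proof.
move=> fa gb; apply: is_derive_eq (is_deriveM fa gb) _.
by rewrite /GRing.scale /= [RHS]addrC [g x * a]mulrC.
Qed.

Lemma idcst k x : is_derive x 1 (fun=> k) 0.
Proof. exact: is_derive_cst. Qed.

Lemma idZ f k x a : is_derive x 1 f a -> is_derive x 1 (fun y => k * f y) (k * a).
Proof.
by move=> fa; apply: is_derive_eq (idM (idcst k x) fa) _; rewrite mul0r add0r.
Qed.

Lemma idaff k c x : is_derive x 1 (fun y => k * y + c) k.
Proof.
apply: is_derive_eq (idD (idZ k (is_derive_id x 1)) (idcst c x)) _.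
by rewrite mulr1 addr0.
Qed.

Lemma idcomp f g x a b : is_derive (g x) 1 f a -> is_derive x 1 g b ->
  is_derive x 1 (fun y => f (g y)) (a * b).
Proof. exact: is_derive1_comp. Qed.

Lemma idcomp_aff f x k c a : is_derive (k * x + c) 1 f a ->
  is_derive x 1 (fun y => f (k * y + c)) (a * k).
Proof. by move=> fa; exact: (@idcomp f (fun y => k * y + c) x a k fa (idaff k c x)). Qed.

Lemma idX f n x a : is_derive x 1 f a ->
  is_derive x 1 (fun y => f y ^+ n) (n%:R * f x ^+ n.-1 * a).
Proof.
move=> fa; elim: n => [|n IH]; first by rewrite !mul0r; exact: idcst.
rewrite (_ : (fun y => _) = fun y => f y * f y ^+ n); last first.
  by apply/funext => y; rewrite exprS.
apply: is_derive_eq (idM fa IH) _.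
case: n {IH} => [|n]; first by rewrite /= !expr0; ring.
by rewrite /= -[n.+2%:R]natr1 exprS; ring.
Qed.

Lemma is_derive_derive1 f x a : is_derive x 1 f a -> derive1 f x = a.
Proof. by case=> _ fa; rewrite derive1E. Qed.

Lemma derive1_fun f g : (forall x, is_derive x 1 f (g x)) -> derive1 f = g.
Proof. by move=> fg; apply/funext => x; exact: is_derive_derive1. Qed.

Lemma derivable_cont f : (forall x, derivable f x 1) -> continuous f.
Proof. by move=> df x; apply/differentiable_continuous/derivable1_diffP. Qed.

(** Derivatives are carried as explicit functions, so that sums, products and affine changes of
    variable follow by induction; [smoothn_iter] returns to the iterated [derive1] that [test_fun]
    asks for. *)
Fixpoint smoothn (n : nat) f : Prop :=
  if n is n'.+1 then exists g, (forall x, is_derive x 1 f (g x)) /\ smoothn n' g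
  else True.

Lemma smoothn_le n f : smoothn n.+1 f -> smoothn n f.
Proof.
elim: n f => // n IH f [g [fg gn]]; exists g; split=> //; exact: IH.
Qed.

Lemma smoothn_iter n f : smoothn n.+1 f ->
  forall x, derivable (iter n (fun h : R -> R => derive1 h) f) x 1.
Proof.
elim: n f => [|n IH] f [g [fg gn]] x; first by have [] := fg x.
by rewrite iterSr (derive1_fun fg); exact: IH.
Qed.

Lemma smoothnD n f g : smoothn n f -> smoothn n g -> smoothn n (fun x => f x + g x).
Proof.
elim: n f g => // n IH f g [f' [ff' nf']] [g' [gg' ng']].
exists (fun x => f' x + g' x); split; last exact: IH.
by move=> x; exact: idD.
Qed.

Lemma smoothnZ n k f : smoothn n f -> smoothn n (fun x => k * f x).
Proof.
elim: n f => // n IH f [f' [ff' nf']].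
exists (fun x => k * f' x); split; last exact: IH.
by move=> x; exact: idZ.
Qed.

Lemma smoothnM n f g : smoothn n f -> smoothn n g -> smoothn n (fun x => f x * g x).
Proof.
elim: n f g => // n IH f g nf ng.
have [f' [ff' nf']] := nf; have [g' [gg' ng']] := ng.
exists (fun x => f' x * g x + f x * g' x); split.
  by move=> x; exact: idM.
by apply: smoothnD; apply: IH => //; exact: smoothn_le.
Qed.

Lemma smoothn_aff n f k c : smoothn n f -> smoothn n (fun x => f (k * x + c)).
Proof.
elim: n f => // n IH f [f' [ff' nf']].
exists (fun x => k * f' (k * x + c)); split; last by apply: smoothnZ; exact: IH.
by move=> x; rewrite mulrC; exact: idcomp_aff.
Qed.

(** For [n = 0] this is the classical [exp (-1/x)] glued to 0. The negative powers of [x] make the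
    family closed under differentiation. *)
Definition flat (n : nat) x : R := if 0 < x then x^-1 ^+ n * expR (- x^-1) else 0.

Lemma flat_ge0 n x : 0 <= flat n x.
Proof.
by rewrite /flat; case: ifP => // x0; rewrite mulr_ge0 ?expR_ge0 // exprn_ge0 // invr_ge0 ltW.
Qed.

(** The term of degree [n + 2] of the exponential series bounds [expR x^-1] from below. Its two
    surplus powers make [flat n] vanish to second order at 0. *)
Lemma flat_bound n x : 0 < x -> flat n x <= (n.+2)`!%:R * x ^+ 2.
Proof.
move=> x0; rewrite /flat x0 expRN ler_pdivrMr ?expR_gt0 //.
have f0 : 0 < (n.+2)`!%:R :> R by rewrite ltr0n fact_gt0.
have := @expR_ge1Dxn R x^-1 n.+1; rewrite invr_ge0 (ltW x0) => /(_ isT) h.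
have h2 : x^-1 ^+ n.+2 / (n.+2)`!%:R <= expR x^-1.
  by apply: le_trans h; rewrite lerDr.
rewrite ler_pdivrMr // in h2.
have -> : x^-1 ^+ n = x^-1 ^+ n.+2 * x ^+ 2.
  by rewrite -addn2 exprD -mulrA -exprMn mulVf ?gt_eqF // expr1n mulr1.
rewrite (_ : _ * expR x^-1 = expR x^-1 * (n.+2)`!%:R * x ^+ 2); last by ring.
by rewrite ler_wpM2r // exprn_ge0 // ltW.
Qed.

Lemma flat_derive n x : is_derive x 1 (flat n) (flat n.+2 x - n%:R * flat n.+1 x).
Proof.
have [x0|x0|->] := ltgtP x 0.
- rewrite /flat ltNge (ltW x0) /= mulr0 subr0.
  apply: (near_eq_is_derive _ (idcst 0 x)).
  near=> y; rewrite ifF //; apply/negbTE; rewrite -leNgt ltW //.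
  near: y; exact: lt_nbhsl.
- have h1 : is_derive x 1 (fun y : R => y^-1) (- x ^- 2).
    apply: is_derive_eq (is_deriveV _ (is_derive_id x 1)) _; rewrite ?gt_eqF //.
    by rewrite /GRing.scale /= mulr1.
  have h2 : is_derive x 1 (fun y : R => y^-1 ^+ n) (- n%:R * x^-1 ^+ n.+1).
    apply: is_derive_eq (idX n h1) _.
    case: n => [|n]; first by rewrite !mul0r oppr0 mul0r.
    by rewrite -exprVn /= [in RHS]exprS [in RHS]exprS; ring.
  have h3 : is_derive x 1 (fun y : R => expR (- y^-1)) (expR (- x^-1) * x^-1 ^+ 2).
    apply: is_derive_eq (idcomp (is_derive_expR _) (idN h1)) _.
    by rewrite opprK exprVn.
  apply: is_derive_eq (near_eq_is_derive _ (idM h2 h3)) _.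
    near=> y; rewrite /flat ifT //; near: y; exact: lt_nbhsr.
  rewrite /flat x0.
  by rewrite !exprS; ring.
- rewrite {2 3}/flat ltxx mulr0 subrr.
  (* At 0 the difference quotient is [flat n y / y]: it is 0 for [y <= 0] and at most a constant
     times [y] otherwise, so the derivative is 0. *)
  apply/is_derive1_caratheodory; exists (fun y => flat n y / y); split.
  + move=> z; rewrite subr0 {2}/flat ltxx subr0.
    have [->|z0] := eqVneq z 0; first by rewrite /flat ltxx !mul0r.
    by rewrite mulfVK.
  + rewrite /prop_for /continuous_at invr0 mulr0.
    apply/cvgrPdist_le => e e0; near=> y; rewrite sub0r normrN.
    have [y0|y0] := leP y 0.
      by rewrite /flat ltNge y0 /= mul0r normr0 ltW.
    rewrite ger0_norm; last first.
      by apply: divr_ge0; [exact: flat_ge0|exact: ltW].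
    rewrite ler_pdivrMr //; apply: le_trans (flat_bound _ y0) _.
    rewrite expr2 mulrA ler_pM2r //.
    have f0 : 0 < (n.+2)`!%:R :> R by rewrite ltr0n fact_gt0.
    rewrite mulrC -ler_pdivlMr //; apply: ltW.
    near: y; apply: lt_nbhsl; exact: divr_gt0.
  + by rewrite invr0 mulr0.
Unshelve. all: by end_near. Qed.

Lemma flat_smooth m n : smoothn m (flat n).
Proof.
elim: m n => // m IH n.
exists (fun x => flat n.+2 x - n%:R * flat n.+1 x); split; first exact: flat_derive.
rewrite (_ : (fun x => _) = fun x => flat n.+2 x + - n%:R * flat n.+1 x); last first.
  by apply/funext => x; rewrite mulNr.
by apply: smoothnD => //; exact: smoothnZ.
Qed.

Definition smooth_bump x : R := flat 0 (1 * x + 1) * flat 0 (- 1 * x + 1).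

Lemma smooth_bump_smooth n : smoothn n smooth_bump.
Proof. by apply: smoothnM; apply: smoothn_aff; exact: flat_smooth. Qed.

Lemma bump_ge0 x : 0 <= smooth_bump x.
Proof. by rewrite mulr_ge0 ?flat_ge0. Qed.

Lemma bump0_gt0 : 0 < smooth_bump 0.
Proof. by rewrite /smooth_bump !mulr0 !add0r /flat ltr01 expr0 mul1r mulr_gt0 ?expR_gt0. Qed.

Lemma bump_out x : 1 <= `|x| -> smooth_bump x = 0.
Proof.
rewrite ler_normr /smooth_bump /flat => /orP[x1|x1].
  by rewrite [X in _ * X]ifF ?mulr0 //; apply/negbTE; rewrite -leNgt; lra.
by rewrite ifF ?mul0r //; apply/negbTE; rewrite -leNgt; lra.
Qed.

End Mollifier.

(** * Smoothed steps, ramps and trapezoids used as test functions *)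

Section Tents.
Context {R : realType}.
Local Notation leb := (@lebesgue_measure R).
Implicit Types (f g w : R -> R) (a b c d e k s x y : R).

Lemma smoothn_cont n f : smoothn n.+1 f -> continuous f.
Proof. by move=> [g [fg _]] x; exact: is_derive_cont (fg x). Qed.

(** The base point -2 lies to the left of the supports in play, which start at -1; the primitive
    then vanishes up to -1 and can be integrated again. *)
Definition primitive f x := RI (- 2) x f.

Lemma primitive_le f x : (forall y, y <= - 1 -> f y = 0) -> x <= - 1 -> primitive f x = 0.
Proof.
move=> f0 x1; rewrite /primitive.
have [x2|x2] := leP (- 2) x; last first.
  rewrite /RI set_itv_ge ?Rintegral_set0 // bnd_simp -ltNge //.
rewrite (RI_eq (g := fun=> 0)) ?RI_cst ?mul0r // => y /andP[_ yx]; apply: f0; lra.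
Qed.

Lemma primitive_derive f x : continuous f -> (forall y, y <= - 1 -> f y = 0) ->
  is_derive x 1 (primitive f) (f x).
Proof.
(* Up to -3/2 the primitive is locally 0; beyond it the point is interior to the domain of
   integration, as the fundamental theorem requires. *)
move=> cf f0; have [x2|x2] := leP x (- 3 / 2).
  rewrite f0; last by lra.
  apply: (near_eq_is_derive _ (idcst 0 x)); near=> y.
  rewrite primitive_le //; suff: y < - 1 by lra.
  near: y; apply: lt_nbhsl; lra.
have xx : x < x + 1 by lra.
have x2' : - 2 < x by lra.
have [] := continuous_FTC1_closed xx (cont_intble (-2) (x+1) cf) x2' (cf x).
move=> h1 h2; apply: DeriveDef; [exact: h1|rewrite -derive1E; exact: h2].
Unshelve. all: by end_near. Qed.

Lemma primitive_smooth n f : smoothn n f -> continuous f ->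
  (forall y, y <= - 1 -> f y = 0) -> smoothn n.+1 (primitive f).
Proof. by move=> nf cf f0; exists f; split=> // x; exact: primitive_derive. Qed.

Lemma bump_cont : continuous (@smooth_bump R).
Proof. exact: (@smoothn_cont 0 _ (smooth_bump_smooth 1)). Qed.

Definition mass : R := RI (- 1) 1 (@smooth_bump R).

Lemma mass_gt0 : 0 < mass.
Proof.
rewrite lt_neqAle RI_ge0 ?andbT; last by move=> x _; exact: bump_ge0.
apply/negP => /eqP/esym m0.
have h : (- 1 : R) < 1 by lra.
have := RI_eq0 h bump_cont (fun x _ => bump_ge0 x) m0 (x := 0).
have := @bump0_gt0 R; move=> /[swap] ->; rewrite ?ltxx //; lra.
Qed.

Definition rho x : R := mass^-1 * smooth_bump x.

Lemma rho_ge0 x : 0 <= rho x.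
Proof. by rewrite mulr_ge0 ?bump_ge0 // invr_ge0 ltW // mass_gt0. Qed.

Lemma rho_out x : 1 <= `|x| -> rho x = 0.
Proof. by move=> x1; rewrite /rho bump_out // mulr0. Qed.

Lemma rho_smooth n : smoothn n rho.
Proof. by apply: smoothnZ; exact: smooth_bump_smooth. Qed.

Lemma rho_cont : continuous rho.
Proof. exact: (@smoothn_cont 0 _ (rho_smooth 1)). Qed.

Lemma rho_le x : x <= - 1 -> rho x = 0.
Proof. by move=> x1; apply: rho_out; rewrite ler_normr; apply/orP; right; lra. Qed.

Definition step := primitive rho.

Lemma step_derive x : is_derive x 1 step (rho x).
Proof. by apply: primitive_derive; [exact: rho_cont|exact: rho_le]. Qed.

Lemma step_cont : continuous step.
Proof. by move=> x; exact: is_derive_cont (step_derive x). Qed.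

Lemma step_le x : x <= - 1 -> step x = 0.
Proof. by apply: primitive_le; exact: rho_le. Qed.

Lemma stepB x y : x <= y -> step y - step x = RI x y rho.
Proof.
move=> xy; apply/esym/RI_ftc' => // [|z _]; last exact: step_derive.
exact/cont_within/rho_cont.
Qed.

Lemma step_ge1 x : 1 <= x -> step x = 1.
Proof.
move=> x1; have h1 : step 1 = 1.
  have h0 : (-1 : R) <= 1 by lra.
  have := stepB h0; rewrite (@step_le (- 1)) // subr0 => ->.
  by rewrite /rho RIZ ?mulVf ?gt_eqF ?mass_gt0 //; exact/cont_intble/bump_cont.
have := stepB x1; rewrite h1 => /eqP; rewrite subr_eq => /eqP ->.
rewrite (RI_eq (g := fun=> 0)) ?RI_cst ?mul0r ?add0r // => y /andP[y1 _].
by apply: rho_out; rewrite ler_normr y1.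
Qed.

Lemma step_nd x y : x <= y -> step x <= step y.
Proof.
by move=> xy; rewrite -subr_ge0 stepB // RI_ge0 // => z _; exact: rho_ge0.
Qed.

Lemma step_01 x : 0 <= step x <= 1.
Proof.
apply/andP; split.
  have [x1|x1] := leP x (- 1); first by rewrite step_le.
  by rewrite -(@step_le (- 1)) // step_nd // ltW.
have [x1|x1] := leP 1 x; first by rewrite step_ge1.
by rewrite -(@step_ge1 1) // step_nd // ltW.
Qed.

Definition ramp := primitive step.

Lemma ramp_derive x : is_derive x 1 ramp (step x).
Proof. by apply: primitive_derive; [exact: step_cont|exact: step_le]. Qed.

Lemma ramp_smooth n : smoothn n ramp.
Proof.
apply/smoothn_le/primitive_smooth; [|exact: step_cont|exact: step_le].
apply/smoothn_le/primitive_smooth; [|exact: rho_cont|exact: rho_le].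
exact: rho_smooth.
Qed.

Lemma ramp_le x : x <= - 1 -> ramp x = 0.
Proof. by apply: primitive_le; exact: step_le. Qed.

Lemma rampB x y : x <= y -> ramp y - ramp x = RI x y step.
Proof.
move=> xy; apply/esym/RI_ftc' => // [|z _]; last exact: ramp_derive.
exact/cont_within/step_cont.
Qed.

Lemma ramp_lip x y : x <= y -> 0 <= ramp y - ramp x <= y - x.
Proof.
move=> xy; rewrite rampB // RI_ge0 ?andTb; last by move=> z _; have /andP[] := step_01 z.
have -> : y - x = RI x y (fun=> 1) by rewrite RI_cst // mul1r.
apply: RI_le.
- exact/cont_intble/step_cont.
- exact: intble_cst.
- by move=> z _; have /andP[] := step_01 z.
Qed.

Lemma ramp_ge x : 1 <= x -> ramp x = ramp 1 + (x - 1).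
Proof.
move=> x1; have := rampB x1; rewrite (RI_eq (g := fun=> 1)) ?RI_cst //; first by lra.
by move=> y /andP[y1 _]; rewrite step_ge1.
Qed.

Lemma ramp_pos x : `|ramp x - Num.max 0 x| <= 2.
Proof.
have r1 : 0 <= ramp 1 <= 2.
  have h0 : (-1 : R) <= 1 by lra.
  by have := ramp_lip h0; rewrite (@ramp_le (- 1)) // subr0; lra.
have [x1|x1] := leP x (- 1).
  by rewrite ramp_le // max_l ?subrr ?normr0 //; lra.
have [x2|x2] := leP 1 x.
  rewrite ramp_ge // max_r ?ler_norml; last by lra.
  by apply/andP; split; lra.
have := ramp_lip (ltW x1); rewrite (@ramp_le (- 1)) // subr0 => /andP[r0 rx].
rewrite ler_norml; have [?|?] := leP 0 x; apply/andP; split; lra.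
Qed.

(** Rescalings to width [e] around [x0]: the second derivative of the smoothed positive part
    [rampe e x0] is [rhoe e x0], an approximate Dirac mass. *)
Definition rhoe e x0 x : R := e^-1 * rho (e^-1 * x + - (e^-1 * x0)).
Definition rampe e x0 x : R := e * ramp (e^-1 * x + - (e^-1 * x0)).

Lemma rampe_smooth n e x0 : smoothn n (rampe e x0).
Proof. by apply: smoothnZ; apply: smoothn_aff; exact: ramp_smooth. Qed.

Lemma rhoe_cont e x0 : continuous (rhoe e x0).
Proof.
apply: (@smoothn_cont 0); apply: smoothnZ; apply: smoothn_aff; exact: rho_smooth.
Qed.

Lemma affE e x0 x : e^-1 * x + - (e^-1 * x0) = (x - x0) / e.
Proof. by rewrite mulrBl ![e^-1 * _]mulrC. Qed.

Lemma rampe_le e x0 x : 0 < e -> x <= x0 - e -> rampe e x0 x = 0.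
Proof.
move=> e0 xx; rewrite /rampe affE ramp_le ?mulr0 // ler_pdivrMr //; lra.
Qed.

(** The offset [e * (ramp 1 - 1)] does not depend on [x0], so it cancels in differences of two
    ramps; this lets combinations of ramps vanish exactly past their last corner. *)
Lemma rampe_ge e x0 x : 0 < e -> x0 + e <= x ->
  rampe e x0 x = e * (ramp 1 - 1) + (x - x0).
Proof.
move=> e0 xx; rewrite /rampe affE ramp_ge ?ler_pdivlMr; [|lra|lra].
by rewrite addrA addrAC mulrDr mulrCA mulfV ?mulr1 // gt_eqF.
Qed.

Lemma rampe_pos e x0 x : 0 < e -> `|rampe e x0 x - Num.max 0 (x - x0)| <= 2 * e.
Proof.
move=> e0; have := ramp_pos ((x - x0) / e).
have -> : Num.max 0 ((x - x0) / e) = Num.max 0 (x - x0) / e.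
  by rewrite maxr_pMl ?mul0r // invr_ge0 ltW.
rewrite /rampe affE => h.
rewrite (_ : _ - _ = e * (ramp ((x - x0) / e) - Num.max 0 (x - x0) / e)); last first.
  by rewrite mulrBr [e * (_ / e)]mulrCA mulfV ?mulr1 // gt_eqF.
by rewrite normrM gtr0_norm // mulrC ler_pM2r.
Qed.

Lemma rampe_lip e x0 x y : 0 < e -> x <= y ->
  0 <= rampe e x0 y - rampe e x0 x <= y - x.
Proof.
move=> e0 xy; rewrite /rampe !affE -mulrBr.
have h : (x - x0) / e <= (y - x0) / e by rewrite ler_pM2r ?invr_gt0 //; lra.
have /andP[h1 h2] := ramp_lip h.
rewrite mulr_ge0 ?(ltW e0) //= -ler_pdivlMl //; apply: le_trans h2 _.
by rewrite -mulrBl mulrC ler_pM2l ?invr_gt0 //; lra.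
Qed.

Lemma rampe_shift e x0 x1 x : rampe e x1 x = rampe e x0 (x - x1 + x0).
Proof. by rewrite /rampe !affE addrK. Qed.

Lemma rhoe_mass e x0 : 0 < e -> e <= x0 -> x0 <= 1 - e -> RI 0 1 (rhoe e x0) = 1.
Proof.
move=> e0 h1 h2.
have hd x : 0 <= x <= 1 ->
    is_derive x 1 (fun x => step (e^-1 * x + - (e^-1 * x0))) (rhoe e x0 x).
  by move=> _; apply: is_derive_eq (idcomp_aff (step_derive _)) _; rewrite mulrC.
rewrite (RI_ftc' ler01 (cont_within (@rhoe_cont e x0)) hd).
rewrite step_ge1 ?step_le ?subr0 // !affE ?ler_pdivrMr ?ler_pdivlMr //; lra.
Qed.

Lemma rhoe_approx w x0 d : continuous w -> 0 < x0 < 1 -> 0 < d ->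
  exists2 e0, 0 < e0 & forall e, 0 < e -> e < e0 ->
    `|RI 0 1 (fun x => w x * rhoe e x0 x) - w x0| <= d.
Proof.
move=> cw /andP[x00 x01] d0.
have /cvgrPdist_le /(_ d d0) [r /= r0 Hr] := cw x0.
exists (Num.min r (Num.min x0 (1 - x0))).
  by rewrite !lt_min r0 x00 subr_gt0.
move=> e e0; rewrite !lt_min => /andP[er /andP[ex0 ex1]].
have ci : continuous (rhoe e x0) by exact: rhoe_cont.
have m1 : RI 0 1 (rhoe e x0) = 1 by apply: rhoe_mass => //; lra.
have -> : w x0 = RI 0 1 (fun x => w x0 * rhoe e x0 x).
  by rewrite RIZ ?m1 ?mulr1 //; exact: cont_intble.
have i1 : intble 0 1 (fun x => w x * rhoe e x0 x).
  by apply: cont_intble => x; apply: cvgM; [exact: cw|exact: ci].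
have i2 : intble 0 1 (fun x => w x0 * rhoe e x0 x).
  by apply/intbleZ/cont_intble.
rewrite -RIB //.
have iB := intbleB i1 i2.
have iN : intble 0 1 (fun x => `|w x * rhoe e x0 x - w x0 * rhoe e x0 x|).
  exact: (integrable_abse iB).
apply: (@le_trans _ _ (RI 0 1 (fun x => `|w x * rhoe e x0 x - w x0 * rhoe e x0 x|))).
  exact: le_normr_Rintegral.
have -> : d = RI 0 1 (fun x => d * rhoe e x0 x).
  by rewrite RIZ ?m1 ?mulr1 //; exact: cont_intble.
apply: RI_le; [exact: iN|exact/intbleZ/cont_intble|].
move=> x _; rewrite -mulrBl normrM.
have r_ge0 : 0 <= rhoe e x0 x by rewrite mulr_ge0 ?rho_ge0 // invr_ge0 ltW.
rewrite (ger0_norm r_ge0).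
have [xe|xe] := ltP `|x - x0| e.
  rewrite ler_wpM2r // distrC; apply: Hr => /=; rewrite distrC; lra.
rewrite /rhoe affE rho_out ?mulr0 //.
by rewrite normrM normfV (gtr0_norm e0) ler_pdivlMr ?mul1r.
Qed.

(** A trapezoid: it rises from 0 at [a] to [c - s] at [b], stays there up to [s], and descends with
    slope -1 to 0 at [c]. Its second derivative is a combination of Dirac masses at the corners. For
    [a], [b] near 0 and [c] near 1 it is close to [1 - max(x, s)] away from the ends. *)
Definition tent a b s c x : R :=
  (c - s) / (b - a) * (Num.max 0 (x - a) - Num.max 0 (x - b))
  - (Num.max 0 (x - s) - Num.max 0 (x - c)).

Lemma combo_bound k d ra rb rs rc wa wb ws wc : 0 < k ->
  `|ra - wa| <= d -> `|rb - wb| <= d -> `|rs - ws| <= d -> `|rc - wc| <= d ->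
  `|k * (ra - rb) - (rs - rc) - (wc - ws - k * (wb - wa))| <= 2 * (k + 1) * d.
Proof.
rewrite !ler_norml => k0 /andP[A1 A2] /andP[B1 B2] /andP[S1 S2] /andP[C1 C2].
have -> : k * (ra - rb) - (rs - rc) - (wc - ws - k * (wb - wa)) =
  k * ((ra - wa) - (rb - wb)) - ((rs - ws) - (rc - wc)) by ring.
have hk1 : k * ((ra - wa) - (rb - wb)) <= k * (2 * d) by rewrite ler_pM2l //; lra.
have hk2 : k * - (2 * d) <= k * ((ra - wa) - (rb - wb)) by rewrite ler_pM2l //; lra.
have -> : 2 * (k + 1) * d = k * (2 * d) + 2 * d by ring.
have h : k * - (2 * d) = - (k * (2 * d)) by ring.
by move: hk1 hk2; rewrite h => hk1 hk2; apply/andP; split; lra.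
Qed.

(** Each positive part of [tent] is replaced by a ramp of one common width [e]. Nonnegativity and
    compact support in (0, 1) hold exactly, the values and the pairing with [w] up to [d]. *)
Lemma tent_test w a b s c d : continuous w -> 0 < a -> a < b -> b < s -> s < c -> c < 1 ->
  0 < d -> exists T : R -> R,
  [/\ test_fun T, forall x, 0 <= T x, forall x, `|T x - tent a b s c x| <= d,
     continuous T /\ continuous (derive1 (derive1 T)) &
     `|RI 0 1 (fun x => w x * derive1 (derive1 T) x) -
       (w c - w s - (c - s) / (b - a) * (w b - w a))| <= d].
Proof.
move=> cw a0 ab bs sc c1 d0.
pose k := (c - s) / (b - a).
have k0 : 0 < k by rewrite /k divr_gt0 ?subr_gt0.
have kk : k * (b - a) = c - s by rewrite /k mulfVK // subr_eq0 gt_eqF.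
pose d' := d / (2 * (k + 1)).
have d'0 : 0 < d' by rewrite /d' divr_gt0 //; lra.
have dd : 2 * (k + 1) * d' = d.
  by rewrite /d' mulrCA mulfV ?mulr1 // gt_eqF //; lra.
have Ha : 0 < a < 1 by lra.
have Hb : 0 < b < 1 by lra.
have Hs : 0 < s < 1 by lra.
have Hc : 0 < c < 1 by lra.
have [ea ea0 Ea] := rhoe_approx cw Ha d'0.
have [eb eb0 Eb] := rhoe_approx cw Hb d'0.
have [es es0 Es] := rhoe_approx cw Hs d'0.
have [ec ec0 Ec] := rhoe_approx cw Hc d'0.
(* The first four bounds serve [rhoe_approx] at the corners; [d' / 2] pays for the error [2 * e] of
   [rampe_pos]; [a] and [1 - c] keep the support inside (0, 1); [2 * e < s - b] ends the rise before
   the descent begins. *)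
have [e e0 [eea eeb ees eec ex]] : exists2 e : R, 0 < e &
   [/\ e < ea, e < eb, e < es, e < ec & [/\ e < d' / 2, e < a, e < 1 - c & 2 * e < s - b]].
  pose m := Num.min ea (Num.min eb (Num.min es (Num.min ec (Num.min (d' / 2)
    (Num.min a (Num.min (1 - c) ((s - b) / 2))))))).
  have m0 : 0 < m.
    by rewrite /m !lt_min ea0 eb0 es0 ec0 a0 /=; apply/and3P; split; lra.
  have : m / 2 < m by lra.
  rewrite {2}/m !lt_min => /andP[h1 /andP[h2 /andP[h3 /andP[h4 /andP[h5 /andP[h6 /andP[h7 h8]]]]]]].
  exists (m / 2); first by lra.
  by split=> //; split=> //; lra.
have [ed eaa ec1 ebs] := ex.
pose T x := k * (rampe e a x + - 1 * rampe e b x) + - 1 * (rampe e s x + - 1 * rampe e c x).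
have smT n : smoothn n T.
  have h x0 := rampe_smooth n e x0.
  exact: (smoothnD (smoothnZ k (smoothnD (h a) (smoothnZ (- 1) (h b))))
    (smoothnZ (- 1) (smoothnD (h s) (smoothnZ (- 1) (h c))))).
have D2 x : derive1 (derive1 T) x =
    k * (rhoe e a x - rhoe e b x) - (rhoe e s x - rhoe e c x).
  have h1 x0 y : is_derive y 1 (rampe e x0) (step (e^-1 * y + - (e^-1 * x0))).
    apply: is_derive_eq (idZ e (idcomp_aff (ramp_derive _))) _.
    by rewrite mulrCA mulfV ?mulr1 // gt_eqF.
  have h2 x0 y : is_derive y 1 (fun y => step (e^-1 * y + - (e^-1 * x0))) (rhoe e x0 y).
    by apply: is_derive_eq (idcomp_aff (step_derive _)) _; rewrite mulrC.
  have := derive1_fun (fun y => idD (idZ k (idD (h1 a y) (idZ (- 1) (h1 b y))))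
     (idZ (-1) (idD (h1 s y) (idZ (-1) (h1 c y))))).
  rewrite -/T => ->.
  have := derive1_fun (fun y => idD (idZ k (idD (h2 a y) (idZ (- 1) (h2 b y))))
     (idZ (-1) (idD (h2 s y) (idZ (-1) (h2 c y))))).
  by move=> ->; ring.
have TE x : T x = k * (rampe e a x - rampe e b x) - (rampe e s x - rampe e c x).
  by rewrite /T; ring.
have suppT x : ~ (a - e <= x <= c + e) -> T x = 0.
  move=> /negP; rewrite negb_and -!ltNge => /orP[xa|xc]; rewrite TE.
    rewrite !rampe_le //; [ring|lra..].
  rewrite !rampe_ge //; [|lra..].
  transitivity (k * (b - a) - (c - s)); first by ring.
  by rewrite kk subrr.
exists T; split.
- split; first by move=> n x; exact: (smoothn_iter (smT n.+1)).
  exists (a - e), (c + e); split; first by lra.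
  by split; [lra|split; [lra|exact: suppT]].
- move=> x; rewrite TE.
  (* The rise is a difference of translates of a nondecreasing function. From [s - e] on it has its
     full height [c - s], and the descent, a difference of translates of a 1-Lipschitz function,
     never exceeds that. *)
  have Hab : 0 <= rampe e a x - rampe e b x.
    rewrite (rampe_shift _ a b).
    have h : x - b + a <= x by lra.
    by have /andP[] := rampe_lip a e0 h.
  have [xs|xs] := leP x (s - e).
    rewrite (@rampe_le e s) // (@rampe_le e c) //; last by lra.
    by rewrite !subr0 mulr_ge0 // ltW.
  have -> : rampe e a x - rampe e b x = b - a.
    rewrite !rampe_ge //; [ring|lra..].
  rewrite kk (rampe_shift _ s c).
  have h : x - c + s <= x by lra.
  have /andP[_] := rampe_lip s e0 h; lra.
- move=> x; rewrite TE /tent -/k.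
  have h x0 := rampe_pos x0 x e0.
  have h' x0 : `|rampe e x0 x - Num.max 0 (x - x0)| <= d' by apply: le_trans (h x0) _; lra.
  rewrite -dd (_ : _ - (Num.max 0 (x - s) - _) = Num.max 0 (x - c) - Num.max 0 (x - s) -
    k * (Num.max 0 (x - b) - Num.max 0 (x - a))); last by ring.
  by apply: combo_bound.
- split; first exact: (@smoothn_cont 0 _ (smT 1%N)).
  have := smT 3%N => -[T1 [hT1 [T2 [hT2 nT2]]]].
  rewrite (derive1_fun hT1) (derive1_fun hT2); exact: (@smoothn_cont 0).
- have cwi x0 : intble 0 1 (fun x => w x * rhoe e x0 x).
    by apply: cont_intble => x; apply: cvgM; [exact: cw|exact: rhoe_cont].
  rewrite (RI_eq (g := fun x => k * (w x * rhoe e a x - w x * rhoe e b x)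
      - (w x * rhoe e s x - w x * rhoe e c x))); last first.
    by move=> x _; rewrite D2; ring.
  have iab := intbleB (cwi a) (cwi b).
  have isc := intbleB (cwi s) (cwi c).
  rewrite RIB ?RIZ ?RIB //; last exact: intbleZ.
  rewrite -dd; apply: combo_bound k0 _ _ _ _; [exact: Ea|exact: Eb|exact: Es|exact: Ec].
Qed.

End Tents.

(** * Concave non-increasing functions and the cone generated by hinges *)

Section Concave.
Context {R : realType}.
Implicit Types (f g p : R -> R) (a b c d e s x y z t : R).

Lemma within_contP f a b x e : {within `[a, b], continuous f} -> a <= x <= b -> 0 < e ->
  exists2 d, 0 < d & forall y, a <= y <= b -> `|x - y| < d -> `|f x - f y| <= e.
Proof.
move=> /subspace_continuousP cf xab e0.
have h : `[a, b]%classic x by rewrite /= in_itv.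
have /cvgrPdist_le /(_ e e0) [d /= d0 Hd] := cf x h.
exists d => // y yab xy; apply: Hd => //; by rewrite /= in_itv.
Qed.

Lemma Cset_slope f x y z : Cset f -> 0 <= x -> x < y -> y < z -> z <= 1 ->
  (f x - f y) * (z - y) <= (f y - f z) * (y - x).
Proof.
move=> [_ [_ [_ cf]]] x0 xy yz z1.
pose t := (z - y) / (z - x).
have zx : 0 < z - x by lra.
have tE : t * (z - x) = z - y by rewrite /t mulfVK ?gt_eqF.
have t01 : 0 <= t <= 1.
  by rewrite /t ler_pdivrMr // divr_ge0 //=; lra.
have hx : 0 <= x <= 1 by lra.
have hz : 0 <= z <= 1 by lra.
have := cf x z t hx hz t01.
have -> : t * x + (1 - t) * z = y by move: tE; rewrite mulrBr; lra.
move=> h.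
have h2 : (t * f x + (1 - t) * f z) * (z - x) <= f y * (z - x) by rewrite ler_pM2r.
have e1 : (t * f x + (1 - t) * f z) * (z - x) = (z - y) * f x + (y - x) * f z.
  transitivity ((t * (z - x)) * f x + ((z - x) - t * (z - x)) * f z); first by ring.
  by rewrite tE; ring.
rewrite e1 in h2; lra.
Qed.

(** For [0 < s < 1], minus its second derivative is the Dirac mass at [s]: such functions span
    extreme rays of the cone. *)
Definition hinge s x : R := 1 - Num.max x s.

Lemma hinge_cont s : continuous (hinge s).
Proof.
move=> x; apply: cvgB; first exact: cvg_cst.
apply: (@continuous_max R R id (cst s) x); [exact: cvg_id|exact: cvg_cst].
Qed.

Lemma hinge_ni s x y : x <= y -> hinge s y <= hinge s x.
Proof.
by move=> xy; rewrite /hinge lerD2l lerN2 ge_max !le_max xy lexx /= orbT.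
Qed.

(* Piecewise linear interpolation of f at the nodes i/n; the coefficients of
   the hinges are the (nonnegative) slope decrements. *)
Lemma cone_approx f e : Cset f -> 0 < e -> exists n (m s : nat -> R),
  (forall i, (i < n)%N -> 0 <= m i /\ 0 <= s i < 1) /\
  forall x, 0 <= x <= 1 ->
    `|f x - (f 1 + \sum_(i < n) m i * hinge (s i) x)| <= e.
Proof.
move=> Cf e0; have [cf [f0 [fni _]]] := Cf.
(* The last decrement of [f] over a grid of step [1 / n] is made small. By concavity it is the
   largest one, so it bounds the error on every cell. *)
have [n n0 fn] : exists2 n, (0 < n)%N & f (1 - n%:R^-1) - f 1 <= e.
  have h11 : 0 <= (1 : R) <= 1 by rewrite ler01 lexx.
  have [d d0 Hd] := within_contP cf h11 e0.
  pose n := (Num.Def.archi_bound (d^-1)).+1; exists n => //.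
  have nd : n%:R^-1 < d.
    rewrite -[d]invrK ltf_pV2 ?posrE ?invr_gt0 ?ltr0n //.
    apply: lt_trans (_ : (Num.Def.archi_bound (d^-1))%:R < _); last by rewrite ltr_nat.
    by apply: Num.Theory.archi_boundP; rewrite invr_ge0 ltW.
  have n1 : (n%:R : R)^-1 <= 1 by rewrite invf_le1 ?ler1n ?ltr0n.
  have np : 0 < (n%:R : R)^-1 by rewrite invr_gt0 ltr0n.
  have e1 : 1 - (1 - n%:R^-1) = n%:R^-1 :> R by ring.
  have := Hd (1 - n%:R^-1); rewrite e1 gtr0_norm //.
  rewrite subr_ge0 n1 lerBlDr lerDl (ltW np) => /(_ isT nd).
  by rewrite ler_norml => /andP[]; lra.
have nR : 0 < n%:R :> R by rewrite ltr0n.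
pose s i : R := i%:R / n%:R.
pose D i := f (s i) - f (s i.+1).
pose Dm i := if i is j.+1 then D j else 0.
pose m i := n%:R * (D i - Dm i).
have sS i : s i.+1 = s i + n%:R^-1 by rewrite /s -natr1 mulrDl mul1r.
have sn : s n = 1 by rewrite /s mulfV ?gt_eqF.
have s_ge0 i : 0 <= s i by rewrite /s divr_ge0 ?ler0n.
have np : 0 < (n%:R : R)^-1 by rewrite invr_gt0.
have s_le i j : (i <= j)%N -> s i <= s j.
  by move=> ij; rewrite /s ler_wpM2r ?(ltW np) // ler_nat.
have s_le1 i : (i <= n)%N -> s i <= 1 by move=> /s_le; rewrite sn.
have D0 i : (i < n)%N -> 0 <= D i.
  move=> i_n; rewrite subr_ge0; apply: fni => //; [exact: s_le|exact: s_le1].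
have Dnd i : (i.+1 < n)%N -> D i <= D i.+1.
  move=> i_n.
  have l1 : s i < s i.+1 by rewrite (sS i) ltrDl.
  have l2 : s i.+1 < s i.+2 by rewrite (sS i.+1) ltrDl.
  have e1 : s i.+2 - s i.+1 = n%:R^-1 by rewrite (sS i.+1); ring.
  have e2 : s i.+1 - s i = n%:R^-1 by rewrite (sS i); ring.
  by have := Cset_slope Cf (s_ge0 i) l1 l2 (s_le1 _ i_n); rewrite e1 e2 ler_pM2r.
have DndW j i : (i <= j)%N -> (j < n)%N -> D i <= D j.
  elim: j => [|j IH]; first by rewrite leqn0 => /eqP ->.
  rewrite leq_eqVlt => /orP[/eqP -> //|ij jn].
  by apply: le_trans (IH _ (ltnW jn)) (Dnd _ jn).
have De i : (i < n)%N -> D i <= e.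
  move=> i_n; apply: le_trans (DndW n.-1 i _ _) _.
  - by rewrite -ltnS prednK.
  - by rewrite prednK.
  - have := sS n.-1; rewrite /D prednK // sn => h.
    by have -> : s n.-1 = 1 - n%:R^-1 by lra.
exists n, m, s; split.
  move=> i i_n; split.
    rewrite /m mulr_ge0 ?(ltW nR) // subr_ge0; case: i i_n => [|i] i_n /=; first exact: D0.
    exact: Dnd.
  by rewrite s_ge0 /= /s ltr_pdivrMr // mul1r ltr_nat.
pose F x := f 1 + \sum_(i < n) m i * hinge (s i) x.
(* Summation by parts turns slope jumps against hinges into a sum over the decrements [D], which
   telescopes at the nodes. *)
have abel x k : \sum_(i < k) m i * hinge (s i) x =
    \sum_(i < k) n%:R * D i * (Num.max x (s i.+1) - Num.max x (s i))
      + n%:R * Dm k * hinge (s k) x.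
  elim: k => [|k IH]; first by rewrite !big_ord0 /= !mulr0 mul0r addr0.
  by rewrite !big_ord_recr /= IH /m /hinge; ring.
have tele j k : \sum_(i < k) n%:R * D i * (Num.max (s j) (s i.+1) - Num.max (s j) (s i)) =
    f (s j) - f (Num.max (s j) (s k)).
  elim: k => [|k IH].
    by rewrite big_ord0 max_l ?subrr // s_le.
  rewrite big_ord_recr /= IH.
  have [kj|jk] := ltnP k j.
    have h1 := s_le _ _ kj; have h2 := s_le _ _ (ltnW kj).
    by rewrite (max_l h1) (max_l h2); ring.
  have h1 := s_le _ _ jk; have h2 := s_le _ _ (leq_trans jk (leqnSn k)).
  have h3 : s k.+1 - s k = n%:R^-1 by rewrite sS; ring.
  rewrite (max_r h1) (max_r h2) h3 /D mulrAC mulfV ?gt_eqF // mul1r; ring.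
have Fs j : (j <= n)%N -> F (s j) = f (s j).
  move=> jn; rewrite /F abel tele sn.
  have h := s_le1 _ jn; rewrite /hinge (max_r h).
  by ring.
have Fni x y : x <= y -> F y <= F x.
  move=> xy; rewrite /F lerD2l; apply: ler_sum => -[i i_n] _ /=.
  rewrite ler_wpM2l ?hinge_ni //.
  rewrite /m mulr_ge0 ?(ltW nR) // subr_ge0; case: i i_n => [|i] i_n /=; first exact: D0.
  exact: Dnd.
move=> x /andP[x0 x1].
have [j [jn sx xs]] : exists j, [/\ (j < n)%N, s j <= x & x <= s j.+1].
  have ex : exists k, (k < n)%N && (x <= s k.+1).
    by exists n.-1; rewrite prednK // sn x1 leqnn.
  case: (ex_minnP ex) => k /andP[kn xk] kmin; exists k; split => //.
  case: k kn xk kmin => [|k] kn xk kmin; first by rewrite /s mul0r.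
  rewrite leNgt; apply/negP => xk'.
  by have := kmin k; rewrite (ltnW kn) (ltW xk') ltnn => /(_ isT).
rewrite -/(F x).
(* [f] and the interpolant are non-increasing and agree at both ends of the cell, so they differ by
   at most the decrement there. *)
have := De j jn; rewrite /D -(Fs j (ltnW jn)) -(Fs j.+1 jn).
have := Fni _ _ sx; have := Fni _ _ xs.
have h1 : f x <= F (s j) by rewrite (Fs j (ltnW jn)); exact: fni.
have h2 : F (s j.+1) <= f x by rewrite (Fs j.+1 jn); apply: fni => //; exact: s_le1.
by move=> *; rewrite ler_norml; apply/andP; split; lra.
Qed.

(** The functionals in use are mostly integrals, linear where integrability is known, hence the
    restriction to continuous arguments. The sup bound on [0, 1] lets the approximation of
    [cone_approx] pass to the limit. *)
Record sup_cont_linear (L : (R -> R) -> R) : Prop := SupContLinear {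
  sclD : forall f g, continuous f -> continuous g -> L (fun x => f x + g x) = L f + L g;
  sclZ : forall (k : R) f, continuous f -> L (fun x => k * f x) = k * L f;
  scl_bound : exists B, forall f e, continuous f ->
    (forall x, 0 <= x <= 1 -> `|f x| <= e) -> `|L f| <= B * e }.

(** The functional is nonnegative on the approximants of [cone_approx], and [e] is chosen so that
    the error [B * e] cannot make up for a negative [L f]. *)
Lemma cone_ge0 L f : sup_cont_linear L -> Cset f -> continuous f ->
  0 <= L (fun=> 1) -> (forall s, 0 <= s < 1 -> 0 <= L (hinge s)) -> 0 <= L f.
Proof.
move=> [LD LZ [B LB]] Cf cf L1 Ls; rewrite leNgt; apply/negP => Lf.
have c1 (k : R) : continuous (fun _ : R => k) by move=> x; exact: cvg_cst.
have B0 : 0 <= B.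
  have := LB (fun=> 0) 1 (c1 0) (fun x _ => _); rewrite mulr1 => h.
  by apply: le_trans (h _) => // x; rewrite normr0.
pose e := - L f / (2 * (B + 1)).
have e0 : 0 < e by rewrite divr_gt0 ?oppr_gt0 //; lra.
have [n [m [s [ms Hx]]]] := cone_approx Cf e0.
pose S k x := f 1 + \sum_(i < k) m i * hinge (s i) x.
have S0 x : S 0%N x = f 1 by rewrite /S big_ord0 addr0.
have SS k x : S k.+1 x = S k x + m k * hinge (s k) x.
  by rewrite /S big_ord_recr /= addrA.
have cS k : continuous (S k).
  elim: k => [|k IH]; first by rewrite (_ : S 0%N = fun=> f 1) //; apply/funext.
  rewrite (_ : S k.+1 = fun x => S k x + m k * hinge (s k) x); last exact/funext.
  move=> x; apply: cvgD; first exact: IH.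
  by apply: cvgM; [exact: cvg_cst|exact: hinge_cont].
have f1 : 0 <= f 1 by case: Cf => _ [+ _]; apply; rewrite ler01 lexx.
have LS k : (k <= n)%N -> 0 <= L (S k).
  elim: k => [_|k IH kn].
    rewrite (_ : S 0%N = fun x => f 1 * 1); last by apply/funext => x; rewrite mulr1.
    by rewrite LZ // mulr_ge0.
  rewrite (_ : S k.+1 = fun x => S k x + m k * hinge (s k) x); last exact/funext.
  have cm : continuous (fun x => m k * hinge (s k) x).
    by move=> x; apply: cvgM; [exact: cvg_cst|exact: hinge_cont].
  rewrite LD // LZ; last exact: hinge_cont.
  by have [? ?] := ms k kn; rewrite addr_ge0 ?mulr_ge0 ?IH ?Ls // ltnW.
have cd : continuous (fun x => f x + -1 * S n x).
  by move=> x; apply: cvgD; [exact: cf|apply: cvgM; [exact: cvg_cst|exact: cS]].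
have := LB (fun x => f x + -1 * S n x) e cd.
rewrite LD //; last by move=> x; apply: cvgM; [exact: cvg_cst|exact: cS].
rewrite LZ // => h.
have : `|L f + -1 * L (S n)| <= B * e.
  by apply: h => x x01; rewrite mulN1r; exact: Hx.
have := LS n (leqnn n).
have : (B + 1) * e = - L f / 2.
  rewrite /e invfM mulrA -mulrA [(B+1) * _]mulrCA [(B + 1) * _]mulrC -mulrA mulVf ?mulr1 //.
  by rewrite gt_eqF //; lra.
rewrite mulrDl mul1r ler_norml => h1 h2 /andP[h3 _]; lra.
Qed.

End Concave.

(** * The right slope of a concave function and its Stieltjes measure *)

Section Slope.
Context {R : realType}.
Local Notation leb := (@lebesgue_measure R).
Implicit Types (f g F : R -> R) (a b d e s x y z t C M : R).

Definition chord f x y : R := (f x - f y) / (y - x).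

(** Minus the right derivative. For a concave function the descent rates [chord f x y] decrease as
    [y] decreases to [x], so the limit can be taken as an infimum. *)
Definition rslope f x : R :=
  inf [set q | exists2 y, x < y <= 1 & q = chord f x y].

Lemma chordE f x y : x < y -> chord f x y * (y - x) = f x - f y.
Proof. by move=> xy; rewrite /chord mulfVK // subr_eq0 gt_eqF. Qed.

Section RightSlope.
Variables (f : R -> R) (C : R).
Hypothesis Cf : Cset f.
Hypothesis fC : forall t, 0 <= t <= 1 -> f t - f 1 <= C * (1 - t).

Let fni x y : 0 <= x -> x <= y -> y <= 1 -> f y <= f x.
Proof. by case: Cf => _ [_ [+ _]]; exact. Qed.

Lemma rslope_le_chord x y : 0 <= x -> x < y -> y <= 1 -> rslope f x <= chord f x y.
Proof.
move=> x0 xy y1; apply: ge_inf; last by exists y; rewrite // xy.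
exists 0 => _ [z /andP[xz z1] ->].
by rewrite /chord divr_ge0 // subr_ge0; [apply: fni => //|]; exact: ltW.
Qed.

Lemma rslope_ge c x : x < 1 -> (forall y, x < y <= 1 -> c <= chord f x y) ->
  c <= rslope f x.
Proof.
move=> x1 H; apply: lb_le_inf.
  by exists (chord f x 1), 1; rewrite // x1 lexx.
by move=> _ [y xy ->]; exact: H.
Qed.

Lemma rslope_ge0 x : 0 <= x -> x < 1 -> 0 <= rslope f x.
Proof.
move=> x0 x1; apply: rslope_ge => // y /andP[xy y1].
by rewrite /chord divr_ge0 // subr_ge0; [apply: fni => //|]; exact: ltW.
Qed.

Lemma rslope_leC x : 0 <= x -> x < 1 -> rslope f x <= C.
Proof.
move=> x0 x1; apply: le_trans (rslope_le_chord x0 x1 (lexx 1)) _.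
by rewrite /chord ler_pdivrMr ?subr_gt0 //; apply: fC; rewrite x0 ltW.
Qed.

Lemma chord_le_rslope x y : 0 <= x -> x < y -> y < 1 -> chord f x y <= rslope f y.
Proof.
move=> x0 xy y1; apply: rslope_ge => // z /andP[yz z1].
have := Cset_slope Cf x0 xy yz z1.
by rewrite /chord ler_pdivrMr ?subr_gt0 // mulrAC ler_pdivlMr ?subr_gt0.
Qed.

Lemma rslope_nd x y : 0 <= x -> x <= y -> y < 1 -> rslope f x <= rslope f y.
Proof.
move=> x0; rewrite le_eqVlt => /orP[/eqP -> //|xy] y1.
by apply: le_trans (rslope_le_chord x0 xy (ltW y1)) (chord_le_rslope x0 xy y1).
Qed.

(** A chord nearly attaining the infimum at [x] keeps almost the same rate when its left end moves
    slightly to the right. *)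
Lemma rslope_rc x e : 0 <= x -> x < 1 -> 0 < e ->
  exists2 d, 0 < d & forall y, x < y -> y < x + d -> rslope f y <= rslope f x + e.
Proof.
move=> x0 x1 e0.
have [q [z /andP[xz z1] ->] qz] : exists2 q, [set q | exists2 y, x < y <= 1 & q = chord f x y] q
    & q < rslope f x + e / 2.
  apply: inf_adherent; first by rewrite divr_gt0.
  split; first by exists (chord f x 1), 1; rewrite // x1 lexx.
  exists 0 => _ [y /andP[xy y1] ->].
  by rewrite /chord divr_ge0 // subr_ge0; [apply: fni => //|]; exact: ltW.
have q0 : 0 <= chord f x z.
  by rewrite /chord divr_ge0 // subr_ge0; [apply: fni => //|]; exact: ltW.
have D0 : 0 < chord f x z + e / 2 by lra.
have zx : 0 < z - x by lra.
(* With this [d], shortening the chord by less than [d] raises its rate by at most [e / 2]. *)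
pose d := e / 2 * (z - x) / (chord f x z + e / 2).
have d0 : 0 < d by rewrite /d divr_gt0 // mulr_gt0 // divr_gt0.
have dE : (chord f x z + e / 2) * d = e / 2 * (z - x).
  by rewrite /d mulrCA mulfV ?mulr1 // gt_eqF.
exists (Num.min d (z - x)); first by rewrite lt_min d0.
move=> y xy yd.
have yd1 : y - x < d by move: yd; rewrite -ltrBlDl lt_min => /andP[].
have yz : y < z by move: yd; rewrite -ltrBlDl lt_min => /andP[_]; lra.
have y0 : 0 <= y by lra.
apply: le_trans (rslope_le_chord y0 yz z1) _.
suff : chord f y z <= chord f x z + e / 2 by lra.
rewrite {1}/chord ler_pdivrMr ?subr_gt0 //.
have h1 : f y - f z <= f x - f z by rewrite lerD2r fni // ?ltW //; lra.
apply: le_trans h1 _; rewrite -chordE //.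
have : (chord f x z + e / 2) * (y - x) <= e / 2 * (z - x).
  by rewrite -dE ler_pM2l // ltW.
move: (chord f x z) => r; lra.
Qed.

(* The slope is frozen outside (0, 1), so that its Stieltjes measure does not
   charge the complement of (0, 1). *)
Lemma concave_slope : exists F : R -> R,
  [/\ {homo F : x y / x <= y},
      forall x e, 0 < e -> exists2 d, 0 < d & forall y, x < y -> y < x + d -> F y <= F x + e,
      (forall x, 0 <= F x <= C),
      (forall x, x <= 0 -> F x = F 0) /\ (forall x, 1 <= x -> F x = F 1) &
      [/\ forall e, 0 < e -> exists2 t, 0 <= t < 1 & F 1 <= F t + e,
       forall x y, 0 <= x -> x <= y -> y <= 1 -> F x * (y - x) <= f x - f y,
       forall x y, 0 <= x -> x <= y -> y <= 1 -> f x - f y <= F y * (y - x) &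
       forall x, 0 <= x < 1 -> F x = rslope f x]].
Proof.
pose E := [set q | exists2 t, 0 <= t < 1 & q = rslope f t].
have z01 : 0 <= (0 : R) < 1 by rewrite lexx ltr01.
have supE : has_sup E.
  split; first by exists (rslope f 0), 0.
  by exists C => _ [t /andP[t0 t1] ->]; exact: rslope_leC.
pose S := sup E.
have Sub t : 0 <= t -> t < 1 -> rslope f t <= S.
  by move=> t0 t1; apply: sup_upper_bound => //; exists t; rewrite // t0.
have SC : S <= C.
  by apply: ge_sup; [case: supE|move=> _ [t /andP[t0 t1] ->]; exact: rslope_leC].
pose F x := if x <= 0 then rslope f 0 else if x < 1 then rslope f x else S.
have F01 x : 0 <= x -> x < 1 -> F x = rslope f x.
  move=> x0 x1; rewrite /F; case: ifP => [x0'|]; last by rewrite x1.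
  by congr rslope; apply/le_anti; rewrite x0 x0'.
have F0 x : x <= 0 -> F x = rslope f 0 by rewrite /F => ->.
have F1 x : 1 <= x -> F x = S.
  by move=> x1; rewrite /F !ifF //; apply/negbTE; rewrite -?leNgt // -ltNge; lra.
have Fnd x y : x <= y -> F x <= F y.
  move=> xy.
  have [x1|x1] := leP 1 x; first by rewrite !F1 //; lra.
  have [x0|x0] := leP x 0.
    rewrite (F0 x) //; have [y0|y0] := leP y 0; first by rewrite F0.
    have [y1|y1] := leP 1 y; first by rewrite F1 // Sub.
    have y0' := ltW y0.
    by rewrite (F01 y y0' y1); apply: rslope_nd.
  have x0' := ltW x0.
  have [y1|y1] := leP 1 y; first by rewrite (F1 y) // (F01 x) // Sub.
  have y0' := le_trans x0' xy.
  by rewrite (F01 x) // (F01 y) //; apply: rslope_nd.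
have FB x y : 0 <= x -> x <= y -> y < 1 -> f x - f y <= F y * (y - x).
  move=> x0; rewrite le_eqVlt => /orP[/eqP -> _|xy y1]; first by rewrite !subrr mulr0.
  rewrite F01 //; last by lra.
  by rewrite -chordE // ler_pM2r ?subr_gt0 // chord_le_rslope.
exists F; split.
- exact: Fnd.
- move=> x e e0; have [x1|x1] := leP 1 x.
    exists 1 => // y xy _; have y1 := le_trans x1 (ltW xy).
    by rewrite (F1 x) // (F1 y) // lerDl ltW.
  have [x0|x0] := ltP x 0.
    exists (- x); first by lra.
    move=> y xy yx; have y0 : y <= 0 by lra.
    by rewrite (F0 x (ltW x0)) (F0 y y0) lerDl ltW.
  have [d d0 H] := rslope_rc x0 x1 e0.
  exists (Num.min d (1 - x)); first by rewrite lt_min d0 subr_gt0.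
  move=> y xy; rewrite -ltrBlDl lt_min => /andP[yd y1].
  have y0 : 0 <= y by lra.
  have yl1 : y < 1 by lra.
  by rewrite !F01 //; apply: H => //; lra.
- move=> x.
  have r0 : 0 <= rslope f 0 <= C by rewrite rslope_ge0 ?rslope_leC.
  have [x0|x0] := leP x 0; first by rewrite F0.
  have [x1|x1] := leP 1 x.
    by rewrite F1 // SC andbT; case/andP: r0 => r0 _; apply: le_trans r0 (Sub 0 _ _).
  have x0' := ltW x0.
  by rewrite F01 // rslope_ge0 // rslope_leC.
- by split=> x hx; [rewrite (F0 x hx) F0|rewrite (F1 x hx) F1].
- split.
  + move=> e e0; have [_ [t ht ->] h] := sup_adherent e0 supE.
    exists t => //; case/andP: ht => t0 t1.
    by rewrite F1 // (F01 t t0 t1) /S; move: h; move: (sup E) => r; lra.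
  + move=> x y x0; rewrite le_eqVlt => /orP[/eqP -> _|xy y1]; first by rewrite !subrr mulr0.
    rewrite F01 //; last by lra.
    by rewrite -chordE // ler_pM2r ?subr_gt0 // rslope_le_chord.
  + move=> x y x0 xy; rewrite le_eqVlt => /orP[/eqP y1|]; last exact: FB.
    rewrite {}y1 in xy *.
    have [x1|x1] := leP 1 x.
      have -> : x = 1 by apply/le_anti; rewrite x1 xy.
      by rewrite !subrr mulr0.
    rewrite leNgt; apply/negP => h.
    have [cf _] := (Cf).
    have h11 : 0 <= (1 : R) <= 1 by rewrite ler01 lexx.
    pose e := (f x - f 1 - F 1 * (1 - x)) / 2.
    have e0 : 0 < e by rewrite /e; lra.
    have [d d0 Hd] := within_contP cf h11 e0.
    pose y' := Num.max x (1 - d / 2).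
    have y1 : y' < 1 by rewrite /y' gt_max x1 /=; lra.
    have xy' : x <= y' by rewrite /y' le_max lexx.
    have dy : 1 - d / 2 <= y' by rewrite /y' le_max lexx orbT.
    have hy : 0 <= y' <= 1 by lra.
    have hd : `|1 - y'| < d by rewrite gtr0_norm; lra.
    have := Hd _ hy hd; rewrite ler_norml => /andP[h1 h2].
    have h3 := FB _ _ x0 xy' y1.
    have h4 : F y' * (y' - x) <= F 1 * (1 - x).
      have y0 : 0 <= y' := le_trans x0 xy'.
      have Fy0 : 0 <= F y' by rewrite (F01 y' y0 y1); exact: rslope_ge0.
      have Fy1 : F y' <= F 1 := Fnd _ _ (ltW y1).
      apply: (@le_trans _ _ (F 1 * (y' - x))).
        by rewrite ler_wpM2r // subr_ge0.
      by rewrite ler_wpM2l ?(le_trans Fy0) // lerD2r ltW.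
    have : 2 * e = f x - f 1 - F 1 * (1 - x) by rewrite /e; lra.
    move: (F 1 * _) (F y' * _) h4 h3 h1 h2 => A B h4 h3 h1 h2; lra.
  + by move=> x /andP[x0 x1]; rewrite F01.
Qed.

End RightSlope.

(** The last three hypotheses remove the mass outside (0, 1): [F] is constant on both outer
    half-lines, the left one including its end point 0, and left continuity of [F] at 1 excludes an
    atom there. *)
Lemma stieltjes_measure F : {homo F : x y / x <= y} ->
  (forall x e, 0 < e -> exists2 d, 0 < d & forall y, x < y -> y < x + d -> F y <= F x + e) ->
  (forall x, x <= 0 -> F x = F 0) -> (forall x, 1 <= x -> F x = F 1) ->
  (forall e, 0 < e -> exists2 t, 0 <= t < 1 & F 1 <= F t + e) ->
  exists mu : {measure set R -> \bar R},
    (forall a b, a <= b -> mu `]a, b]%classic = (F b - F a)%:E) /\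
    mu (~` `]0%R, 1%R[) = 0%E.
Proof.
move=> Fnd Frc F0 F1 Fl.
have rc : right_continuous F.
  move=> x; apply/cvgrPdist_le => e e0; have [d d0 H] := Frc x e e0.
  near=> y.
  have xy : x < y by near: y; exact: nbhs_right_gt.
  have yd : y < x + d by near: y; apply: nbhs_right_lt; lra.
  have := H y xy yd; have := Fnd _ _ (ltW xy).
  by rewrite ler_norml => *; apply/andP; split; lra.
pose Fc : cumulative R R := HB.pack F (isCumulative.Build R _ R F Fnd rc).
pose mu0 := [the measure (measurableTypeR R) R of lebesgue_stieltjes_measure Fc].
have mu00 : (mu0 : set R -> \bar R) set0 = 0%E by exact: measure0.
have mu0_ge0 (A : set R) : (0 <= (mu0 : set R -> \bar R) A)%E by exact: measure_ge0.
have mu0_sa : semi_sigma_additive (mu0 : set R -> \bar R).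
  exact: (@measure_semi_sigma_additive _ _ _ mu0).
pose mu : {measure set R -> \bar R} :=
  HB.pack (mu0 : set R -> \bar R) (isMeasure.Build _ _ _ (mu0 : set R -> \bar R) mu00 mu0_ge0 mu0_sa).
have muE a b : a <= b -> mu `]a, b]%classic = (F b - F a)%:E.
  move=> ab; rewrite /mu /= /lebesgue_stieltjes_measure /measure_extension.
  by rewrite measurable_mu_extE /= ?wlength_itv_bnd //; exact: is_ocitv.
exists mu; split => //.
have n0 (A : set R) : measurable A -> mu A = 0%E -> mu.-negligible A.
  by move=> mA A0; exact/negligibleP.
have sub : ~` `]0, 1[%classic `<=` (\bigcup_n `](- n%:R : R), 0]%classic) `|`
    ((\bigcup_n `](1 : R), 1 + n%:R]%classic) `|` [set 1 : R]).
  move=> x /=; rewrite in_itv /= => /negP; rewrite negb_and -!leNgt => /orP[x0|x1].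
    left; exists (Num.Def.archi_bound (- x)).+1 => //=; rewrite in_itv /= x0 andbT ltrNl.
    apply: lt_trans (_ : (Num.Def.archi_bound (- x))%:R < _); last by rewrite ltr_nat.
    by apply: Num.Theory.archi_boundP; rewrite oppr_ge0.
  right; have [->|x1'] := eqVneq x 1; first by right.
  left; exists (Num.Def.archi_bound (x - 1)) => //=; rewrite in_itv /= lt_neqAle eq_sym x1' x1 /=.
  by rewrite -lerBlDl ltW //; apply: Num.Theory.archi_boundP; rewrite subr_ge0.
have m1 : mu [set 1] = 0%E.
  apply/eqP; rewrite eq_le measure_ge0 andbT; apply/lee_addgt0Pr => e e0.
  have [t /andP[t0 t1] h] := Fl e e0.
  rewrite add0e; apply: (@le_trans _ _ (mu `]t, 1]%classic)).
    apply: le_measure; rewrite ?inE //.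
    by move=> x /= ->; rewrite in_itv /= t1 lexx.
  by rewrite (muE _ _ (ltW t1)) lee_fin; lra.
have neg : mu.-negligible (~` `]0, 1[%classic).
  apply: negligibleS sub _; apply: negligibleU; last apply: negligibleU.
  - apply: negligible_bigcup => n; apply: n0 => //.
    have h : - (n%:R : R) <= 0 by rewrite oppr_le0.
    by rewrite muE // (F0 _ h) subrr.
  - apply: negligible_bigcup => n; apply: n0 => //.
    have h : 1 <= 1 + (n%:R : R) by rewrite lerDl.
    by rewrite muE // (F1 _ h) subrr.
  - exact: n0.
by apply: (negligibleP _ _).1 neg; apply: measurableC.
Unshelve. all: by end_near. Qed.

End Slope.

(** * Integration by parts for a monotone slope *)

Section ByParts.
Context {R : realType}.
Implicit Types (x y z : R).
Variables (f F psi psi' : R -> R) (C M : R).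
Hypotheses (cf : continuous f) (cpsi' : continuous psi').
Hypothesis dpsi : forall x, is_derive x 1 psi (psi' x).
Hypothesis M0 : forall x, 0 <= x <= 1 -> `|psi x| <= M.
Hypothesis M1 : forall x, 0 <= x <= 1 -> `|psi' x| <= M.
Hypothesis Fnd : {homo F : x y / x <= y}.
Hypothesis FC : forall x, 0 <= F x <= C.

Let cpsi : continuous psi.
Proof. by move=> x; exact: is_derive_cont (dpsi x). Qed.

Let psi_lip x y : 0 <= x -> x <= y -> y <= 1 -> `|psi y - psi x| <= M * (y - x).
Proof.
move=> x0 xy y1; rewrite -(@RI_ftc' _ psi' psi x y) //; last exact: cont_within.
apply: RI_abs_le => // [|z /andP[xz zy]]; first exact: cont_intble.
by apply: M1; rewrite (le_trans x0 xz) (le_trans zy y1).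
Qed.

Lemma nd_intble g x y : 0 <= x -> y <= 1 -> continuous g ->
  (forall z, 0 <= z <= 1 -> `|g z| <= M) -> intble x y (fun z => F z * g z).
Proof.
move=> x0 y1 cg gM; apply: (@intble_bounded _ _ _ _ (C * M)).
  apply: measurable_funM; first exact: nondecreasing_measurable.
  by apply: subspace_continuous_measurable_fun => //; exact: cont_within.
move=> z /andP[xz zy]; rewrite normrM; have /andP[Fz0 FzC] := FC z.
rewrite (ger0_norm Fz0) ler_pM // gM //.
by rewrite (le_trans x0 xz) (le_trans zy y1).
Qed.

Lemma nd_intble1 x y : intble x y F.
Proof.
apply: (@intble_bounded _ _ _ _ C); first exact: nondecreasing_measurable.
by move=> z _; have /andP[Fz0 FzC] := FC z; rewrite ger0_norm.
Qed.

(** [f] need not be differentiable, so the product rule is replaced by [const_of_small]: the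
    increments of [G] over [[x, y]] are at most those of a monotone function times [y - x], because
    [f x - f y] lies between [F x * (y - x)] and [F y * (y - x)]. *)
Lemma slope_by_parts :
  (forall x y, 0 <= x -> x <= y -> y <= 1 -> F x * (y - x) <= f x - f y) ->
  (forall x y, 0 <= x -> x <= y -> y <= 1 -> f x - f y <= F y * (y - x)) ->
  RI 0 1 (fun x => f x * psi' x) =
  f 1 * psi 1 - f 0 * psi 0 + RI 0 1 (fun x => F x * psi x).
Proof.
move=> FA FB.
pose G x := f x * psi x + RI 0 x (fun z => F z * psi z) - RI 0 x (fun z => f z * psi' z).
(* [M * F] absorbs the oscillation of the slope on a cell, and the linear term the two errors from
   freezing [psi] and [f] at a cell end. *)
pose A x := M * F x + 2 * C * M * x.
have cfp : continuous (fun z => f z * psi' z) by move=> z; apply: cvgM; [exact: cf|exact: cpsi'].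
have M_ge0 : 0 <= M by apply: le_trans (M0 (x := 0) _); rewrite ?lexx ?ler01.
have C_ge0 : 0 <= C by have /andP[] := FC 0; exact: le_trans.
suff : G 1 = G 0 by rewrite /G !RI_pt; lra.
apply: (@const_of_small _ G A 0 1) => // x y x0 xy y1.
have y0 := le_trans x0 xy.
have iF u v : 0 <= u -> v <= 1 -> intble u v (fun z => F z * psi z).
  by move=> u0 v1; exact: nd_intble.
have if' u v : intble u v (fun z => f z * psi' z) by exact: cont_intble.
have E1 : G y - G x = f y * psi y - f x * psi x + RI x y (fun z => F z * psi z)
    - RI x y (fun z => f z * psi' z).
  rewrite /G (@RI_cat _ 0 x y (fun z => F z * psi z)) //; last exact: iF.
  by rewrite (@RI_cat _ 0 x y (fun z => f z * psi' z)) //; ring.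
have iF1 : intble x y (fun z => F z * (psi z - psi x)).
  apply: (@intble_bounded _ _ _ _ (C * (M * 1))).
    apply: measurable_funM; first exact: nondecreasing_measurable.
    apply: subspace_continuous_measurable_fun => //; apply: cont_within => z.
    by apply: cvgB; [exact: cpsi|exact: cvg_cst].
  move=> z /andP[xz zy]; rewrite normrM; have /andP[Fz0 FzC] := FC z.
  rewrite (ger0_norm Fz0) ler_pM //; apply: le_trans (psi_lip x0 xz (le_trans zy y1)) _.
  by rewrite ler_wpM2l //; lra.
have if1 : intble x y (fun z => (f z - f y) * psi' z).
  apply: cont_intble => z; apply: cvgM; last exact: cpsi'.
  by apply: cvgB; [exact: cf|exact: cvg_cst].
have E2 : RI x y (fun z => F z * psi z) =
    RI x y (fun z => F z * (psi z - psi x)) + psi x * RI x y F.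
  rewrite -RIZ; last exact: nd_intble1.
  rewrite -RID //; last by apply/intbleZ/nd_intble1.
  by apply: RI_eq => z _; ring.
have E3 : RI x y (fun z => f z * psi' z) =
    RI x y (fun z => (f z - f y) * psi' z) + f y * (psi y - psi x).
  rewrite -(@RI_ftc' _ psi' psi x y) //; last exact: cont_within.
  rewrite -RIZ; last exact: cont_intble.
  rewrite -RID //; last by apply/intbleZ/cont_intble.
  by apply: RI_eq => z _; ring.
have -> : G y - G x = RI x y (fun z => F z * (psi z - psi x)) +
    psi x * (RI x y F - (f x - f y)) - RI x y (fun z => (f z - f y) * psi' z).
  by rewrite E1 E2 E3; ring.
have yx : 0 <= y - x by rewrite subr_ge0.
have B1 : `|RI x y (fun z => F z * (psi z - psi x))| <= C * (M * (y - x)) * (y - x).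
  apply: RI_abs_le => // z /andP[xz zy]; have /andP[Fz0 FzC] := FC z.
  rewrite normrM (ger0_norm Fz0) ler_pM //.
  apply: le_trans (psi_lip x0 xz (le_trans zy y1)) _.
  by rewrite ler_wpM2l //; lra.
have B2 : `|RI x y (fun z => (f z - f y) * psi' z)| <= C * (y - x) * M * (y - x).
  apply: RI_abs_le => // z /andP[xz zy]; rewrite normrM.
  have z0 := le_trans x0 xz.
  apply: ler_pM => //; last by apply: M1; rewrite z0 (le_trans zy y1).
  have h1 := FB z y z0 zy y1; have h2 := FA z y z0 zy y1.
  have zy0 : 0 <= y - z by rewrite subr_ge0.
  have /andP[Fz0 _] := FC z; have /andP[_ FyC] := FC y.
  rewrite ger0_norm; last by apply: le_trans h2; rewrite mulr_ge0.
  apply: le_trans h1 _; apply: (@le_trans _ _ (C * (y - z))); first by rewrite ler_wpM2r.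
  by rewrite ler_wpM2l //; lra.
have B3 : `|psi x * (RI x y F - (f x - f y))| <= M * ((F y - F x) * (y - x)).
  rewrite normrM; apply: ler_pM => //.
    by apply: M0; rewrite x0 (le_trans xy y1).
  have iFF := nd_intble1 x y.
  have u1 : RI x y F <= F y * (y - x).
    rewrite -RI_cst //; apply: RI_le => //; first exact: intble_cst.
    by move=> z /andP[_]; exact: Fnd.
  have u2 : F x * (y - x) <= RI x y F.
    rewrite -RI_cst //; apply: RI_le => //; first exact: intble_cst.
    by move=> z /andP[+ _]; exact: Fnd.
  have h1 := FB x y x0 xy y1; have h2 := FA x y x0 xy y1.
  rewrite mulrBl; move: u1 u2 h1 h2; move: (F x * _) (F y * _) (RI x y F) => a b c.
  by move=> *; rewrite ler_norml; apply/andP; split; lra.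
apply: le_trans (ler_normB _ _) _; apply: le_trans (lerD (ler_normD _ _) (lexx _)) _.
apply: le_trans (lerD (lerD B1 B3) B2) _.
rewrite /A le_eqVlt; apply/orP; left; apply/eqP; ring.
Qed.

(** Again [const_of_small]: on each cell [psi] is frozen at the right end in the [mu] integral, and
    [F] at the left end in the Lebesgue integral. Each error is at most [M * (y - x) * (F y - F x)],
    whence the function [2 * M * F]. *)
Lemma stieltjes_by_parts (mu : {measure set R -> \bar R}) :
  (forall a b, a <= b -> mu `]a, b]%classic = (F b - F a)%:E) ->
  psi 0 = 0 -> psi 1 = 0 ->
  (\int[mu]_(x in `]0%R, 1%R[) (psi x)%:E = (- RI 0 1 (fun x => F x * psi' x))%:E)%E.
Proof.
move=> muE p0 p1.
have ->: (\int[mu]_(x in `]0%R, 1%R[) (psi x)%:E = \int[mu]_(x in `]0%R, 1%R]) (psi x)%:E)%E.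
  rewrite integral_mkcond [RHS]integral_mkcond; apply: eq_integral => x _.
  rewrite !patchE; have [->|x1] := eqVneq x 1.
    by rewrite p1; do 2 case: ifP.
  rewrite (_ : (x \in `]0%R, 1%R[%classic) = (x \in `]0%R, 1%R]%classic)) //.
  apply/idP/idP; rewrite !inE /= !in_itv /= => /andP[-> h] //=; first exact: ltW.
  by rewrite lt_neqAle x1.
have mpsi : measurable_fun setT psi by exact: continuous_measurable_fun.
have fin_oc x y : (mu `]x, y]%classic < +oo)%E.
  have [xy|yx] := leP x y; first by rewrite muE // ltry.
  by rewrite set_itv_ge ?measure0 // bnd_simp -leNgt ltW.
have ib (g : R -> R) (K : R) x y : measurable_fun setT g -> (forall z, x <= z <= y -> `|g z| <= K) ->
    mu.-integrable `]x, y] (EFin \o g).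
  move=> mg gK; apply: measurable_bounded_integrable => //.
    exact: measurable_funS mg.
  rewrite /bounded_near; near=> N => z /=; rewrite in_itv /= => /andP[xz zy].
  apply: le_trans (gK z _) _; first by rewrite (ltW xz).
  by near: N; apply: nbhs_pinfty_ge; rewrite num_real.
have ip x y : 0 <= x -> y <= 1 -> mu.-integrable `]x, y] (EFin \o psi).
  move=> x0 y1; apply: (ib _ M) => // z /andP[xz zy].
  by apply: M0; rewrite (le_trans x0 xz) (le_trans zy y1).
pose J x y := \int[mu]_(z in `]x, y]) psi z.
pose G x := J 0 x - psi x * F x + RI 0 x (fun z => F z * psi' z).
have M_ge0 : 0 <= M by apply: le_trans (M0 (x := 0) _); rewrite ?lexx ?ler01.
suff G10 : G 1 = G 0.
  move: G10; rewrite /G p0 p1 !mul0r RI_pt /J set_itvoc0 Rintegral_set0.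
  move=> h; rewrite -[LHS]fineK; last by apply: integrable_fin_num => //; exact: ip.
  by congr EFin; move: h; rewrite /Rintegral; lra.
apply: (@const_of_small _ G (fun x => 2 * M * F x) 0 1) => // x y x0 xy y1.
have y0 := le_trans x0 xy.
have yx : 0 <= y - x by rewrite subr_ge0.
have E0 : J 0 y = J 0 x + J x y.
  rewrite /J -Rintegral_setU //=.
  - by rewrite -itv_bndbnd_setU // bnd_simp.
  - by rewrite -itv_bndbnd_setU ?bnd_simp //; exact: ip.
  - apply/disj_setPLR => z /=; rewrite !in_itv /= => /andP[_ zx].
    by apply/negP; rewrite negb_and -leNgt zx.
have iB : mu.-integrable `]x, y] (EFin \o (fun z => psi z - psi y)).
  apply: (ib _ (M * (y - x))); first by apply: measurable_funB.
  move=> z /andP[xz zy]; rewrite distrC.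
  apply: le_trans (psi_lip (le_trans x0 xz) zy y1) _.
  by rewrite ler_wpM2l //; lra.
have icst (k : R) : mu.-integrable `]x, y] (EFin \o (fun=> k)).
  by apply: (ib _ `|k|).
have Jcst (k : R) : \int[mu]_(z in `]x, y]) (fun=> k) z = k * (F y - F x).
  by rewrite Rintegral_cst //= muE.
have E2 : J x y = \int[mu]_(z in `]x, y]) (psi z - psi y) + psi y * (F y - F x).
  rewrite -(Jcst (psi y)) -RintegralD //; apply: eq_Rintegral => z _ /=; ring.
have B1 : `|\int[mu]_(z in `]x, y]) (psi z - psi y)| <= M * (y - x) * (F y - F x).
  apply: le_trans (le_normr_Rintegral _ iB) _ => //.
  rewrite -Jcst; apply: le_Rintegral => //; first exact: (integrable_abse iB).
  move=> z /=; rewrite in_itv /= => /andP[xz zy]; rewrite distrC.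
  apply: le_trans (psi_lip (le_trans x0 (ltW xz)) zy y1) _.
  by rewrite ler_wpM2l //; lra.
have iF u v : 0 <= u -> v <= 1 -> intble u v (fun z => F z * psi' z).
  by move=> u0 v1; exact: nd_intble.
have i' : intble x y psi' by exact: cont_intble.
have E3 : RI x y (fun z => F z * psi' z) =
    RI x y (fun z => F z * psi' z - F x * psi' z) + F x * (psi y - psi x).
  rewrite -(@RI_ftc' _ psi' psi x y) //; last exact: cont_within.
  by rewrite -RIZ // RIB ?subrK //; [exact: iF|exact: intbleZ].
have B2 : `|RI x y (fun z => F z * psi' z - F x * psi' z)| <= (F y - F x) * M * (y - x).
  apply: RI_abs_le => //; first by apply: intbleB; [exact: iF|exact: intbleZ].
  move=> z /andP[xz zy]; rewrite -mulrBl normrM.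
  have h1 := Fnd xz; have h2 := Fnd zy.
  apply: ler_pM => //; first by rewrite ger0_norm; lra.
  by apply: M1; rewrite (le_trans x0 xz) (le_trans zy y1).
have -> : G y - G x = \int[mu]_(z in `]x, y]) (psi z - psi y) +
    RI x y (fun z => F z * psi' z - F x * psi' z).
  rewrite /G E0 (@RI_cat _ 0 x y) //; last exact: iF.
  by rewrite E2 E3; ring.
apply: le_trans (ler_normD _ _) _; apply: le_trans (lerD B1 B2) _.
rewrite le_eqVlt; apply/orP; left; apply/eqP; ring.
Unshelve. all: by end_near. Qed.

End ByParts.

(** * Power series: regularity of [xi] on a neighbourhood of [0, 1] *)

Section Model.
Context {R : realType}.
Implicit Types (c : nat -> R) (r K x y q : R).

(** The geometric sum of the powers of [q] up to [q ^+ n] has [n.+1] terms, each at least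
    [q ^+ n]. *)
Lemma muln_geometric_le q n : 0 <= q < 1 -> n.+1%:R * q ^+ n * (1 - q) <= 1.
Proof.
move=> /andP[q0 q1]; suff : n.+1%:R * q ^+ n * (1 - q) <= 1 - q ^+ n.+1.
  have : 0 <= q ^+ n.+1 by rewrite exprn_ge0.
  lra.
elim: n => [|n IH]; first by rewrite expr0 expr1; lra.
have qn0 : 0 <= q ^+ n.+1 by rewrite exprn_ge0.
have qn1 : q ^+ n.+1 <= 1 by rewrite exprn_ile1 // ltW.
have h1 : q * (n.+1%:R * q ^+ n * (1 - q)) <= q * (1 - q ^+ n.+1) by rewrite ler_wpM2l.
have h2 : q ^+ n.+1 * (1 - q) <= 1 * (1 - q) by rewrite ler_wpM2r // subr_ge0 ltW.
have e1 : n.+2%:R * q ^+ n.+1 * (1 - q) =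
    q * (n.+1%:R * q ^+ n * (1 - q)) + q ^+ n.+1 * (1 - q).
  by rewrite -[n.+2%:R]natr1 exprS; ring.
have e2 : q ^+ n.+2 = q * q ^+ n.+1 by rewrite exprS.
rewrite e1 e2; move: h1 h2; rewrite !mulrBr mulr1 mul1r.
move: (q * (n.+1%:R * q ^+ n * 1)) (q * (n.+1%:R * q ^+ n * q)) (q * q ^+ n.+1) (q ^+ n.+1 * q) => *.
lra.
Qed.

(** An intermediate radius [r1] splits the ratio: [n.+1%:R * (K / r1) ^+ n] stays bounded, by
    [muln_geometric_le], and [(r1 / r) ^+ n] is a convergent geometric factor. *)
Lemma pseries_diffs_cvg c r K : (forall i, 0 <= c i) -> 0 <= K -> K < r ->
  cvgn (pseries c r) -> cvgn (pseries (pseries_diffs c) K).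
Proof.
move=> c0 K0 Kr Cr; have [B [Breal Bf]] := cvg_series_bounded Cr.
pose B' := `|B| + 1.
have cB i : c i * r ^+ i <= B'.
  apply: le_trans (ler_norm _) _; apply: Bf => //.
  by rewrite /B'; apply: le_lt_trans (ler_norm B) _; rewrite ltrDl.
have B'0 : 0 <= B' by rewrite addr_ge0.
have r0 : 0 < r by lra.
pose r1 := (K + r) / 2.
have r10 : 0 < r1 by rewrite /r1; lra.
have Kr1 : K < r1 by rewrite /r1; lra.
have r1r : r1 < r by rewrite /r1; lra.
have q01 : 0 <= K / r1 < 1 by rewrite divr_ge0 ?(ltW r10) // ltr_pdivrMr // mul1r.
pose M := (1 - K / r1)^-1.
have qq : 0 < 1 - K / r1 by case/andP: q01 => _ ?; lra.
have M0 : 0 <= M by rewrite invr_ge0 ltW.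
apply: series_le_cvg (_ : cvgn (series (geometric (B' / r * M) (r1 / r)))).
- by move=> n /=; rewrite /pseries_diffs !mulr_ge0 ?exprn_ge0.
- move=> n /=; apply: mulr_ge0; last by apply/exprn_ge0/divr_ge0; exact: ltW.
  by apply: mulr_ge0 => //; apply: divr_ge0 => //; exact: ltW.
- move=> n /=; rewrite /pseries_diffs.
  have e1 : n.+1%:R * c n.+1 * K ^+ n =
      (c n.+1 * r ^+ n.+1) / r * (n.+1%:R * (K / r1) ^+ n) * (r1 / r) ^+ n.
    have e0 : (K / r1) ^+ n * (r1 / r) ^+ n = K ^+ n / r ^+ n.
      by rewrite -exprMn mulrA mulfVK ?gt_eqF // exprMn exprVn.
    have rn0 : r ^+ n != 0 by rewrite expf_neq0 // gt_eqF.
    have rr : r != 0 by rewrite gt_eqF.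
    transitivity (c n.+1 * r ^+ n.+1 / r * n.+1%:R * ((K / r1) ^+ n * (r1 / r) ^+ n)).
      by rewrite e0 [r ^+ n.+1]exprS; field; rewrite rn0 rr.
    by rewrite !mulrA.
  rewrite e1; apply: ler_wpM2r; first by rewrite exprn_ge0 // divr_ge0 // ltW.
  apply: ler_pM.
  + by apply: divr_ge0; [apply: mulr_ge0 => //; apply: exprn_ge0|]; exact: ltW.
  + by rewrite mulr_ge0 // exprn_ge0 //; case/andP: q01.
  + by rewrite ler_pM2r ?invr_gt0.
  + rewrite /M -[leRHS]mul1r ler_pdivlMr //; exact: muln_geometric_le.
- apply: is_cvg_geometric_series; rewrite ger0_norm ?divr_ge0 ?(ltW r0) ?(ltW r10) //.
    by rewrite ltr_pdivrMr // mul1r.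
  by rewrite addr_ge0 // ltW.
Qed.

Lemma pseries_diffs_ge0 c : (forall i, 0 <= c i) -> forall i, 0 <= pseries_diffs c i.
Proof. by move=> c0 i; rewrite mulr_ge0. Qed.

Lemma iter_pseries_diffs_cvg c r n : (forall i, 0 <= c i) -> 1 < r -> cvgn (pseries c r) ->
  exists2 K, 1 < K & forall i, (i <= n)%N -> cvgn (pseries (iter i (@pseries_diffs R) c) K).
Proof.
move=> c0 r1 Cr; elim: n => [|n [K K1 H]].
  by exists r => // i; rewrite leqn0 => /eqP ->.
pose K' := (1 + K) / 2.
have K'1 : 1 < K' by rewrite /K'; lra.
have K'K : K' < K by rewrite /K'; lra.
have ci0 i : forall j, 0 <= iter i (@pseries_diffs R) c j.
  by elim: i => // i IH; exact: pseries_diffs_ge0.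
exists K' => // i; rewrite leq_eqVlt => /orP[/eqP ->|i_n].
  apply: (@pseries_diffs_cvg _ K K' (ci0 n) _ K'K (H n (leqnn n))).
  by apply: ltW; exact: lt_trans ltr01 K'1.
apply: is_cvg_pseries_inside (H i i_n) _.
by rewrite !gtr0_norm //; lra.
Qed.

Lemma pseries_ge0 c x : (forall i, 0 <= c i) -> 0 <= x -> cvgn (pseries c x) ->
  0 <= limn (pseries c x).
Proof.
move=> c0 x0 cx; apply: limr_ge => //; apply: nearW => n.
by rewrite sumr_ge0 // => i _; rewrite mulr_ge0 ?exprn_ge0.
Qed.

Lemma pseries_nd c x y : (forall i, 0 <= c i) -> 0 <= x -> x <= y ->
  cvgn (pseries c x) -> cvgn (pseries c y) -> limn (pseries c x) <= limn (pseries c y).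
Proof.
move=> c0 x0 xy cx cy; apply: ler_lim => //; apply: nearW => n.
apply: ler_sum => i _; rewrite ler_wpM2l // lerXn2r // qualifE /=; lra.
Qed.

(** The coefficients are nonnegative, so the third derivative is largest at 1 on [0, 1], and its
    value there serves as Lipschitz constant of [xi2 beta]. *)
Lemma model_regular (beta : nat -> R) : is_model beta ->
  exists d, [/\ 0 < d,
   forall x, `|x| < 1 + d -> [/\ is_derive x 1 (xi beta) (xi1 beta x),
     is_derive x 1 (xi1 beta) (xi2 beta x) & {for x, continuous (xi2 beta)}],
   forall x, 0 <= x <= 1 -> 0 <= xi2 beta x &
   exists2 L, 0 <= L & forall x y, 0 <= x -> x <= y -> y <= 1 ->
     xi2 beta y - xi2 beta x <= L * (y - x)].
Proof.
move=> [_ [eps [eps0 Ceps]]].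
pose c i : R := if (i < 2)%N then 0 else beta i ^+ 2.
have c0 i : 0 <= c i by rewrite /c; case: ifP => // _; rewrite sqr_ge0.
have sumE n t : \sum_(2 <= p < n) beta p ^+ 2 * t ^+ p = pseries c t n.
  rewrite /pseries /series /=; have [n2|n2] := ltnP n 2.
    rewrite big_geq 1?ltnW // big_nat_cond big1 // => i /andP[/andP[_ i_n] _].
    by rewrite /c (ltn_trans i_n n2) mul0r.
  rewrite [RHS](big_cat_nat (n := 2)) //= [X in _ = X + _]big_nat_cond [X in _ = X + _]big1 ?add0r; last first.
    by move=> i /andP[/andP[_ i2] _]; rewrite /c i2 mul0r.
  by apply: eq_big_nat => i /andP[i2 _]; rewrite /c ltnNge i2.
have Cc : cvgn (pseries c (1 + eps)).
  rewrite (_ : pseries c (1 + eps) = fun n => \sum_(2 <= p < n) beta p ^+ 2 * (1 + eps) ^+ p) //.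
  by apply/funext => n; rewrite sumE.
have e1 : 1 < 1 + eps by rewrite ltrDl.
(* Differentiation is allowed at orders up to 3, and each use of [pseries_snd_diffs] asks for
   convergence two orders further, hence 5. *)
have [K K1 HK] := iter_pseries_diffs_cvg 5 c0 e1 Cc.
pose S i x := limn (pseries (iter i (@pseries_diffs R) c) x).
have ci0 i : forall j, 0 <= iter i (@pseries_diffs R) c j.
  by elim: i => // i IH; exact: pseries_diffs_ge0.
have SD i x : (i <= 3)%N -> `|x| < K -> is_derive x 1 (S i) (S i.+1 x).
  move=> i3 xK; apply: (@pseries_snd_diffs _ _ K).
  - by apply: HK; apply: leq_trans i3 _.
  - by apply: (HK i.+1); rewrite ltnS (leq_trans i3).
  - by apply: (HK i.+2); rewrite !ltnS.
  - by rewrite (gtr0_norm (lt_trans ltr01 K1)).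
have nearK x : `|x| < K -> \forall y \near x, `|y| < K.
  move=> xK; have : \forall y \near x, ball x (K - `|x|) y.
    by apply: nbhsx_ballx; rewrite subr_gt0.
  apply: filterS => y; rewrite /ball /= => h.
  rewrite (_ : y = x - (x - y)); last by ring.
  by apply: le_lt_trans (ler_normB _ _) _; rewrite -ltrBrDl.
have xiE : xi beta = S 0%N.
  apply/funext => x; rewrite /xi /S; congr (limn _).
  by apply/funext => n; rewrite sumE.
have xi1E x : `|x| < K -> xi1 beta x = S 1%N x.
  move=> xK; rewrite /xi1 xiE; exact: (is_derive_derive1 (SD 0%N x isT xK)).
have dxi1 x : `|x| < K -> is_derive x 1 (xi1 beta) (S 2%N x).
  move=> xK; apply: (near_eq_is_derive _ (SD 1%N x isT xK)).
  by apply: filterS (nearK x xK) => y yK; rewrite xi1E.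
have xi2E x : `|x| < K -> xi2 beta x = S 2%N x.
  move=> xK; exact: (is_derive_derive1 (dxi1 x xK)).
have dxi2 x : `|x| < K -> is_derive x 1 (xi2 beta) (S 3%N x).
  move=> xK; apply: (near_eq_is_derive _ (SD 2%N x isT xK)).
  by apply: filterS (nearK x xK) => y yK; rewrite xi2E.
have cS i x : (i <= 5)%N -> `|x| < K -> cvgn (pseries (iter i (@pseries_diffs R) c) x).
  move=> i5 xK; apply: is_cvg_pseries_inside (HK i i5) _.
  by rewrite (gtr0_norm (lt_trans ltr01 K1)).
have x01K x : 0 <= x <= 1 -> `|x| < K.
  by move=> /andP[x0 x1]; rewrite ger0_norm // (le_lt_trans x1).
exists (K - 1); split; first by lra.
- move=> x; rewrite (addrC 1) subrK => xK; split.
  + rewrite (xi1E x xK) xiE; exact: (SD 0%N x isT xK).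
  + rewrite (xi2E x xK); exact: (dxi1 x xK).
  + exact: is_derive_cont (dxi2 x xK).
- move=> x x01; rewrite xi2E ?x01K //; case/andP: (x01) => x0 _.
  by apply: pseries_ge0 => //; apply: cS => //; exact: x01K.
- have h11 : 0 <= (1 : R) <= 1 by rewrite ler01 lexx.
  exists (S 3%N 1).
    by apply: pseries_ge0 => //; apply: cS => //; exact: x01K.
  move=> x y x0 xy y1.
  have hz z : x <= z -> z <= y -> 0 <= z <= 1 by move=> *; apply/andP; split; lra.
  have [||z zxy ->] := @MVT_segment R (xi2 beta) (S 3%N) x y xy.
  + move=> z; rewrite in_itv /= => /andP[xz zy]; apply: dxi2; apply: x01K.
    by apply: hz; exact: ltW.
  + apply: continuous_in_subspaceT => z; rewrite inE /= in_itv /= => /andP[xz zy].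
    exact: is_derive_cont (dxi2 z (x01K _ (hz _ xz zy))).
  + move: zxy; rewrite in_itv /= => /andP[xz zy].
    have /andP[z0 z1] := hz _ xz zy.
    apply: ler_wpM2r; first by rewrite subr_ge0.
    by apply: pseries_nd => //; apply: cS => //; apply: x01K => //; rewrite z0.
Qed.

End Model.

(** * Operations on the cone and bounds for the functional [Pfun] *)

Section Positivity.
Context {R : realType}.
Local Notation leb := (@lebesgue_measure R).
Implicit Types (f g psi : R -> R) (a b c d e s x y t K M : R).

Lemma CsetD f g : Cset f -> Cset g -> Cset (fun x => f x + g x).
Proof.
move=> [cf [f0 [fni fc]]] [cg [g0 [gni gc]]]; split.
  by move=> x; apply: cvgD; [exact: cf|exact: cg].
split; first by move=> x x01; rewrite addr_ge0 ?f0 ?g0.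
split; first by move=> x y x0 xy y1; rewrite lerD ?fni ?gni.
move=> x y t x01 y01 t01; have := fc x y t x01 y01 t01; have := gc x y t x01 y01 t01.
by rewrite !mulrDr; lra.
Qed.

Lemma CsetZ f c : 0 <= c -> Cset f -> Cset (fun x => c * f x).
Proof.
move=> c0 [cf [f0 [fni fc]]]; split.
  by move=> x; apply: cvgM; [exact: cvg_cst|exact: cf].
split; first by move=> x x01; rewrite mulr_ge0 ?f0.
split; first by move=> x y x0 xy y1; rewrite ler_wpM2l ?fni.
move=> x y t x01 y01 t01; have := fc x y t x01 y01 t01 => /(ler_wpM2l c0).
by rewrite mulrDr !(mulrCA c).
Qed.

Lemma Cset_cst c : 0 <= c -> Cset (fun=> c : R).
Proof.
move=> c0; split; first by apply: cont_within => x; exact: cvg_cst.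
by do 2 split=> // *; rewrite -mulrDl addrC subrK mul1r.
Qed.

Lemma Cset_hinge s : 0 <= s <= 1 -> Cset (hinge s).
Proof.
move=> /andP[s0 s1]; split; first exact/cont_within/hinge_cont.
split; first by move=> x /andP[x0 x1]; rewrite /hinge subr_ge0 ge_max x1.
split; first by move=> x y _ xy _; exact: hinge_ni.
move=> x y t x01 y01 /andP[t0 t1]; rewrite /hinge.
have h1 : x <= Num.max x s by rewrite le_max lexx.
have h2 : s <= Num.max x s by rewrite le_max lexx orbT.
have h3 : y <= Num.max y s by rewrite le_max lexx.
have h4 : s <= Num.max y s by rewrite le_max lexx orbT.
suff : Num.max (t * x + (1 - t) * y) s <= t * Num.max x s + (1 - t) * Num.max y s.
  by rewrite !mulrBr !mulr1; lra.
have t1' : 0 <= 1 - t by lra.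
rewrite ge_max; apply/andP; split; first by rewrite lerD // ler_wpM2l.
apply: (@le_trans _ _ (t * s + (1 - t) * s)).
  by rewrite -mulrDl addrC subrK mul1r.
by rewrite lerD // ler_wpM2l.
Qed.

Lemma Cset_scale f s : 0 <= s <= 1 -> Cset f -> Cset (fun x => f (s * x)).
Proof.
move=> /andP[s0 s1] [cf [f0 [fni fc]]].
have in01 x : 0 <= x <= 1 -> 0 <= s * x <= 1.
  by move=> /andP[x0 x1]; rewrite mulr_ge0 // mulr_ile1.
split.
  have h : {within `[0, 1], continuous (fun x => clamp f (s * x))}.
    apply: cont_within => x.
    apply: (@continuous_comp _ _ _ (fun x => s * x) (clamp f)); last exact: clamp_cont.
    by apply: cvgM; [exact: cvg_cst|exact: cvg_id].
  apply: subspace_eq_continuous h => x; rewrite inE /= in_itv /= => x01.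
  by rewrite /from_subspace clamp_id ?in01.
split; first by move=> x x01; rewrite f0 ?in01.
split.
  move=> x y x0 xy y1; apply: fni; [exact: mulr_ge0|exact: ler_wpM2l|].
  by rewrite mulr_ile1 //; exact: le_trans xy.
move=> x y t x01 y01 t01; have := fc (s * x) (s * y) t (in01 x x01) (in01 y y01) t01.
by rewrite !(mulrCA _ s) -mulrDr.
Qed.

Lemma Cset_ext f g : (forall x, 0 <= x <= 1 -> f x = g x) -> Cset f -> Cset g.
Proof.
move=> fg [cf [f0 [fni fc]]]; split.
  by apply: subspace_eq_continuous cf => x; rewrite inE /= in_itv /=; exact: fg.
split; first by move=> x x01; rewrite -fg // f0.
split; first by move=> x y x0 xy y1; rewrite -!fg ?fni //; lra.
move=> x y t x01 y01 t01; rewrite -!fg ?fc //.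
move: x01 y01 t01 => /andP[x0 x1] /andP[y0 y1] /andP[t0 t1].
have t1' : 0 <= 1 - t by lra.
rewrite addr_ge0 ?mulr_ge0 //=.
have a1 : t * x <= t * 1 by rewrite ler_wpM2l.
have a2 : (1 - t) * y <= (1 - t) * 1 by rewrite ler_wpM2l.
lra.
Qed.

(** Both integrals are suprema over simple functions below the integrand, so comparing these
    families suffices; in this form it applies directly to the integrand of [Pfun], with its values
    [einv]. *)
Lemma mono_integral (D : set R) (f1 f2 : R -> \bar R) :
  (forall x, D x -> 0 <= f1 x)%E -> (forall x, D x -> f1 x <= f2 x)%E ->
  (\int[leb]_(x in D) f1 x <= \int[leb]_(x in D) f2 x)%E.
Proof.
move=> f10 f12.
have f20 x : D x -> (0 <= f2 x)%E by move=> Dx; apply: le_trans (f10 x Dx) (f12 x Dx).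
rewrite !ge0_integralE //; apply: le_ereal_sup => _ [h /= hf <-].
by exists h => //= x; apply: le_trans (hf x) _; exact: lee_restrict.
Qed.

Variables (beta : nat -> R) (h : R) (X : R -> R).
Hypothesis cX : continuous X.
Hypothesis XE : forall x, 0 <= x <= 1 -> X x = xi2 beta x.
Hypothesis X0 : forall x, 0 <= x <= 1 -> 0 <= X x.

Lemma Pfun_pos psi psi' c : continuous psi' -> 0 < c -> (forall x, 0 <= x <= 1 -> c <= psi x) ->
  (forall x, 0 <= x <= 1 -> psi' x = psi x) -> (forall x, c <= psi' x) ->
  Defs.Pfun beta h psi = (RI 0 1 (fun x => X x * psi' x + (psi' x)^-1) + h ^+ 2 * psi 0)%:E.
Proof.
move=> cp c0 pc pp p'c; rewrite /Defs.Pfun EFinD; congr (_ + _)%E.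
have ci : continuous (fun x => X x * psi' x + (psi' x)^-1).
  move=> x; apply: cvgD; first by apply: cvgM; [exact: cX|exact: cp].
  by apply: cvgV; [rewrite gt_eqF // (lt_le_trans c0)|exact: cp].
rewrite -RI_EFin; last exact: cont_intble.
apply: eq_integral => x; rewrite inE /= in_itv /= => x01.
rewrite /einv pp // -XE // EFinD ifF //.
by apply/negbTE; rewrite gt_eqF // (lt_le_trans c0) ?pc.
Qed.

(** Splitting at [s] allows different bounds on the two pieces: an integrand [g] before [s], and
    only the term [einv (phi x)] after it, where [phi] may still vanish. *)
Lemma Pfun_lower phi g s K : Cset phi -> 0 <= s <= 1 -> 0 <= K -> continuous g ->
  (forall x, 0 <= x <= s -> 0 <= g x /\ ((g x)%:E <= (X x * phi x)%:E + einv (phi x))%E) ->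
  (forall x, s < x <= 1 -> (K%:E <= einv (phi x))%E) ->
  ((RI 0 s g + K * (1 - s) + h ^+ 2 * phi 0)%:E <= Defs.Pfun beta h phi)%E.
Proof.
move=> [cf [f0 _]] /andP[s0 s1] K0 cg gle Kle; rewrite /Defs.Pfun EFinD; apply: leeD2r.
pose f1 x := if x <= s then (g x)%:E else K%:E.
apply: (@le_trans _ _ (\int[leb]_(x in `[0%R, 1%R]) f1 x)%E); last first.
  apply: mono_integral => x; rewrite /= in_itv /= => /andP[x0 x1]; rewrite /f1.
    case: ifP => xs; rewrite lee_fin //.
    by have [] := gle x _; rewrite ?x0.
  rewrite -XE ?x0 //; case: ifP => xs; first by have [] := gle x _; rewrite ?x0 ?xs.
  apply: le_trans (Kle x _) _; first by rewrite ltNge xs.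
  by rewrite leeDr // lee_fin mulr_ge0 ?f0 ?X0 ?x0.
have -> : `[0%R, 1%R]%classic = `[0%R, s]%classic `|` `]s, 1%R]%classic :> set R.
  by rewrite -itv_bndbnd_setU // bnd_simp.
rewrite ge0_integral_setU //=.
- rewrite EFinD; apply: leeD.
    rewrite -RI_EFin; last exact: cont_intble.
    apply: mono_integral => x; rewrite /= in_itv /= => /andP[x0 xs].
      by rewrite lee_fin; have [] := gle x _; rewrite ?x0.
    by rewrite /f1 xs.
  apply: (@le_trans _ _ (\int[leb]_(x in `]s, 1%R]) (cst K%:E) x)%E).
    rewrite integral_cst //= lebesgue_measure_itv /= lte_fin.
    case: ltP => s1'; first by rewrite -EFinD -EFinM.
    have -> : s = 1 by apply/le_anti; rewrite s1 s1'.
    by rewrite mule0 lee_fin subrr mulr0.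
  apply: mono_integral => x; rewrite /= in_itv /= => /andP[sx x1]; first by rewrite lee_fin.
  by rewrite /f1 [x <= s]leNgt sx.
- apply: measurable_funTS; rewrite /f1; apply: measurable_fun_ifT => //=.
  + exact: measurable_fun_ler.
  + by apply/measurable_EFinP; exact: continuous_measurable_fun.
- move=> x [|]; rewrite /= in_itv /= /f1 => /andP[x0 xs].
    by rewrite xs lee_fin; have [] := gle x _; rewrite ?x0.
  by rewrite [x <= s]leNgt x0 /= lee_fin.
- apply/disj_setPLR => x /=; rewrite !in_itv /= => /andP[_ xs].
  by apply/negP; rewrite negb_and -leNgt xs.
Qed.

(** The substitution goes through [primitive], which asks for a function vanishing up to -1; [g] is
    therefore cut off on the negative axis, outside the range of integration. *)
Lemma RI_scale g s : continuous g -> 0 < s <= 1 ->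
  s * RI 0 1 (fun x => g (s * x)) = RI 0 s g.
Proof.
move=> cg /andP[s0 s1].
pose w x := g x * Num.max 0 (Num.min (x + 1) 1).
have cw : continuous w.
  move=> x; apply: cvgM; first exact: cg.
  apply: (@continuous_max R R (cst 0) (fun x => Num.min (x + 1) 1) x); first exact: cvg_cst.
  apply: (@continuous_min R R (fun x => x + 1) (cst 1) x); last exact: cvg_cst.
  by apply: cvgD; [exact: cvg_id|exact: cvg_cst].
have w0 y : y <= - 1 -> w y = 0.
  move=> y1; rewrite /w max_l ?mulr0 // ge_min; apply/orP; left; lra.
have wg x : 0 <= x -> w x = g x.
  by move=> x0; rewrite /w min_r ?max_r ?mulr1 //; lra.
rewrite (RI_eq (g := fun x => w (s * x))); last first.
  by move=> x /andP[x0 _]; rewrite wg // mulr_ge0 // ltW.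
rewrite [RHS](RI_eq (g := w)); last by move=> x /andP[x0 _]; rewrite wg.
have dw x := primitive_derive x cw w0.
have cws : continuous (fun x => w (s * x)).
  move=> x; apply: (@continuous_comp _ _ _ (fun x => s * x) w); last exact: cw.
  by apply: cvgM; [exact: cvg_cst|exact: cvg_id].
rewrite -RIZ; last exact: cont_intble.
have e1 : RI 0 s w = primitive w s - primitive w 0.
  by apply: RI_ftc' => //; [exact: ltW|exact: cont_within].
have e2 : RI 0 1 (fun x => s * w (s * x)) = primitive w (s * 1 + 0) - primitive w (s * 0 + 0).
  apply: (@RI_ftc' _ _ (fun x => primitive w (s * x + 0))) => //.
    by apply: cont_within => x; apply: cvgM; [exact: cvg_cst|exact: cws].
  move=> x _; apply: is_derive_eq (idcomp_aff (dw _)) _.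
  by rewrite addr0 mulrC.
by rewrite e1 e2 mulr1 mulr0 !addr0.
Qed.

End Positivity.

(** * The minimizer is bounded away from zero *)

Section LowerBound.
Context {R : realType}.
Implicit Types (f g psi : R -> R) (a b c d e s x y t K M : R).

Variables (beta : nat -> R) (h : R) (X : R -> R) (B : R).
Hypothesis cX : continuous X.
Hypothesis XE : forall x, 0 <= x <= 1 -> X x = xi2 beta x.
Hypothesis X0 : forall x, 0 <= x <= 1 -> 0 <= X x.
Hypothesis XB : forall x, 0 <= x <= 1 -> X x <= B.

Lemma einv_ge x K : 0 <= x -> x * K <= 1 -> (K%:E <= einv x)%E.
Proof.
move=> x0 xK; rewrite /einv; have [_|xn] := eqVneq x 0; first by rewrite leey.
have xp : 0 < x by rewrite lt_def xn.
by rewrite lee_fin -[x^-1]mul1r ler_pdivlMr // mulrC.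
Qed.

(** Positivity on [0, 1) comes from finiteness of the minimum. The competitors [phi (s * x)] then
    bound [(1 - s) / phi s] by a constant times [1 - s], uniformly in [s], and the value at 1
    follows by continuity. *)
Lemma minimizer_pos phi : is_Pmin beta h phi ->
  exists2 c, 0 < c & forall t, 0 <= t <= 1 -> c <= phi t.
Proof.
move=> [Cphi Pmin]; have [cf [f0 [fni _]]] := Cphi.
have h01 : 0 <= (0 : R) <= 1 by rewrite lexx ler01.
have h11 : 0 <= (1 : R) <= 1 by rewrite lexx ler01.
have B_ge0 : 0 <= B by apply: le_trans (X0 h01) (XB h01).
have phi0 := f0 0 h01.
have hh : 0 <= h ^+ 2 by rewrite sqr_ge0.
have hphi : 0 <= h ^+ 2 * phi 0 by rewrite mulr_ge0.
have c1 k : continuous (fun _ : R => k : R) by move=> x; exact: cvg_cst.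
pose B0 := RI 0 1 (fun x => X x * 1 + (1 : R)^-1) + h ^+ 2 * 1.
have PB0 : (Defs.Pfun beta h phi <= B0%:E)%E.
  apply: le_trans (Pmin _ (Cset_cst ler01)) _.
  rewrite le_eqVlt; apply/orP; left; apply/eqP.
  exact: (Pfun_pos h cX XE (psi := fun=> 1) (psi' := fun=> 1) (c1 1) ltr01).
have B00 : 0 <= B0.
  apply: addr_ge0; last exact: mulr_ge0.
  apply: RI_ge0 => x x01; by rewrite mulr1 invr1 addr_ge0 ?X0.
have einv0 x : 0 <= x <= 1 -> (0 <= (X x * phi x)%:E + einv (phi x))%E.
  move=> x01; apply: adde_ge0; first by rewrite lee_fin mulr_ge0 ?X0 ?f0.
  by apply: einv_ge; rewrite ?f0 // mulr0.
have Apos s : 0 <= s -> s < 1 -> 0 < phi s.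
  move=> s0 s1; have s01 : 0 <= s <= 1 by rewrite s0 ltW.
  rewrite lt_def f0 // andbT; apply/negP => /eqP ps.
  (* If [phi s = 0] then [phi] vanishes on [[s, 1]], where [einv] exceeds every constant; this [K]
     makes the tail alone contribute [B0 + 1], more than the value [B0] at the constant function
     1. *)
  pose K := (B0 + 1) / (1 - s).
  have s1' : 0 < 1 - s by rewrite subr_gt0.
  have K0 : 0 <= K by apply: divr_ge0; [exact: addr_ge0|exact: ltW].
  have := @Pfun_lower R beta h X XE X0 phi (fun=> 0) s K Cphi s01 K0 (c1 0).
  have H1 x : 0 <= x <= s -> 0 <= (0 : R) /\ (0%:E <= (X x * phi x)%:E + einv (phi x))%E.
    move=> /andP[x0 xs]; split=> //; apply: einv0; rewrite x0 /=.
    exact: le_trans xs (ltW s1).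
  have H2 x : s < x <= 1 -> (K%:E <= einv (phi x))%E.
    move=> /andP[sx x1]; apply: einv_ge; first by apply: f0; rewrite x1 (le_trans s0) // ltW.
    have -> : phi x = 0; last by rewrite mul0r.
    apply/le_anti; rewrite -{1}ps fni ?(ltW sx) //= f0 // x1 andbT.
    by rewrite (le_trans s0) // ltW.
  move=> /(_ H1 H2) /le_trans /(_ PB0); rewrite lee_fin /K mulfVK ?gt_eqF //.
  have := @RI_ge0 R 0 s (fun=> 0) (fun x _ => lexx 0).
  move: (RI _ _ _) => r; move: hphi; move: (h ^+ 2 * phi 0) => hp; lra.
(* [B * phi 0] is the price of the dilation in the [xi''] term, [2 * B0] its price in the [1 / phi]
   term, and the summand 1 makes [A] positive. *)
pose A := B * phi 0 + 2 * B0 + 1.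
have Bphi : 0 <= B * phi 0 by rewrite mulr_ge0.
have A0 : 0 < A by rewrite /A; lra.
have Bpos s : 2^-1 <= s -> s < 1 -> A^-1 <= phi s.
  move=> s2 s1; have s0 : 0 < s by apply: lt_le_trans s2; rewrite invr_gt0.
  have s01 : 0 <= s <= 1 by apply/andP; split; exact: ltW.
  have p0 : 0 < phi s by apply: Apos => //; exact: ltW.
  (* [phi] frozen after [s]: it agrees with [phi] on [[0, s]] and is at least [phi s > 0]
     everywhere, so its reciprocal is continuous. *)
  pose f x := clamp phi (Num.min x s).
  have cfs : continuous f.
    move=> x; apply: (@continuous_comp _ _ _ (fun x => Num.min x s) (clamp phi)); last exact: clamp_cont.
    apply: (@continuous_min R R id (cst s) x); [exact: cvg_id|exact: cvg_cst].
  have fE x : 0 <= x -> x <= s -> f x = phi x.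
    by move=> x0 xs; rewrite /f min_l // clamp_id // x0 (le_trans xs) // ltW.
  have fni' x y : x <= y -> f y <= f x.
    move=> xy; rewrite /f /clamp; apply: fni.
    - by have /andP[] := clamp_in (Num.min x s).
    - rewrite ge_max le_max lexx /= le_max; apply/orP; right.
      have h1 : Num.min x s <= Num.min y s by rewrite le_min !ge_min xy lexx orbT.
      rewrite le_min; apply/andP; split; first by rewrite ge_min h1.
      by rewrite ge_min lexx orbT.
    - by have /andP[] := clamp_in (Num.min y s).
  have fs x : phi s <= f x.
    rewrite /f /clamp; apply: fni.
    - by have /andP[] := clamp_in (Num.min x s).
    - by rewrite ge_max (ltW s0) /= !ge_min lexx orbT.
    - exact: ltW.
  have fpos x : 0 < f x by apply: lt_le_trans (fs x).
  have f0' x : 0 <= x -> f x <= phi 0.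
    by move=> x0; rewrite -(fE 0 (lexx 0) (ltW s0)); exact: fni'.
  have cfi : continuous (fun x => (f x)^-1).
    by move=> x; apply: cvgV; [rewrite gt_eqF|exact: cfs].
  have cXf g : continuous g -> continuous (fun x => X x * g x).
    by move=> cg x; apply: cvgM; [exact: cX|exact: cg].
  have csc g : continuous g -> continuous (fun x => g (s * x)).
    move=> cg x; apply: (@continuous_comp _ _ _ (fun x => s * x) g); last exact: cg.
    by apply: cvgM; [exact: cvg_cst|exact: cvg_id].
  have einvE x : 0 <= x -> x <= s -> einv (phi x) = ((f x)^-1)%:E.
    by move=> x0 xs; rewrite -fE // /einv gt_eqF.
  have cD g1 g2 : continuous g1 -> continuous g2 -> continuous (fun x : R => g1 x + g2 x : R).
    by move=> c2 c3 x; apply: cvgD; [exact: c2|exact: c3].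
  have xs1 x : x <= s -> x <= 1 by move=> xs; apply: le_trans xs (ltW s1).
  have H1 : RI 0 s (fun x => X x * f x + (f x)^-1) + (phi s)^-1 * (1 - s) + h ^+ 2 * phi 0 <=
      RI 0 1 (fun x => X x * f (s * x) + (f (s * x))^-1) + h ^+ 2 * phi 0.
    rewrite -lee_fin.
    have ps0 : 0 <= (phi s)^-1 by rewrite invr_ge0 ltW.
    have cg1 := cD _ _ (cXf _ cfs) cfi.
    apply: le_trans (Pfun_lower (beta := beta) h XE X0 Cphi s01 ps0 cg1 _ _) _.
    - move=> x /andP[x0 xs]; rewrite einvE // fE // lexx; split=> //.
      by rewrite addr_ge0 ?mulr_ge0 ?X0 ?f0 ?invr_ge0 ?f0 ?x0 ?xs1.
    - move=> x /andP[sx x1]; apply: einv_ge; first by apply: f0; rewrite x1 andbT (le_trans (ltW s0)) // ltW.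
      by rewrite ler_pdivrMr // mul1r fni // ltW.
    apply: le_trans (Pmin _ (Cset_scale s01 Cphi)) _.
    rewrite (Pfun_pos (beta := beta) (X := X) h cX XE (psi' := fun x => f (s * x)) (c := phi s)).
    - by rewrite mulr0.
    - exact: csc.
    - by [].
    - move=> x /andP[x0 x1]; apply: fni => //; first by rewrite mulr_ge0 // ltW.
        by rewrite -[leRHS]mulr1 ler_pM2l.
      exact: ltW.
    - move=> x /andP[x0 x1]; rewrite fE //; first by rewrite mulr_ge0 // ltW.
      by rewrite -[leRHS]mulr1 ler_pM2l.
    - by move=> x; exact: fs.
  have H2 : RI 0 s (fun x => (f x)^-1) <= B0.
    have := Pfun_lower (beta := beta) h XE X0 Cphi s01 (lexx 0) cfi.
    have q1 x : 0 <= x <= s -> 0 <= (f x)^-1 /\ (((f x)^-1)%:E <= (X x * phi x)%:E + einv (phi x))%E.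
      move=> /andP[x0 xs]; rewrite invr_ge0 ltW //; split=> //; rewrite einvE // leeDr //.
      by rewrite lee_fin mulr_ge0 ?X0 ?f0 ?x0 ?xs1.
    have q2 x : s < x <= 1 -> (0%:E <= einv (phi x))%E.
      move=> /andP[sx x1]; apply: einv_ge; last by rewrite mulr0.
      by apply: f0; rewrite x1 andbT (le_trans (ltW s0)) // ltW.
    move=> /(_ q1 q2) /le_trans /(_ PB0); rewrite lee_fin mul0r addr0.
    by move=> q3; apply: le_trans q3; rewrite lerDl.
  have s01' : 0 < s <= 1 by rewrite s0 ltW.
  have Ea := RI_scale cfs s01'; have Eb := RI_scale cfi s01'.
  pose a := RI 0 1 (fun x => f (s * x)); pose b := RI 0 1 (fun x => (f (s * x))^-1).
  rewrite -/a in Ea; rewrite -/b in Eb.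
  have If : RI 0 s f <= phi 0 * s.
    rewrite -[X in _ * X]subr0 -(RI_cst (phi 0) (ltW s0)).
    apply: RI_le; [exact: cont_intble|exact: intble_cst|].
    by move=> x /andP[x0 _]; exact: f0'.
  have a1 : a <= phi 0.
    have : s * a <= s * phi 0 by rewrite Ea [leRHS]mulrC.
    by rewrite ler_pM2l.
  have b0 : 0 <= b by apply: RI_ge0 => x _; rewrite invr_ge0 ltW.
  (* Here [s >= 1/2] enters: [b <= 2 * (s * b)], and [s * b] is the integral of [1 / phi] over
     [[0, s]]. *)
  have b1 : b <= 2 * B0.
    have h1 : b <= 2 * (s * b).
      rewrite mulrA -[leLHS]mul1r ler_wpM2r //.
      by move: s2; rewrite -[X in X <= _ -> _]mul1r ler_pdivrMr // mulrC.
    by apply: le_trans h1 _; rewrite ler_pM2l // Eb.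
  have i1 u v g : continuous g -> intble u v g by move=> cg; exact: cont_intble.
  have cfsc := csc _ cfs; have cfisc := csc _ cfi.
  (* Since [f (s * x) >= f x], the weight [X] may be replaced by its bound [B] in the difference. *)
  have H3 : RI 0 1 (fun x => X x * f (s * x)) - RI 0 s (fun x => X x * f x) <= B * (a - RI 0 s f).
    rewrite (RI_cat (ltW s0) (ltW s1) (i1 _ _ _ (cXf _ cfsc))).
    rewrite /a (RI_cat (ltW s0) (ltW s1) (i1 _ _ _ cfsc)).
    have k1 : RI s 1 (fun x => X x * f (s * x)) <= B * RI s 1 (fun x => f (s * x)).
      rewrite -RIZ; last exact: i1.
      apply: RI_le; [exact/i1/cXf|exact/intbleZ/i1|].
      move=> x /andP[sx x1]; apply: ler_wpM2r; first exact: ltW.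
      by apply: XB; rewrite x1 andbT; exact: le_trans (ltW s0) sx.
    have k2 : RI 0 s (fun x => X x * f (s * x)) - RI 0 s (fun x => X x * f x) <=
        B * (RI 0 s (fun x => f (s * x)) - RI 0 s f).
      rewrite -RIB; [|exact/i1/cXf|exact/i1/cXf].
      rewrite -[in leRHS]RIB; [|exact: i1|exact: i1].
      rewrite -RIZ; last by apply: intbleB; exact: i1.
      apply: RI_le; [by apply: intbleB; exact/i1/cXf|by apply/intbleZ/intbleB; exact: i1|].
      move=> x /andP[x0 xs]; rewrite -mulrBr ler_wpM2r ?XB ?x0 ?xs1 //.
      rewrite subr_ge0; apply: fni'.
      by rewrite -[leRHS]mul1r ler_wpM2r // ltW.
    have alg (P Q S u v r b' : R) : P - S <= b' * (u - r) -> Q <= b' * v ->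
        P + Q - S <= b' * (u + v - r) by rewrite !mulrBr mulrDr; lra.
    exact: alg k2 k1.
  rewrite RID in H1; [|exact/i1/cXf|exact: i1].
  rewrite [X in _ <= X + _]RID in H1; [|exact/i1/cXf|exact: i1].
  rewrite -/b -Eb in H1; rewrite -Ea in H3.
  have H4 : B * (a - s * a) <= B * phi 0 * (1 - s).
    rewrite -mulrA ler_wpM2l // -[X in X - _]mul1r -mulrBl mulrC ler_wpM2r //.
    by rewrite subr_ge0 ltW.
  have H5 : b - s * b <= 2 * B0 * (1 - s).
    by rewrite -[X in X - _]mul1r -mulrBl mulrC ler_wpM2r // subr_ge0 ltW.
  have H6 : (phi s)^-1 * (1 - s) <= A * (1 - s).
    have e1 : A * (1 - s) = B * phi 0 * (1 - s) + 2 * B0 * (1 - s) + (1 - s) by rewrite /A; ring.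
    have alg (U V I p hp b' B1 C1 C2 t : R) : U + I + p + hp <= V + b' + hp ->
        V - U <= B1 -> B1 <= C1 -> b' - I <= C2 -> 0 <= t -> p <= C1 + C2 + t by lra.
    rewrite e1; apply: alg H1 H3 H4 H5 _; by rewrite subr_ge0 ltW.
  rewrite ler_pM2r ?subr_gt0 // in H6.
  by rewrite -[phi s]invrK lef_pV2 // posrE // invr_gt0.
exists A^-1; first by rewrite invr_gt0.
suff phi1 : A^-1 <= phi 1.
  by move=> t /andP[t0 t1]; apply: le_trans phi1 (fni _ _ t0 t1 (lexx 1)).
rewrite leNgt; apply/negP => phi1.
pose e := (A^-1 - phi 1) / 2.
have e0 : 0 < e by rewrite divr_gt0 // subr_gt0.
have [d d0 Hd] := within_contP cf h11 e0.
pose y := Num.max 2^-1 (1 - d / 2).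
have y1 : y < 1 by rewrite /y gt_max; apply/andP; split; lra.
have y2 : 2^-1 <= y by rewrite /y le_max lexx.
have yd : 1 - d / 2 <= y by rewrite /y le_max lexx orbT.
have yy : 0 <= y <= 1 by rewrite (ltW y1) andbT (le_trans _ y2) // invr_ge0.
have hd : `|1 - y| < d by rewrite gtr0_norm ?subr_gt0 //; lra.
have := Hd y yy hd; have := Bpos y y2 y1; rewrite ler_norml /e => q1 /andP[q2 q3].
move: phi1 q1 q2 q3; move: (phi 1) (phi y) A^-1 => u v w; lra.
Qed.

End LowerBound.

(** * First variation of the functional at the minimizer *)

Section Optimality.
Context {R : realType}.
Implicit Types (f g psi : R -> R) (a b d e s x y t K M : R).

(** The expansion is exact with remainder [D^2 / (P^2 Q)]; the bounds [P >= c] and [Q >= c / 2] give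
    the constant [2 / c^3]. *)
Lemma inv_expand (P Q D c m : R) : 0 < c -> c <= P -> c / 2 <= Q -> Q = P + D -> `|D| <= m ->
  Q^-1 <= P^-1 - P^-1 * P^-1 * D + m ^+ 2 * (2 * c^-1 ^+ 3).
Proof.
move=> c0 cP cQ QE Dm.
have P0 : 0 < P by apply: lt_le_trans cP.
have Q0 : 0 < Q by apply: lt_le_trans cQ; rewrite divr_gt0.
have e1 : Q^-1 = P^-1 - P^-1 * P^-1 * D + D ^+ 2 * (P^-1 * P^-1 * Q^-1).
  have Pn : P != 0 by rewrite gt_eqF.
  have Qn : P + D != 0 by rewrite -QE gt_eqF.
  by rewrite QE; field; rewrite Pn Qn.
have hP : P^-1 <= c^-1 by rewrite lef_pV2.
have hQ : Q^-1 <= 2 * c^-1.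
  by rewrite -[2]invrK -invfM lef_pV2 ?posrE // ?mulr_gt0 ?invr_gt0 // mulrC.
have iP : 0 <= P^-1 by rewrite invr_ge0 ltW.
have iQ : 0 <= Q^-1 by rewrite invr_ge0 ltW.
rewrite {1}e1 lerD2l; apply: ler_pM.
- exact: sqr_ge0.
- by rewrite !mulr_ge0.
- by rewrite -(real_normK (num_real D)) lerXn2r // qualifE /= ?(le_trans _ Dm).
- have -> : 2 * c^-1 ^+ 3 = c^-1 * c^-1 * (2 * c^-1) by rewrite !exprS expr0; ring.
  by apply: ler_pM => //; [exact: mulr_ge0|apply: ler_pM].
Qed.

Variables (beta : nat -> R) (h : R) (phi X : R -> R) (c : R).
Hypothesis cX : continuous X.
Hypothesis XE : forall x, 0 <= x <= 1 -> X x = xi2 beta x.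
Hypothesis Pmin : is_Pmin beta h phi.
Hypothesis c0 : 0 < c.
Hypothesis cphi : forall x, 0 <= x <= 1 -> c <= phi x.

Let Cphi : Cset phi := proj1 Pmin.

Definition invsq x : R := (clamp phi x)^-1 * (clamp phi x)^-1.

Lemma clamp_phi_cont : continuous (clamp phi).
Proof. by apply: clamp_cont; case: Cphi. Qed.

Lemma clamp_phi_ge x : c <= clamp phi x.
Proof. by apply: cphi; exact: clamp_in. Qed.

Lemma clamp_phi_gt0 x : 0 < clamp phi x.
Proof. exact: lt_le_trans (clamp_phi_ge x). Qed.

Lemma invphi_cont : continuous (fun x => (clamp phi x)^-1).
Proof.
move=> x; apply: cvgV; first by rewrite gt_eqF // clamp_phi_gt0.
exact: clamp_phi_cont.
Qed.

Lemma invsq_cont : continuous invsq.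
Proof. by move=> x; apply: cvgM; exact: invphi_cont. Qed.

Lemma invsq_gt0 x : 0 < invsq x.
Proof. by rewrite mulr_gt0 // invr_gt0 clamp_phi_gt0. Qed.

(* The first variation of the functional at phi. *)
Definition Jvar f : R := RI 0 1 (fun x => (X x - invsq x) * f x) + h ^+ 2 * f 0.

Lemma Jvar_cont f : continuous f -> continuous (fun x => (X x - invsq x) * f x).
Proof.
move=> cf x; apply: cvgM; last exact: cf.
by apply: cvgB; [exact: cX|exact: invsq_cont].
Qed.

Lemma Jvar_linear : sup_cont_linear Jvar.
Proof.
split.
- move=> f g cf cg; rewrite /Jvar (RI_eq (g := fun x => (X x - invsq x) * f x + (X x - invsq x) * g x)); last first.
    by move=> x _; ring.
  by rewrite RID; [ring|exact/cont_intble/Jvar_cont|exact/cont_intble/Jvar_cont].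
- move=> k f cf; rewrite /Jvar (RI_eq (g := fun x => k * ((X x - invsq x) * f x))); last first.
    by move=> x _; ring.
  by rewrite RIZ; [ring|exact/cont_intble/Jvar_cont].
- have [x0 _ Hx] := @EVT_max R (fun x => `|X x - invsq x|) 0 1 ler01
    (cont_within (fun x => cvg_norm (cvgB (@cX x) (@invsq_cont x)))).
  exists (`|X x0 - invsq x0| + h ^+ 2) => f e cf fe.
  apply: le_trans (ler_normD _ _) _; rewrite mulrDl; apply: lerD.
    have -> : `|X x0 - invsq x0| * e = `|X x0 - invsq x0| * e * (1 - 0) by rewrite subr0 mulr1.
    apply: RI_abs_le => //; first exact/cont_intble/Jvar_cont.
    by move=> x x01; rewrite normrM ler_pM //; [apply: Hx; rewrite in_itv|exact: fe].
  rewrite normrM (ger0_norm (sqr_ge0 _)) ler_wpM2l ?sqr_ge0 // fe //.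
  by rewrite lexx ler01.
Qed.

Lemma Pphi : Defs.Pfun beta h phi =
  (RI 0 1 (fun x => X x * clamp phi x + (clamp phi x)^-1) + h ^+ 2 * phi 0)%:E.
Proof.
apply: (Pfun_pos h cX XE clamp_phi_cont c0 cphi); first by move=> x x01; rewrite clamp_id.
exact: clamp_phi_ge.
Qed.

(** Along an admissible direction the functional changes by at most [e * Jvar d + K * e^2];
    minimality, with [e] tending to 0, gives the sign. *)
Lemma first_variation (d : R -> R) M e0 : continuous d -> (forall x, 0 <= x <= 1 -> `|d x| <= M) -> 0 < e0 ->
  (forall e, 0 < e -> e < e0 -> Cset (fun x => phi x + e * d x) /\
     forall x, 0 <= x <= 1 -> c / 2 <= phi x + e * d x) -> 0 <= Jvar d.
Proof.
move=> cd dM e00 H.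
have h01 : 0 <= (0 : R) <= 1 by rewrite lexx ler01.
have M0 : 0 <= M by apply: le_trans (dM 0 h01).
pose K := M ^+ 2 * (2 * c^-1 ^+ 3).
have K0 : 0 <= K by rewrite /K mulr_ge0 ?sqr_ge0 // mulr_ge0 // exprn_ge0 // invr_ge0 ltW.
suff step e : 0 < e -> e < e0 -> - (K * e) <= Jvar d.
  rewrite leNgt; apply/negP => J0.
  pose e := Num.min (e0 / 2) (- Jvar d / (2 * (K + 1))).
  have K1 : 0 < 2 * (K + 1) by lra.
  have ep : 0 < e by rewrite /e lt_min !divr_gt0 // oppr_gt0.
  have ee : e < e0.
    by apply: le_lt_trans (_ : e0 / 2 < _); [rewrite ge_min lexx|lra].
  have eK : 2 * (K + 1) * e <= - Jvar d.
    by rewrite mulrC -ler_pdivlMr // ge_min lexx orbT.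
  have := step e ep ee; have : 0 <= K * e by rewrite mulr_ge0 // ltW.
  move: eK; have -> : 2 * (K + 1) * e = 2 * (K * e) + 2 * e by ring.
  by lra.
move=> ep ee; have [Ce Hc] := H e ep ee.
pose p := clamp phi.
(* The perturbed function cut from below at [c / 2]: the same on [0, 1], but with a continuous
   reciprocal on the whole line. *)
pose q x := Num.max (c / 2) (p x + e * d x).
have cq : continuous q.
  move=> x; apply: (@continuous_max R R (cst (c / 2)) (fun x => p x + e * d x) x).
    exact: cvg_cst.
  by apply: cvgD; [exact: clamp_phi_cont|apply: cvgM; [exact: cvg_cst|exact: cd]].
have pE x : 0 <= x <= 1 -> p x = phi x by exact: clamp_id.
have qE x : 0 <= x <= 1 -> q x = p x + e * d x.
  by move=> x01; rewrite /q max_r // pE // Hc.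
have c20 : 0 < c / 2 by rewrite divr_gt0.
have q2 x : c / 2 <= q x by rewrite /q le_max lexx.
have := (proj2 Pmin) _ Ce; rewrite Pphi (Pfun_pos h cX XE cq c20 Hc); last 2 first.
  by move=> x x01; rewrite qE // pE.
  exact: q2.
rewrite lee_fin => HP.
have cqi : continuous (fun x => (q x)^-1).
  by move=> x; apply: cvgV; [rewrite gt_eqF // (lt_le_trans c20)|exact: cq].
have i1 : intble 0 1 (fun x => X x * q x + (q x)^-1).
  by apply: cont_intble => x; apply: cvgD; [apply: cvgM; [exact: cX|exact: cq]|exact: cqi].
have i2 : intble 0 1 (fun x => X x * p x + (p x)^-1).
  apply: cont_intble => x; apply: cvgD; last exact: invphi_cont.
  by apply: cvgM; [exact: cX|exact: clamp_phi_cont].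
have i3 : intble 0 1 (fun x => (X x - invsq x) * d x) by exact/cont_intble/Jvar_cont.
have i4 : intble 0 1 (fun _ : R => e ^+ 2 * K) by exact: intble_cst.
have key : RI 0 1 (fun x => X x * q x + (q x)^-1) <= RI 0 1 (fun x => X x * p x + (p x)^-1) +
   (e * RI 0 1 (fun x => (X x - invsq x) * d x) + e ^+ 2 * K).
  have -> : e ^+ 2 * K = RI 0 1 (fun _ : R => e ^+ 2 * K) by rewrite RI_cst // subr0 mulr1.
  rewrite -RIZ // -RID //; last exact: intbleZ.
  rewrite -RID //; last by apply: intbleD => //; exact: intbleZ.
  apply: RI_le => //; first by apply: intbleD => //; apply: intbleD => //; exact: intbleZ.
  move=> x x01.
  have ed : `|e * d x| <= e * M by rewrite normrM (gtr0_norm ep) ler_pM2l // dM.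
  have h1 := inv_expand c0 (clamp_phi_ge x) (q2 x) (qE x x01) ed.
  rewrite {1}qE // -/p /invsq; move: h1; rewrite -/p /K exprMn.
  by move: ((q x)^-1) (p x) ((p x)^-1) => *; lra.
have e2 : e ^+ 2 * K = e * (K * e) by rewrite expr2; ring.
have : 0 <= e * (Jvar d + K * e).
  move: HP key; rewrite e2 /Jvar /p.
  move: (RI 0 1 (fun x => X x * q x + _)) (RI 0 1 (fun x => X x * clamp phi x + _)) => r1 r2.
  by move: (RI _ _ _) (phi 0) (d 0) (K * e) => r3 r4 r5 r6; lra.
by rewrite pmulr_rge0 // => hh; lra.
Qed.

Lemma Jvar_ge0 f : Cset f -> continuous f -> 0 <= Jvar f.
Proof.
move=> Cf cf; have [_ [f0 [fni _]]] := Cf.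
apply: (@first_variation f (f 0) 1) => //.
- move=> x x01; rewrite ger0_norm ?f0 //; case/andP: x01 => x0 x1.
  exact: fni.
- move=> e ep _; split; first exact: CsetD Cphi (CsetZ (ltW ep) Cf).
  move=> x x01; have := cphi x01; have : 0 <= e * f x by rewrite mulr_ge0 ?f0 // ltW.
  by move: c0 => c0'; lra.
Qed.

(** The constants are a two-sided direction: lowering [phi] by less than [c / 2] keeps it in the
    cone. *)
Lemma Jvar_one : Jvar (fun=> 1) = 0.
Proof.
have c1 k : continuous (fun _ : R => k : R) by move=> x; exact: cvg_cst.
apply/le_anti; rewrite Jvar_ge0 ?andbT //; last exact: Cset_cst.
have [_ JZ _] := Jvar_linear.
suff : 0 <= Jvar (fun x => -1 * 1) by rewrite JZ // mulN1r oppr_ge0.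
apply: (@first_variation _ 1 (c / 2)) => //.
- by move=> x _; rewrite mulr1 normrN normr1.
- by rewrite divr_gt0.
- move=> e ep ee; split; last by move=> x x01; have := cphi x01; lra.
  have [cf [f0 [fni fc]]] := Cphi.
  split; first by move=> x; apply: cvgD; [exact: cf|exact: cvg_cst].
  split; first by move=> x x01; have := cphi x01; have := c0; lra.
  split; first by move=> x y x0 xy y1; rewrite lerD2r fni.
  by move=> x y t x01 y01 t01; have := fc x y t x01 y01 t01; lra.
Qed.

Lemma Jvar_phi : Jvar (clamp phi) = 0.
Proof.
have Cc : Cset (clamp phi).
  by apply: Cset_ext Cphi => x x01; rewrite clamp_id.
apply/le_anti; rewrite (Jvar_ge0 Cc clamp_phi_cont) andbT.
have [_ JZ _] := Jvar_linear.
suff : 0 <= Jvar (fun x => -1 * clamp phi x).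
  by rewrite JZ ?mulN1r ?oppr_ge0 //; exact: clamp_phi_cont.
have [_ [f0 [fni _]]] := Cphi.
apply: (@first_variation _ (phi 0) 2^-1) => //.
- by move=> x; apply: cvgM; [exact: cvg_cst|exact: clamp_phi_cont].
- move=> x /andP[x0 x1]; rewrite mulN1r normrN clamp_id ?x0 // ger0_norm; last by apply: f0; rewrite x0.
  exact: fni.
- move=> e ep ee; have e1 : 0 <= 1 - e by lra.
  split.
    by apply: Cset_ext (CsetZ e1 Cphi) => x x01; rewrite clamp_id //; ring.
  move=> x x01; rewrite clamp_id //.
  have -> : phi x + e * (-1 * phi x) = (1 - e) * phi x by ring.
  have a1 : (1 - e) * c <= (1 - e) * phi x by rewrite ler_wpM2l // cphi.
  have a2 : 2^-1 * c <= (1 - e) * c by rewrite ler_pM2r //; lra.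
  by apply: le_trans a1; rewrite mulrC.
Qed.

End Optimality.

(** * Conditions at a minimum, and the concavity defect as a linear functional *)

Section OrderConditions.
Context {R : realType}.
Implicit Types (f g : R -> R) (a b x y s t e : R).

Lemma mvt01 f f1 a b : 0 <= a -> a < b -> b <= 1 ->
  (forall x, 0 <= x <= 1 -> is_derive x 1 f (f1 x)) ->
  exists c, [/\ a < c, c < b & f b - f a = f1 c * (b - a)].
Proof.
move=> a0 ab b1 df.
have hz z : a <= z -> z <= b -> 0 <= z <= 1.
  by move=> az zb; rewrite (le_trans a0 az) (le_trans zb b1).
have h1 x : x \in `]a, b[%R -> is_derive x 1 f (f1 x).
  by rewrite in_itv /= => /andP[ax xb]; apply: df; apply: hz; exact: ltW.
have h2 : {within `[a, b], continuous f}.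
  apply: continuous_in_subspaceT => x; rewrite inE /= in_itv /= => /andP[ax xb].
  exact: is_derive_cont (df x (hz x ax xb)).
have [c] := MVT ab h1 h2; rewrite in_itv /= => /andP[ac cb] E.
by exists c.
Qed.

Lemma interior_min f f1 t : (forall x, 0 <= x <= 1 -> is_derive x 1 f (f1 x)) ->
  (forall x, 0 <= x <= 1 -> 0 <= f x) -> 0 < t < 1 -> f t = 0 -> f1 t = 0.
Proof.
move=> df f0 /andP[t0 t1] ft.
have h1 x : x \in `](0 : R), 1[%R -> derivable f x 1.
  rewrite in_itv /= => /andP[x0 x1].
  have x01 : 0 <= x <= 1 by rewrite !ltW.
  by have [] := df x x01.
have t01 : 0 <= t <= 1 by rewrite !ltW.
have : is_derive t 1 f 0.
  apply: (derive1_at_min ler01 h1); first by rewrite in_itv /= t0.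
  move=> x; rewrite in_itv /= => /andP[x0 x1]; rewrite ft f0 //.
  by rewrite !ltW.
move=> /is_derive_derive1 <-; apply/esym; apply: is_derive_derive1; exact: df.
Qed.

Lemma cont_neg f x : continuous f -> f x < 0 ->
  exists2 d, 0 < d & forall y, `|x - y| < d -> f y < 0.
Proof.
move=> cf fx; have h : 0 < - f x / 2 by lra.
have /cvgrPdist_lt /(_ _ h) [d /= d0 Hd] := cf x.
exists d => // y yd; have := Hd y yd; rewrite ltr_norml => /andP[]; lra.
Qed.

Lemma left_min f f1 g : (forall x, 0 <= x <= 1 -> is_derive x 1 f (f1 x)) ->
  continuous g -> (forall x, 0 <= x <= 1 -> g x = f1 x) ->
  (forall x, 0 <= x <= 1 -> 0 <= f x) -> f 0 = 0 -> 0 <= f1 0.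
Proof.
move=> df cg gf f0 f00; rewrite leNgt; apply/negP => f1neg.
have h01 : 0 <= (0 : R) <= 1 by rewrite lexx ler01.
have g0 : g 0 < 0 by rewrite gf.
have [d d0 Hd] := cont_neg cg g0.
pose y := Num.min (d / 2) 1.
have y0 : 0 < y by rewrite /y lt_min divr_gt0 // ltr01.
have y1 : y <= 1 by rewrite /y ge_min lexx orbT.
have yd : y < d by rewrite /y gt_min; apply/orP; left; lra.
have [c [c0 cy]] := mvt01 (lexx 0) y0 y1 df.
rewrite f00 !subr0 => E.
have y01 : 0 <= y <= 1 by rewrite y1 ltW.
have c01 : 0 <= c <= 1 by rewrite ltW //= (le_trans (ltW cy)).
have cneg : f1 c < 0.
  rewrite -gf //; apply: Hd; rewrite sub0r normrN gtr0_norm //; exact: lt_trans yd.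
have := f0 y y01; rewrite E pmulr_lge0 // leNgt cneg //.
Qed.

Lemma second_order f f1 f2 t : (forall x, 0 <= x <= 1 -> is_derive x 1 f (f1 x)) ->
  (forall x, 0 <= x <= 1 -> is_derive x 1 f1 (f2 x)) -> continuous f2 ->
  (forall x, 0 <= x <= 1 -> 0 <= f x) -> 0 <= t <= 1 -> f t = 0 -> f1 t = 0 -> 0 <= f2 t.
Proof.
move=> df df1 cf2 f0 t01 ft f1t; rewrite leNgt; apply/negP => f2neg.
have [d d0 Hd] := cont_neg cf2 f2neg.
have /andP[t0 t1] := t01.
have [t1'|t1'] := ltP t 1.
  pose y := Num.min (t + d / 2) 1.
  have ty : t < y by rewrite /y lt_min t1' andbT; lra.
  have y1 : y <= 1 by rewrite /y ge_min lexx orbT.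
  have yd : y <= t + d / 2 by rewrite /y ge_min lexx.
  have [c [tc cy E]] := mvt01 t0 ty y1 df.
  have [c' [tc' cc' E']] := mvt01 t0 tc (le_trans (ltW cy) y1) df1.
  have n2 : f2 c' < 0 by apply: Hd; rewrite ltr_norml; apply/andP; split; lra.
  have tc0 : 0 < c - t by rewrite subr_gt0.
  have ty0 : 0 < y - t by rewrite subr_gt0.
  have n1 : f1 c < 0.
    by rewrite f1t subr0 in E'; rewrite E' nmulr_rlt0.
  have y01 : 0 <= y <= 1 by rewrite y1 (le_trans t0 (ltW ty)).
  by have := f0 y y01; rewrite ft subr0 in E; rewrite E leNgt nmulr_rlt0 // ty0.
have e1 : t = 1 by apply/le_anti; rewrite t1 t1'.
pose y := Num.max (t - d / 2) 0.
have yt : y < t by rewrite /y gt_max; apply/andP; split; lra.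
have y0 : 0 <= y by rewrite /y le_max lexx orbT.
have yd : t - d / 2 <= y by rewrite /y le_max lexx.
have [c [tc cy E]] := mvt01 y0 yt t1 df.
have [c' [tc' cc' E']] := mvt01 (le_trans y0 (ltW tc)) cy t1 df1.
have n2 : f2 c' < 0 by apply: Hd; rewrite ltr_norml; apply/andP; split; lra.
have tc0 : 0 < t - c by rewrite subr_gt0.
have ty0 : 0 < t - y by rewrite subr_gt0.
have n1 : 0 < f1 c.
  by rewrite f1t sub0r in E'; rewrite -oppr_lt0 E' nmulr_rlt0.
have y01 : 0 <= y <= 1 by rewrite y0 (le_trans (ltW yt)).
have := f0 y y01; rewrite ft sub0r in E; rewrite -oppr_le0 E leNgt.
by rewrite pmulr_rgt0 // ty0.
Qed.

(** Taylor's formula with integral remainder: the kernel is constant on [[0, s]], and on [[s, 1]]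
    the integrand has primitive [(1 - x) * f1 x + f x]. *)
Lemma hinge_by_parts f f1 f2 s : (forall x, 0 <= x <= 1 -> is_derive x 1 f (f1 x)) ->
  (forall x, 0 <= x <= 1 -> is_derive x 1 f1 (f2 x)) -> continuous f2 -> 0 <= s < 1 ->
  RI 0 1 (fun x => f2 x * hinge s x) = f 1 - f s - f1 0 * (1 - s).
Proof.
move=> df df1 cf2 /andP[s0 s1].
have cJ : continuous (fun x => f2 x * hinge s x).
  by move=> x; apply: cvgM; [exact: cf2|exact: hinge_cont].
rewrite (RI_cat s0 (ltW s1) (cont_intble 0 1 cJ)).
have E1 : RI 0 s (fun x => f2 x * hinge s x) = (1 - s) * f1 s - (1 - s) * f1 0.
  rewrite (RI_eq (g := fun x => (1 - s) * f2 x)); last first.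
    by move=> x /andP[x0 xs]; rewrite /hinge max_r // mulrC.
  apply: (@RI_ftc' _ _ (fun x => (1 - s) * f1 x)); first exact: s0.
    by apply: cont_within => x; apply: cvgM; [exact: cvg_cst|exact: cf2].
  move=> x /andP[x0 xs]; apply: idZ; apply: df1; rewrite x0; exact: le_trans xs (ltW s1).
have E2 : RI s 1 (fun x => f2 x * hinge s x) =
    ((1 - 1) * f1 1 + f 1) - ((1 - s) * f1 s + f s).
  rewrite (RI_eq (g := fun x => (1 - x) * f2 x)); last first.
    by move=> x /andP[sx x1]; rewrite /hinge max_l // mulrC.
  apply: (@RI_ftc' _ _ (fun x => (1 - x) * f1 x + f x)); first exact: ltW.
    apply: cont_within => x; apply: cvgM; last exact: cf2.
    by apply: cvgB; [exact: cvg_cst|exact: cvg_id].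
  move=> x /andP[sx x1]; have x01 : 0 <= x <= 1 by rewrite x1 (le_trans s0).
  apply: is_derive_eq (idD (idM (idB (idcst 1 x) (is_derive_id x 1)) (df1 x x01)) (df x x01)) _.
  ring.
by rewrite E1 E2; ring.
Qed.

Lemma sclB (L1 L2 : (R -> R) -> R) (k : R) : sup_cont_linear L1 -> sup_cont_linear L2 ->
  sup_cont_linear (fun f => k * L1 f - L2 f).
Proof.
move=> [D1 Z1 [B1 H1]] [D2 Z2 [B2 H2]]; split.
- by move=> f g cf cg; rewrite D1 // D2 //; ring.
- by move=> r f cf; rewrite Z1 // Z2 //; ring.
- exists (`|k| * B1 + B2) => f e cf fe.
  apply: le_trans (ler_normB _ _) _; rewrite mulrDl normrM -mulrA.
  by apply: lerD; [rewrite ler_wpM2l // H1|exact: H2].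
Qed.

(** The concavity defect on the chord from [a] to [b]: for [t] in [0, 1] it is nonnegative on
    concave functions, and it is zero on affine ones. *)
Definition gap a b t f : R := f (t * a + (1 - t) * b) - (t * f a + (1 - t) * f b).

Lemma gap_linear a b t : 0 <= a <= 1 -> 0 <= b <= 1 -> 0 <= t <= 1 ->
  sup_cont_linear (gap a b t).
Proof.
move=> a01 b01 t01.
have /andP[t0 t1] := t01; have t1' : 0 <= 1 - t by lra.
have m01 : 0 <= t * a + (1 - t) * b <= 1.
  move: a01 b01 => /andP[a0 a1] /andP[b0 b1].
  rewrite addr_ge0 ?mulr_ge0 //=.
  have h1 : t * a <= t * 1 by rewrite ler_wpM2l.
  have h2 : (1 - t) * b <= (1 - t) * 1 by rewrite ler_wpM2l.
  lra.
split.
- by move=> f g _ _; rewrite /gap; ring.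
- by move=> k f _; rewrite /gap; ring.
- exists 2 => f e _ fe; rewrite /gap.
  apply: le_trans (ler_normB _ _) _.
  have h1 := fe _ m01.
  have h2 : `|t * f a + (1 - t) * f b| <= t * e + (1 - t) * e.
    apply: le_trans (ler_normD _ _) _; rewrite !normrM (ger0_norm t0) (ger0_norm t1').
    by apply: lerD; rewrite ler_wpM2l // fe.
  have e2 : t * e + (1 - t) * e = e by ring.
  by rewrite e2 in h2; lra.
Qed.

Lemma gap_hinge a b t s : a <= b -> b <= 1 -> 0 <= t <= 1 -> 0 <= s ->
  (s <= a \/ b <= s -> gap a b t (hinge s) = 0) /\ gap a b t (hinge s) <= 1.
Proof.
move=> ab b1 /andP[t0 t1] s0; have t1' : 0 <= 1 - t by lra.
have ma : a <= t * a + (1 - t) * b.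
  have : (1 - t) * a <= (1 - t) * b by rewrite ler_wpM2l.
  by rewrite mulrBl mul1r; lra.
have mb : t * a + (1 - t) * b <= b.
  have : t * a <= t * b by rewrite ler_wpM2l.
  by rewrite mulrBl mul1r; lra.
have E1 : s <= a -> gap a b t (hinge s) = 0.
  move=> sa; rewrite /gap /hinge !max_l; [ring|lra..].
have E2 : b <= s -> gap a b t (hinge s) = 0.
  move=> bs; rewrite /gap /hinge !max_r; [ring|lra..].
split; first by case.
have [sa|sa] := leP s a; first by rewrite E1.
have [bs|bs] := leP b s; first by rewrite E2.
rewrite /gap /hinge (max_r (ltW sa)) (max_l (ltW bs)).
have h1 : s <= Num.max (t * a + (1 - t) * b) s by rewrite le_max lexx orbT.
have h2 : (1 - t) * (b - s) <= 1 * 1.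
  by apply: ler_pM => //; [rewrite subr_ge0 ltW|lra|lra].
move: h1; move: (Num.max _ _) => mm h1.
have -> : 1 - mm - (t * (1 - s) + (1 - t) * (1 - b)) = (1 - t) * (b - s) - (mm - s) by ring.
lra.
Qed.

End OrderConditions.

(** * The dual function, complementary slackness and the Lipschitz bound at 1 *)

Section Dual.
Context {R : realType}.
Implicit Types (f g psi : R -> R) (a b d e s x y t K M : R).
Variables (beta : nat -> R) (h : R) (phi X : R -> R) (c : R).
Hypothesis cX : continuous X.
Hypothesis XE : forall x, 0 <= x <= 1 -> X x = xi2 beta x.
Hypothesis Pmin : is_Pmin beta h phi.
Hypothesis c0 : 0 < c.
Hypothesis cphi : forall x, 0 <= x <= 1 -> c <= phi x.
Hypothesis dxi : forall x, 0 <= x <= 1 -> is_derive x 1 (xi beta) (xi1 beta x).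
Hypothesis dxi1 : forall x, 0 <= x <= 1 -> is_derive x 1 (xi1 beta) (X x).

Let Cphi : Cset phi := proj1 Pmin.
Let w := invsq phi.
Let J := Jvar h phi X.

(** Two successive primitives of [invsq phi], corrected by an affine function that fits the boundary
    values. The integrand is cut off on the negative axis so that [primitive] applies, hence the
    condition [0 <= x] in the identity for [e2]. *)
Lemma dual_exists : exists e0 e1 e2 : R -> R,
  [/\ continuous e2, forall x, is_derive x 1 e0 (e1 x), forall x, is_derive x 1 e1 (e2 x),
      forall x, 0 <= x -> e2 x = w x & e0 1 = xi beta 1 /\ e1 0 = xi1 beta 0 - h ^+ 2].
Proof.
pose q x := w x * Num.max 0 (Num.min (x + 1) 1).
have cq : continuous q.
  move=> x; apply: cvgM; first exact: (invsq_cont Pmin c0 cphi).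
  apply: (@continuous_max R R (cst 0) (fun x => Num.min (x + 1) 1) x); first exact: cvg_cst.
  apply: (@continuous_min R R (fun x => x + 1) (cst 1) x); last exact: cvg_cst.
  by apply: cvgD; [exact: cvg_id|exact: cvg_cst].
have q0 y : y <= - 1 -> q y = 0.
  by move=> y1; rewrite /q max_l ?mulr0 // ge_min; apply/orP; left; lra.
have qw x : 0 <= x -> q x = w x.
  by move=> x0; rewrite /q min_r ?max_r ?mulr1 //; lra.
pose A1 := primitive q.
have dA1 x : is_derive x 1 A1 (q x) by exact: primitive_derive.
have cA1 : continuous A1 by move=> x; exact: is_derive_cont (dA1 x).
pose A2 := primitive A1.
have dA2 x : is_derive x 1 A2 (A1 x).
  by apply: primitive_derive => // y y1; exact: primitive_le.
pose k := xi1 beta 0 - h ^+ 2 - A1 0.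
exists (fun x => (k * x + (xi beta 1 - k - A2 1)) + A2 x), (fun x => k + A1 x), q.
split => //.
- by move=> x; apply: idD => //; exact: idaff.
- by move=> x; apply: is_derive_eq (idD (idcst k x) (dA1 x)) _; rewrite add0r.
- by split; rewrite /k; ring.
Qed.

Variables (e0 e1 e2 : R -> R).
Hypothesis ce2 : continuous e2.
Hypothesis de0 : forall x, is_derive x 1 e0 (e1 x).
Hypothesis de1 : forall x, is_derive x 1 e1 (e2 x).
Hypothesis e2w : forall x, 0 <= x -> e2 x = w x.
Hypothesis e01 : e0 1 = xi beta 1.
Hypothesis e10 : e1 0 = xi1 beta 0 - h ^+ 2.

Let u x := e0 x - xi beta x.
Let u1 x := e1 x - xi1 beta x.
Let u2 x := e2 x - X x.

Lemma du x : 0 <= x <= 1 -> is_derive x 1 u (u1 x).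
Proof. by move=> x01; exact: (idB (de0 x) (dxi x01)). Qed.

Lemma du1 x : 0 <= x <= 1 -> is_derive x 1 u1 (u2 x).
Proof. by move=> x01; exact: (idB (de1 x) (dxi1 x01)). Qed.

Lemma u2_cont : continuous u2.
Proof. by move=> x; apply: cvgB; [exact: ce2|exact: cX]. Qed.

(** This is [hinge_by_parts] for [u]; the term [h^2 * hinge s 0] cancels the boundary term, because
    [u1 0 = - h^2]. *)
Lemma Jvar_hinge s : 0 <= s < 1 -> J (hinge s) = u s.
Proof.
move=> s01; have /andP[s0 s1] := s01.
rewrite /J /Jvar -/w (RI_eq (g := fun x => -1 * (u2 x * hinge s x))); last first.
  by move=> x /andP[x0 xs]; rewrite /u2 e2w //; ring.
rewrite RIZ; last first.
  by apply: cont_intble => x; apply: cvgM; [exact: u2_cont|exact: hinge_cont].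
rewrite (hinge_by_parts du du1 u2_cont s01) /hinge max_r //.
have -> : u1 0 = - h ^+ 2 by rewrite /u1 e10; ring.
have -> : u 1 = 0 by rewrite /u e01 subrr.
by ring.
Qed.

Lemma dual_slope1 : e1 1 = xi1 beta 1.
Proof.
have := Jvar_one cX XE Pmin c0 cphi; rewrite /Jvar -/w.
rewrite (RI_eq (g := fun x => -1 * u2 x)); last first.
  by move=> x /andP[x0 _]; rewrite /u2 e2w //; ring.
rewrite RIZ; last by apply: cont_intble; exact: u2_cont.
rewrite (RI_ftc' ler01 (cont_within (@u2_cont)) du1) /u1 e10 => E.
by apply/eqP; rewrite -subr_eq0; apply/eqP; move: E; lra.
Qed.

Lemma dual_ge x : 0 <= x <= 1 -> xi beta x <= e0 x.
Proof.
move=> /andP[x0]; rewrite le_eqVlt => /orP[/eqP ->|x1]; first by rewrite e01.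
rewrite -subr_ge0 -/(u x) -Jvar_hinge ?x0 //.
apply: (Jvar_ge0 cX XE Pmin c0 cphi); last exact: hinge_cont.
by apply: Cset_hinge; rewrite x0 ltW.
Qed.

Lemma u_ge0 x : 0 <= x <= 1 -> 0 <= u x.
Proof. by move=> x01; rewrite subr_ge0 dual_ge. Qed.

(** Complementary slackness in dual form: [k * J - L] is nonnegative on the generators, hence at
    [phi], and [J] vanishes there. *)
Lemma dominated (L : (R -> R) -> R) k : sup_cont_linear L -> L (fun=> 1) = 0 ->
  (forall s, 0 <= s < 1 -> L (hinge s) <= k * u s) -> L (clamp phi) <= 0.
Proof.
move=> Llin L1 Lh.
have JL := Jvar_linear (h := h) cX Pmin c0 cphi.
have Cc : Cset (clamp phi) by apply: Cset_ext Cphi => x x01; rewrite clamp_id.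
have := cone_ge0 (sclB k JL Llin) Cc (clamp_phi_cont Pmin).
rewrite (Jvar_one cX XE Pmin c0 cphi) (Jvar_phi cX XE Pmin c0 cphi) L1 !mulr0 !sub0r oppr0.
move=> /(_ (lexx 0)) H; rewrite -oppr_ge0; apply: H => s s01.
by rewrite -/J Jvar_hinge // subr_ge0 Lh.
Qed.

(** The defect [gap a b t] only sees hinges with corner in [[a, b]], where [u] has a positive
    minimum; so it is dominated by a multiple of [u] and is at most 0 at [phi]. Concavity gives the
    other sign. *)
Lemma affine_on a b t : 0 <= a -> a <= b -> b <= 1 ->
  (forall x, a <= x <= b -> 0 < u x) -> 0 <= t <= 1 ->
  phi (t * a + (1 - t) * b) = t * phi a + (1 - t) * phi b.
Proof.
move=> a0 ab b1 upos t01.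
have a01 : 0 <= a <= 1 by rewrite a0 (le_trans ab).
have b01 : 0 <= b <= 1 by rewrite b1 (le_trans a0).
have m01 : 0 <= t * a + (1 - t) * b <= 1.
  case/andP: t01 => t0 t1; have t1' : 0 <= 1 - t by lra.
  case/andP: a01 => _ a1; case/andP: b01 => b0 _.
  rewrite addr_ge0 ?mulr_ge0 //=.
  have h1 : t * a <= t * 1 by rewrite ler_wpM2l.
  have h2 : (1 - t) * b <= (1 - t) * 1 by rewrite ler_wpM2l.
  lra.
have cu : {within `[a, b], continuous u}.
  apply: continuous_in_subspaceT => x; rewrite inE /= in_itv /= => /andP[ax xb].
  by apply: is_derive_cont (du _); rewrite (le_trans a0 ax) (le_trans xb b1).
have [z zab zmin] := EVT_min ab cu.
have uz : 0 < u z by apply: upos; move: zab; rewrite in_itv.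
have := @dominated (gap a b t) (u z)^-1 (gap_linear a01 b01 t01).
have g1 : gap a b t (fun=> 1) = 0 by rewrite /gap; ring.
have gh s : 0 <= s < 1 -> gap a b t (hinge s) <= (u z)^-1 * u s.
  move=> /andP[s0 s1]; have [H1 H2] := gap_hinge ab b1 t01 s0.
  have [sab|sab] := boolP (a <= s <= b).
    apply: le_trans H2 _; rewrite mulrC ler_pdivlMr // mul1r; apply: zmin.
    by rewrite in_itv.
  rewrite H1; first by rewrite mulr_ge0 ?invr_ge0 ?(ltW uz) // u_ge0 // s0 ltW.
  by move: sab; rewrite negb_and -!ltNge => /orP[?|?]; [left|right]; exact: ltW.
move=> /(_ g1 gh); rewrite /gap !clamp_id // subr_le0 => h1.
apply/le_anti; rewrite h1 /=.
by have [_ [_ [_ fc]]] := Cphi; exact: fc.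
Qed.

(** The functional [f 0 - f d] ignores hinges with corner at or beyond [d], and [u] has a positive
    minimum on [[0, d]]. Domination gives [phi 0 <= phi d]. *)
Lemma const_near0 d : 0 < d -> d <= 1 -> (forall x, 0 <= x <= d -> 0 < u x) -> phi d = phi 0.
Proof.
move=> d0 d1 upos.
have cu : {within `[0, d], continuous u}.
  apply: continuous_in_subspaceT => x; rewrite inE /= in_itv /= => /andP[x0 xd].
  by apply: is_derive_cont (du _); rewrite x0 (le_trans xd d1).
have [z zd zmin] := EVT_min (ltW d0) cu.
have uz : 0 < u z by apply: upos; move: zd; rewrite in_itv.
pose L f : R := f 0 - f d.
have h01 : 0 <= (0 : R) <= 1 by rewrite lexx ler01.
have d01 : 0 <= d <= 1 by rewrite d1 ltW.
have Ll : sup_cont_linear L.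
  split; [by move=> *; rewrite /L; ring|by move=> *; rewrite /L; ring|].
  exists 2 => f e _ fe; apply: le_trans (ler_normB _ _) _.
  by have := fe 0 h01; have := fe d d01; lra.
have L1 : L (fun=> 1) = 0 by rewrite /L subrr.
have Lh s : 0 <= s < 1 -> L (hinge s) <= (u z)^-1 * u s.
  move=> /andP[s0 s1]; rewrite /L /hinge (max_r s0).
  have us : 0 <= (u z)^-1 * u s.
    by rewrite mulr_ge0 ?invr_ge0 ?(ltW uz) // u_ge0 // s0 ltW.
  have [ds|sd] := leP d s; first by rewrite subrr.
  apply: (@le_trans _ _ 1); first by lra.
  rewrite mulrC ler_pdivlMr // mul1r; apply: zmin; by rewrite in_itv /= s0 ltW.
have := dominated Ll L1 Lh; rewrite /L !clamp_id // subr_le0 => h1.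
apply/le_anti; rewrite h1 andbT; have [_ [_ [fni _]]] := Cphi.
by apply: fni => //; exact: ltW.
Qed.

Lemma contact t : 0 <= t <= 1 -> xi beta t = e0 t -> e1 t = xi1 beta t /\ X t <= e2 t.
Proof.
move=> t01 E; have ut : u t = 0 by rewrite /u E subrr.
have u1t : u1 t = 0.
  have /andP[t0 t1] := t01.
  have [t1'|t1'] := ltP t 1; last first.
    have -> : t = 1 by apply/le_anti; rewrite t1 t1'.
    by rewrite /u1 dual_slope1 subrr.
  have [t0'|t0'] := ltP 0 t.
    by apply: (interior_min du u_ge0) => //; rewrite t0'.
  (* At 0 the minimum gives only [0 <= u1 0]; since [u1 0 = - h^2], contact at 0 forces [h = 0]. *)
  have E0 : t = 0 by apply/le_anti; rewrite t0 t0'.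
  have h01 : 0 <= (0 : R) <= 1 by rewrite lexx ler01.
  have cu1 : {within `[0, 1], continuous u1}.
    apply: continuous_in_subspaceT => x; rewrite inE /= in_itv /= => x01.
    exact: is_derive_cont (du1 x01).
  have ut0 : u 0 = 0 by move: ut; rewrite E0.
  have := left_min du (clamp_cont cu1) (fun x => @clamp_id R u1 x) u_ge0 ut0.
  rewrite E0 /u1 e10 => hh.
  have := sqr_ge0 h; have -> : h ^+ 2 = 0; last by rewrite subr0 subrr.
  by apply/le_anti; rewrite sqr_ge0 andbT; lra.
split; first by apply/eqP; rewrite -subr_eq0 -/(u1 t) u1t.
rewrite -subr_ge0 -/(u2 t); exact: (second_order du du1 u2_cont u_ge0 t01 ut u1t).
Qed.

(** By concavity the descent rate from [t] to [r] is at most that from [r] to 1, so bounds at points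
    accumulating at 1 suffice. *)
Lemma lipschitz_from_seq C : 0 <= C ->
  (forall d, 0 < d -> exists r, [/\ 0 <= r, 1 - d < r, r < 1 & phi r - phi 1 <= C * (1 - r)]) ->
  forall t, 0 <= t <= 1 -> phi t - phi 1 <= C * (1 - t).
Proof.
move=> C0 H t /andP[t0]; rewrite le_eqVlt => /orP[/eqP ->|t1]; first by rewrite !subrr mulr0.
have t1' : 0 < 1 - t by rewrite subr_gt0.
have [r [r0 tr r1 Hr]] := H _ t1'.
have tr' : t < r by lra.
have := Cset_slope Cphi t0 tr' r1 (lexx 1).
have h1 : (phi r - phi 1) * (r - t) <= C * (1 - r) * (r - t).
  by rewrite ler_wpM2r // subr_ge0 ltW.
move=> h2; have h3 : (phi t - phi r) * (1 - r) <= C * (r - t) * (1 - r).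
  by apply: le_trans h2 _; apply: le_trans h1 _; rewrite mulrAC.
rewrite ler_pM2r ?subr_gt0 // in h3.
have -> : C * (1 - t) = C * (r - t) + C * (1 - r) by ring.
lra.
Qed.

(** Either [u > 0] on some interval ending at 1, and [phi] is affine there, or zeros of [u]
    accumulate at 1. In the second case Rolle's theorem for [u1], which vanishes at these zeros and
    at 1, gives points where [1 / phi^2 = xi''], and the Lipschitz bound on [xi''] passes to
    [phi]. *)
Lemma lipschitz_at1 L : 0 <= L -> (forall x y, 0 <= x -> x <= y -> y <= 1 -> X y - X x <= L * (y - x)) ->
  exists2 C, 0 <= C & forall t, 0 <= t <= 1 -> phi t - phi 1 <= C * (1 - t).
Proof.
move=> L0 XL; have [cf [f0 [fni fc]]] := Cphi.
have h11 : 0 <= (1 : R) <= 1 by rewrite ler01 lexx.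
have [[d [d0 d1 upos]]|nA] := pselect (exists d, [/\ 0 < d, d < 1 & forall x, 1 - d <= x < 1 -> 0 < u x]).
  pose a := 1 - d; pose m := 1 - d / 2.
  have am : a < m by rewrite /a /m; lra.
  have a0 : 0 <= a by rewrite /a; lra.
  have m1 : m < 1 by rewrite /m; lra.
  pose C := (phi a - phi m) / (m - a).
  have C0 : 0 <= C.
    by apply: divr_ge0; rewrite subr_ge0; [apply: fni => //|]; exact: ltW.
  have CE : C * (m - a) = phi a - phi m by rewrite /C mulfVK // subr_eq0 gt_eqF.
  (* [affine_on] is used on [[a, b]] with [b < 1], since [u 1 = 0]; the fixed chord from [a] to [m]
     then determines [phi b]. *)
  have line b : m < b -> b < 1 -> phi b = phi a - C * (b - a).
    move=> mb b1; have ba : 0 < b - a by lra.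
    pose t := (b - m) / (b - a).
    have tE : t * (b - a) = b - m by rewrite /t mulfVK // gt_eqF.
    have t01 : 0 <= t <= 1 by rewrite /t divr_ge0 ?ler_pdivrMr //; lra.
    have ab : a <= b by lra.
    have ub x : a <= x <= b -> 0 < u x by move=> /andP[ax xb]; apply: upos; rewrite -/a ax (le_lt_trans xb).
    have := affine_on a0 ab (ltW b1) ub t01.
    have -> : t * a + (1 - t) * b = m.
      have -> : t * a + (1 - t) * b = b - t * (b - a) by ring.
      by rewrite tE; ring.
    move=> E; apply/eqP; rewrite -subr_eq0 -(mulIr_eq0 _ (mulIf (_ : m - a != 0))); last first.
      by rewrite subr_eq0 gt_eqF.
    have -> : (phi b - (phi a - C * (b - a))) * (m - a) =
      (phi b - phi a) * (m - a) + (C * (m - a)) * (b - a) by ring.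
    rewrite CE E.
    have -> : (phi b - phi a) * (m - a) + (phi a - (t * phi a + (1 - t) * phi b)) * (b - a) =
      (phi b - phi a) * ((m - a) - (b - a) + t * (b - a)) by ring.
    by rewrite tE; apply/eqP; ring.
  exists C => //; apply: lipschitz_from_seq => // d' d'0.
  pose r := Num.max ((m + 1) / 2) (1 - d' / 2).
  have mr : m < r by rewrite /r lt_max; apply/orP; left; lra.
  have r1 : r < 1 by rewrite /r gt_max; apply/andP; split; lra.
  have dr : 1 - d' < r by rewrite /r lt_max; apply/orP; right; lra.
  exists r; split => //; first by lra.
  rewrite leNgt; apply/negP => hlt.
  pose e := (phi r - phi 1 - C * (1 - r)) / 2.
  have ep : 0 < e by rewrite /e; lra.
  have [d2 d20 Hd2] := within_contP cf h11 ep.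
  pose b := Num.max ((r + 1) / 2) (1 - d2 / 2).
  have rb : r < b by rewrite /b lt_max; apply/orP; left; lra.
  have b1 : b < 1 by rewrite /b gt_max; apply/andP; split; lra.
  have db : 1 - d2 / 2 <= b by rewrite /b le_max lexx orbT.
  have b01 : 0 <= b <= 1 by lra.
  have hb : `|1 - b| < d2 by rewrite gtr0_norm; lra.
  have := Hd2 b b01 hb; rewrite (line b (lt_trans mr rb) b1) ler_norml => /andP[q1 q2].
  have Er := line r mr r1.
  have hC : C * (b - a) <= C * (1 - a) by rewrite ler_wpM2l //; lra.
  have e1' : C * (1 - r) = C * (1 - a) - C * (r - a) by ring.
  move: q1 q2 hC e1'; rewrite /e; move: hlt; rewrite Er.
  move: (C * (b - a)) (C * (1 - a)) (C * (r - a)) (C * (1 - r)) (phi a) (phi 1) => *; lra.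
have zero d : 0 < d -> exists r, [/\ 0 <= r, 1 - d < r, r < 1 & w r = X r].
  move=> d0; pose d' := Num.min (d / 2) 2^-1.
  have d'0 : 0 < d' by rewrite /d' lt_min divr_gt0 // invr_gt0 ltr0n.
  have d'1 : d' < 1 by rewrite /d' gt_min; apply/orP; right; rewrite invf_lt1 ?ltr1n ?ltr0n.
  have dd' : d' <= d / 2 by rewrite /d' ge_min lexx.
  have [x [x1 x2 ux]] : exists x, [/\ 1 - d' <= x, x < 1 & u x = 0].
    apply: contrapT => nx; apply: nA; exists d'; split => // x /andP[x1 x2].
    have x01 : 0 <= x <= 1 by lra.
    rewrite lt_def u_ge0 // andbT; apply/negP => /eqP ux.
    by apply: nx; exists x.
  have x01 : 0 <= x <= 1 by lra.
  have x0 : 0 < x < 1 by lra.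
  have u1x := interior_min du u_ge0 x0 ux.
  have u11 : u1 1 = 0 by rewrite /u1 dual_slope1 subrr.
  have [r [xr r1 E]] := mvt01 (ltW (proj1 (andP x0))) x2 (lexx 1) du1.
  have r0 : 0 <= r by lra.
  exists r; split => //; first by lra.
  have x10 : 1 - x != 0 by rewrite subr_eq0 gt_eqF.
  have /eqP := E; rewrite u11 u1x subrr eq_sym mulf_eq0 (negPf x10) orbF => /eqP u2r.
  by apply/eqP; rewrite -subr_eq0 -e2w // -/(u2 r) u2r.
have w1 : w 1 = X 1.
  apply/eqP/negP => /negP ne.
  have ep : 0 < `|u2 1| / 2.
    by rewrite divr_gt0 // normr_gt0 /u2 e2w ?ler01 // subr_eq0.
  have /cvgrPdist_lt /(_ _ ep) [d /= d0 Hd] := @u2_cont 1.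
  have [r [r0 rd r1 wr]] := zero d d0.
  have hr : `|1 - r| < d by rewrite gtr0_norm; lra.
  have := Hd r hr; rewrite [u2 r]/u2 e2w // wr subrr subr0.
  have := normr_ge0 (u2 1); lra.
pose m := phi 0.
have m0 : c <= m by apply: cphi; rewrite lexx ler01.
(* The differences of [1 / phi^2] and of [phi] between 1 and [r] are related by the factor
   [(phi r + phi 1) / (phi r * phi 1)^2], which is at least [2 * c / m^4]. *)
pose C := L * (m ^+ 4 / (2 * c)).
have mp : 0 < m := lt_le_trans c0 m0.
have C0 : 0 <= C by rewrite mulr_ge0 // divr_ge0 ?exprn_ge0 ?mulr_ge0 ?(ltW c0) ?(ltW mp).
exists C => //; apply: lipschitz_from_seq => // d d0.
have [r [r0 rd r1 wr]] := zero d d0; exists r; split => //.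
have r01 : 0 <= r <= 1 by rewrite r0 ltW.
have hL := XL r 1 r0 (ltW r1) (lexx 1).
rewrite -w1 -wr /w /invsq !clamp_id // in hL.
have P0 := cphi r01; have Q0 := cphi h11; have PQ := fni r 1 r0 (ltW r1) (lexx 1).
have Pm : phi r <= m by apply: fni => //; exact: ltW.
move: P0 Q0 PQ Pm hL; move: (phi r) (phi 1) => P Q P0 Q0 PQ Pm hL.
have Pp : 0 < P := lt_le_trans c0 P0.
have Qp : 0 < Q := lt_le_trans c0 Q0.
have key : (P - Q) * (2 * c) <= (Q^-1 * Q^-1 - P^-1 * P^-1) * m ^+ 4.
  have -> : Q^-1 * Q^-1 - P^-1 * P^-1 = (P - Q) * (P + Q) * (P^-1 * Q^-1) ^+ 2.
    by field; rewrite !gt_eqF.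
  have Qm : Q <= m by lra.
  have h1 : 1 <= P^-1 * Q^-1 * m ^+ 2.
    rewrite expr2 mulrACA -[1]mulr1.
    by apply: ler_pM => //; rewrite mulrC ler_pdivlMr // mul1r.
  have e4 : (P^-1 * Q^-1) ^+ 2 * m ^+ 4 = (P^-1 * Q^-1 * m ^+ 2) ^+ 2.
    by rewrite [RHS]exprMn -exprM.
  have h2 : 1 <= (P^-1 * Q^-1) ^+ 2 * m ^+ 4 by rewrite e4; exact: exprn_ege1.
  have h3 : 2 * c <= P + Q by lra.
  have h4 : 2 * c <= (P + Q) * ((P^-1 * Q^-1) ^+ 2 * m ^+ 4).
    rewrite -[leLHS]mulr1; apply: ler_pM => //; by rewrite mulr_ge0 // ltW.
  have PQ0 : 0 <= P - Q by rewrite subr_ge0.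
  rewrite (_ : (P - Q) * (P + Q) * (P^-1 * Q^-1) ^+ 2 * m ^+ 4 =
    (P - Q) * ((P + Q) * ((P^-1 * Q^-1) ^+ 2 * m ^+ 4))); last by rewrite !mulrA.
  exact: ler_wpM2l.
have c20 : 0 < 2 * c by rewrite mulr_gt0.
have -> : C * (1 - r) = L * (1 - r) * m ^+ 4 / (2 * c) by rewrite /C; ring.
rewrite ler_pdivlMr //; apply: le_trans key _.
by rewrite ler_wpM2r // exprn_ge0 // ltW.
Qed.

End Dual.

(** * Upper bounds for the pairing of [eta''] with hinges and with 1 *)

Section WeakDuality.
Context {R : realType}.
Local Notation leb := (@lebesgue_measure R).
Implicit Types (f F T : R -> R) (a b d e s x y t k M : R).

(* An increasing sequence of continuous functions with limit F on (0, 1),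
   supported in [1/(n+1), 1 - 1/(n+1)] and bounded there by F - 2/(n+1). *)
Definition exhaust F n x : R :=
  Num.max 0 (Num.min (F x - 2 * n.+1%:R^-1)
    (Num.min (n.+1%:R * x - 1) (n.+1%:R * (1 - x) - 1))).

Lemma exhaust_cont F n : continuous F -> continuous (exhaust F n).
Proof.
move=> cF x.
apply: (@continuous_max R R (cst 0) (fun x => Num.min (F x - 2 * n.+1%:R^-1)
    (Num.min (n.+1%:R * x - 1) (n.+1%:R * (1 - x) - 1))) x); first exact: cvg_cst.
apply: (@continuous_min R R (fun x => F x - 2 * n.+1%:R^-1)
    (fun x => Num.min (n.+1%:R * x - 1) (n.+1%:R * (1 - x) - 1)) x).
  by apply: cvgB; [exact: cF|exact: cvg_cst].
apply: (@continuous_min R R (fun x => n.+1%:R * x - 1) (fun x => n.+1%:R * (1 - x) - 1) x).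
  apply: cvgB; last exact: cvg_cst.
  by apply: cvgM; [exact: cvg_cst|exact: cvg_id].
apply: cvgB; last exact: cvg_cst.
apply: cvgM; first exact: cvg_cst.
by apply: cvgB; [exact: cvg_cst|exact: cvg_id].
Qed.

Lemma exhaust_ge0 F n x : 0 <= exhaust F n x.
Proof. by rewrite /exhaust le_max lexx. Qed.

Lemma exhaust_nd F x : 0 <= x <= 1 -> {homo (fun n => exhaust F n x) : n m / (n <= m)%N >-> n <= m}.
Proof.
move=> /andP[x0 x1] n m nm; rewrite /exhaust.
have h1 : (n.+1%:R : R) <= m.+1%:R by rewrite ler_nat.
have h2 : (m.+1%:R : R)^-1 <= n.+1%:R^-1 by rewrite lef_pV2 // posrE ltr0n.
have h3 : n.+1%:R * x <= m.+1%:R * x by rewrite ler_wpM2r.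
have h4 : n.+1%:R * (1 - x) <= m.+1%:R * (1 - x) by rewrite ler_wpM2r // subr_ge0.
rewrite ge_max le_max lexx /= le_max; apply/orP; right.
have h2' : F x - 2 * n.+1%:R^-1 <= F x - 2 * m.+1%:R^-1 by rewrite lerD2l lerN2 ler_pM2l.
have h3' : n.+1%:R * x - 1 <= m.+1%:R * x - 1 by rewrite lerD2r.
have h4' : n.+1%:R * (1 - x) - 1 <= m.+1%:R * (1 - x) - 1 by rewrite lerD2r.
rewrite le_min; apply/andP; split; first by rewrite ge_min h2'.
rewrite le_min; apply/andP; split.
  by rewrite ge_min; apply/orP; right; rewrite ge_min h3'.
by rewrite ge_min; apply/orP; right; rewrite ge_min h4' orbT.
Qed.

Lemma exhaust_cvg F x : 0 < x < 1 -> 0 <= F x -> (fun n => exhaust F n x) @ \oo --> F x.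
Proof.
move=> /andP[x0 x1] F0; apply/cvgrPdist_le => e e0.
pose r := Num.min (e / 2) (Num.min (x / (F x + 2)) ((1 - x) / (F x + 2))).
have F2 : 0 < F x + 2 by lra.
have r0 : 0 < r.
  by rewrite /r !lt_min divr_gt0 //= !divr_gt0 // subr_gt0.
have [n0 Hn0] : exists n0 : nat, forall n, (n0 <= n)%N -> (n.+1%:R : R)^-1 <= r.
  exists (Num.Def.archi_bound r^-1) => n hn.
  rewrite -[r]invrK lef_pV2 ?posrE ?invr_gt0 ?ltr0n //.
  apply: ltW; apply: lt_le_trans (_ : (Num.Def.archi_bound r^-1)%:R <= _).
    by apply: Num.Theory.archi_boundP; rewrite invr_ge0 ltW.
  by rewrite ler_nat (leq_trans hn).
exists n0 => // n /= hn; have := Hn0 n hn; set v := n.+1%:R^-1.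
have v0 : 0 < v by rewrite invr_gt0 ltr0n.
have vE : n.+1%:R = v^-1 :> R by rewrite invrK.
rewrite /r !le_min => /andP[h1 /andP[h2 h3]].
have k1 : F x + 2 <= n.+1%:R * x.
  by rewrite vE mulrC ler_pdivlMr // mulrC -ler_pdivlMr.
have k2 : F x + 2 <= n.+1%:R * (1 - x).
  by rewrite vE mulrC ler_pdivlMr // mulrC -ler_pdivlMr.
have -> : exhaust F n x = Num.max 0 (F x - 2 * v).
  rewrite /exhaust -/v; congr Num.max; apply: min_l.
  by rewrite le_min; apply/andP; split; lra.
have [q|q] := leP 0 (F x - 2 * v); rewrite ger0_norm; lra.
Qed.

Lemma exhaust_le F n x (T : R) : 0 <= T ->
  (n.+1%:R^-1 <= x <= 1 - n.+1%:R^-1 -> F x - 2 * n.+1%:R^-1 <= T) -> exhaust F n x <= T.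
Proof.
move=> T0 H; rewrite /exhaust ge_max T0 /=.
have n0 : (0 : R) < n.+1%:R by rewrite ltr0n.
have [xK|xK] := boolP (n.+1%:R^-1 <= x <= 1 - n.+1%:R^-1).
  by rewrite ge_min H.
rewrite ge_min; apply/orP; right; apply: le_trans T0.
move: xK; rewrite negb_and -!ltNge => /orP[h1|h1].
  rewrite ge_min; apply/orP; left; rewrite subr_le0 ltW //.
  by rewrite -ltr_pdivlMl // mulr1.
rewrite ge_min; apply/orP; right; rewrite subr_le0 ltW //.
by rewrite -ltr_pdivlMl // mulr1 ltrBlDr -ltrBlDl.
Qed.

Variables (g : R -> R) (nus : {measure set R -> \bar R}).
Hypothesis mg : measurable_fun (`]0, 1[ : set R) g.
Hypothesis g0 : forall x, 0 < x < 1 -> 0 <= g x.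

Definition pairing f : \bar R :=
  (\int[leb]_(x in `]0%R, 1%R[) (g x * f x)%:E + \int[nus]_(x in `]0%R, 1%R[) (f x)%:E)%E.

Lemma mgf f : measurable_fun setT f ->
  measurable_fun (`]0, 1[ : set R) (fun x => (g x * f x)%:E).
Proof.
move=> mf; apply/measurable_EFinP; apply: measurable_funM => //.
exact: measurable_funTS.
Qed.

Lemma mf01 f : measurable_fun setT f -> measurable_fun (`]0, 1[ : set R) (EFin \o f).
Proof. by move=> mf; apply/measurable_EFinP; exact: measurable_funTS. Qed.

Lemma pairing_le f1 f2 : measurable_fun setT f1 -> measurable_fun setT f2 ->
  (forall x, 0 < x < 1 -> 0 <= f1 x) -> (forall x, 0 < x < 1 -> f1 x <= f2 x) ->
  (pairing f1 <= pairing f2)%E.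
Proof.
move=> m1 m2 f10 f12.
have I01 x : `]0, 1[%classic x -> 0 < x < 1 by rewrite /= in_itv.
have q1 x : `]0, 1[%classic x -> (0 <= (g x * f1 x)%:E)%E.
  by move=> /I01 x01; rewrite lee_fin mulr_ge0 ?g0 ?f10.
have q2 x : `]0, 1[%classic x -> ((g x * f1 x)%:E <= (g x * f2 x)%:E)%E.
  by move=> /I01 x01; rewrite lee_fin ler_wpM2l ?g0 ?f12.
have q3 x : `]0, 1[%classic x -> (0 <= (f1 x)%:E)%E.
  by move=> /I01 x01; rewrite lee_fin f10.
have q4 x : `]0, 1[%classic x -> ((f1 x)%:E <= (f2 x)%:E)%E.
  by move=> /I01 x01; rewrite lee_fin f12.
apply: leeD.
  by apply: ge0_le_integral; [exact: measurable_itv|exact: q1|exact: mgf|exact: mgf|exact: q2].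
by apply: ge0_le_integral; [exact: measurable_itv|exact: q3|exact: mf01|exact: mf01|exact: q4].
Qed.

Lemma pairingZ f k : measurable_fun setT f -> (forall x, 0 < x < 1 -> 0 <= f x) -> 0 <= k ->
  pairing (fun x => k * f x) = (k%:E * pairing f)%E.
Proof.
move=> mf f0 k0; rewrite /pairing ge0_muleDr; last 2 first.
  by apply: integral_ge0 => x; rewrite /= in_itv /= => x01; rewrite lee_fin mulr_ge0 ?g0 ?f0.
  by apply: integral_ge0 => x; rewrite /= in_itv /= => x01; rewrite lee_fin f0.
have I01 x : `]0, 1[%classic x -> 0 < x < 1 by rewrite /= in_itv.
congr (_ + _)%E.
  rewrite -ge0_integralZl_EFin //; try exact: mgf;
    try (by move=> x /I01 x01; rewrite lee_fin mulr_ge0 ?g0 ?f0).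
  by apply: eq_integral => x _; rewrite -EFinM mulrCA.
rewrite -ge0_integralZl_EFin //; try exact: mf01;
  try (by move=> x /I01 x01; rewrite lee_fin f0).
Qed.

(** Monotone convergence in both parts of [eta'']: bounds on the exhausting functions, which have
    compact support, pass to [F]. *)
Lemma pairing_exhaust F b : continuous F -> (forall x, 0 < x < 1 -> 0 <= F x) ->
  (forall e, 0 < e -> \forall n \near \oo, (pairing (exhaust F n) <= (b + e)%:E)%E) ->
  (pairing F <= b%:E)%E.
Proof.
move=> cF F0 H.
have me n : measurable_fun setT (exhaust F n).
  by apply: continuous_measurable_fun; exact: exhaust_cont.
have o01 x : `]0, 1[%classic x -> 0 <= x <= 1 :> Prop.
  by rewrite /= in_itv /= => /andP[x0 x1]; apply/andP; split; exact: ltW.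
have c1 := @cvg_monotone_convergence _ _ _ leb `]0, 1[%classic (measurable_itv _)
  (fun n x => (g x * exhaust F n x)%:E) (fun n => mgf (me n)).
have c2 := @cvg_monotone_convergence _ _ _ nus `]0, 1[%classic (measurable_itv _)
  (fun n x => (exhaust F n x)%:E) (fun n => mf01 (me n)).
have {}c1 : (\int[leb]_(x in `]0%R, 1%R[) (g x * exhaust F n x)%:E)%E @[n --> \oo] -->
    (\int[leb]_(x in `]0%R, 1%R[) (g x * F x)%:E)%E.
  have -> : (\int[leb]_(x in `]0%R, 1%R[) (g x * F x)%:E =
      \int[leb]_(x in `]0%R, 1%R[) limn (fun n => (g x * exhaust F n x)%:E))%E.
    apply: eq_integral => x; rewrite inE /= in_itv /= => x01; apply/esym/cvg_lim => //.
    apply/cvg_EFin; first by apply: nearW.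
    by apply: cvgM; [exact: cvg_cst|apply: exhaust_cvg => //; exact: F0].
  apply: c1.
  - by move=> n x; rewrite /= in_itv /= => x01; rewrite lee_fin mulr_ge0 ?g0 ?exhaust_ge0.
  - move=> x xI n m nm; rewrite lee_fin ler_wpM2l //; last exact: exhaust_nd (o01 x xI) _ _ nm.
    by apply: g0; move: xI; rewrite /= in_itv.
have {}c2 : (\int[nus]_(x in `]0%R, 1%R[) (exhaust F n x)%:E)%E @[n --> \oo] -->
    (\int[nus]_(x in `]0%R, 1%R[) (F x)%:E)%E.
  have -> : (\int[nus]_(x in `]0%R, 1%R[) (F x)%:E =
      \int[nus]_(x in `]0%R, 1%R[) limn (fun n => (exhaust F n x)%:E))%E.
    apply: eq_integral => x; rewrite inE /= in_itv /= => x01; apply/esym/cvg_lim => //.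
    apply/cvg_EFin; first by apply: nearW.
    by apply: exhaust_cvg => //; exact: F0.
  apply: c2.
  - by move=> n x _; rewrite lee_fin exhaust_ge0.
  - by move=> x xI n m nm; rewrite lee_fin; exact: exhaust_nd (o01 x xI) _ _ nm.
apply/lee_addgt0Pr => e e0; rewrite -EFinD.
have c3 : pairing (exhaust F n) @[n --> \oo] --> pairing F.
  apply: cvgeD => //; apply: ge0_adde_def; rewrite inE; apply: integral_ge0 => x;
    rewrite /= in_itv /= => x01; rewrite lee_fin ?mulr_ge0 ?g0 ?F0 //.
rewrite -(cvg_lim _ c3) //; apply: lime_le; first by apply/cvg_ex; exists (pairing F).
exact: H.
Qed.

Variables (eta : R -> R) (k : R).
Hypothesis ceta : {within `[0, 1], continuous eta}.
Hypothesis keta : forall a b, 0 < a -> a < b -> b < 1 -> k * (b - a) <= eta b - eta a.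
Hypothesis ident : forall psi, test_fun psi ->
  (\int[leb]_(x in `]0%R, 1%R[) (eta x * derive1 (derive1 psi) x)%:E = pairing psi)%E.

(** A smoothed trapezoid with corners [v / 2], [v], [s], [1 - v] lies above the exhausting function
    of [hinge s], and its pairing is given, up to a small error, by the values of [eta] at the
    corners. Near 0 the increment of [eta] is bounded below by [keta]. *)
Lemma pairing_hinge s : 0 < s < 1 -> (pairing (hinge s) <= (eta 1 - eta s - k * (1 - s))%:E)%E.
Proof.
move=> /andP[s0 s1]; apply: pairing_exhaust; first exact: hinge_cont.
  by move=> x /andP[x0 x1]; rewrite /hinge subr_ge0 ge_max !ltW.
move=> e e0.
have h11 : 0 <= (1 : R) <= 1 by rewrite ler01 lexx.
have e40 : 0 < e / 4 by lra.
have [d d0 Hd] := within_contP ceta h11 e40.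
(* [d / 2] makes [eta (1 - v)] close to [eta 1], [s / 2] and [(1 - s) / 2] order the corners, and
   the last entry makes [k * v] at most [e / 4]. *)
pose r := Num.min (Num.min (d / 2) (s / 2)) (Num.min ((1 - s) / 2) (e / 4 / (`|k| + 1))).
have k1 : 0 < `|k| + 1 by rewrite ltr_wpDl.
have r0 : 0 < r.
  by rewrite /r !lt_min !divr_gt0 // subr_gt0.
exists (Num.Def.archi_bound r^-1) => // n /= hn.
set v := n.+1%:R^-1 : R.
have v0 : 0 < v by rewrite invr_gt0 ltr0n.
have vr : v <= r.
  rewrite -[r]invrK lef_pV2 ?posrE ?invr_gt0 ?ltr0n //.
  apply: ltW; apply: lt_le_trans (_ : (Num.Def.archi_bound r^-1)%:R <= _).
    by apply: Num.Theory.archi_boundP; rewrite invr_ge0 ltW.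
  by rewrite ler_nat (leq_trans hn).
move: (vr); rewrite /r !le_min => /andP[/andP[vd vs] /andP[vs1 ve]].
(* On [[v, 1 - v]] the trapezoid is [hinge s - v], so an error of at most [v] keeps its smoothing
   above [hinge s - 2 * v]; this is the slack built into [exhaust]. *)
pose dd := Num.min v (e / 4).
have dd0 : 0 < dd by rewrite /dd lt_min v0.
have ddv : dd <= v by rewrite /dd ge_min lexx.
have dde : dd <= e / 4 by rewrite /dd ge_min lexx orbT.
have a0 : 0 < v / 2 by lra.
have ab : v / 2 < v by lra.
have bs : v < s by lra.
have sc : s < 1 - v by lra.
have c1 : 1 - v < 1 by lra.
have [T [tT T0 Tt [cT cT2] TI]] := tent_test (clamp_cont ceta) a0 ab bs sc c1 dd0.
have IT : pairing T = (RI 0 1 (fun x => clamp eta x * derive1 (derive1 T) x))%:E.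
  rewrite -ident // -int_oo; last first.
    by apply: cont_intble => x; apply: cvgM; [exact: (clamp_cont ceta)|exact: cT2].
  apply: eq_integral => x; rewrite inE /= in_itv /= => /andP[x0 x1].
  by rewrite clamp_id // !ltW.
apply: (@le_trans _ _ (pairing T)).
  apply: pairing_le.
  - apply: continuous_measurable_fun; apply: exhaust_cont; exact: hinge_cont.
  - exact: continuous_measurable_fun.
  - by move=> x _; exact: exhaust_ge0.
  - move=> x _; apply: exhaust_le => // /andP[vx xv]; rewrite -/v in vx xv *.
    have := Tt x; rewrite /tent ler_norml => /andP[+ _].
    rewrite (max_r (_ : 0 <= x - v / 2)); last by lra.
    rewrite (max_r (_ : 0 <= x - v)); last by lra.
    rewrite (max_l (_ : x - (1 - v) <= 0)); last by lra.
    have -> : (1 - v - s) / (v - v / 2) * (x - v / 2 - (x - v)) = 1 - v - s.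
      have -> : x - v / 2 - (x - v) = v - v / 2 by ring.
      by rewrite mulfVK //; rewrite subr_eq0 gt_eqF.
    rewrite /hinge; have [q|q] := leP x s.
      by rewrite max_l; lra.
    by rewrite max_r; lra.
rewrite IT lee_fin.
have v01 : 0 <= v <= 1 by lra.
have v201 : 0 <= v / 2 <= 1 by lra.
have s01 : 0 <= s <= 1 by lra.
have c01 : 0 <= 1 - v <= 1 by lra.
rewrite !clamp_id // in TI.
have hv : `|1 - (1 - v)| < d by rewrite opprB addrC subrK gtr0_norm //; lra.
have := Hd _ c01 hv; rewrite ler_norml => /andP[q1 _].
have v1 : v < 1 by lra.
have q2 := keta a0 ab v1.
have q3 : k * (1 - v - s) <= (1 - v - s) / (v - v / 2) * (eta v - eta (v / 2)).
  have p1 : 0 < v - v / 2 by lra.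
  have p2 : 0 < (1 - v - s) / (v - v / 2) by rewrite divr_gt0 //; lra.
  rewrite -(ler_pM2l p2) in q2; apply: le_trans q2.
  by rewrite mulrCA mulfVK // gt_eqF.
have q4 : k * v <= e / 4.
  apply: le_trans (ler_norm _) _; rewrite normrM (gtr0_norm v0).
  have p1 : v * (`|k| + 1) <= e / 4 by rewrite -ler_pdivlMr.
  by apply: le_trans p1; rewrite mulrC ler_pM2l // lerDl.
have q5 : k * (1 - v - s) = k * (1 - s) - k * v by ring.
move: TI; rewrite ler_norml => /andP[_].
move: q3 q4 q5 q1; move: (RI _ _ _) (_ * (eta v - _)) (k * (1 - v - s)) (k * (1 - s)) (k * v).
move: (eta (1 - v)) (eta 1) (eta s) => E1 E2 E3 r1 r2 r3 r4 r5 *; lra.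
Qed.

(** [v^-1 * hinge (1 - v)] equals 1 up to [1 - v], so it dominates the exhausting function of 1, and
    its pairing is bounded through a difference quotient of [eta] at 1. *)
Lemma pairing_one M : (forall d, 0 < d < 1 -> eta 1 - eta (1 - d) <= M * d) ->
  (pairing (fun=> 1%R) <= (M - k)%:E)%E.
Proof.
move=> HM; have c1 : continuous (fun _ : R => (1 : R)) by move=> x; exact: cvg_cst.
apply: pairing_exhaust => // e e0; exists 1%N => // n /= n1.
set v := n.+1%:R^-1 : R.
have v0 : 0 < v by rewrite invr_gt0 ltr0n.
have v1 : v < 1 by rewrite invf_lt1 ?ltr0n // ltr1n.
have s01 : 0 < 1 - v < 1 by lra.
have mh : measurable_fun setT (@hinge R (1 - v)).
  by apply: continuous_measurable_fun; exact: hinge_cont.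
have h0 x : 0 < x < 1 -> 0 <= hinge (1 - v) x.
  by move=> /andP[x0 x1]; rewrite /hinge subr_ge0 ge_max ltW //=; lra.
have vi : 0 <= v^-1 by rewrite invr_ge0 ltW.
apply: (@le_trans _ _ (pairing (fun x => v^-1 * hinge (1 - v) x))).
  apply: pairing_le.
  - by apply: continuous_measurable_fun; exact: exhaust_cont.
  - by apply: measurable_funM => //; exact: measurable_cst.
  - by move=> x _; exact: exhaust_ge0.
  - move=> x x01; apply: exhaust_le; first by rewrite mulr_ge0 ?h0.
    rewrite -/v => /andP[vx xv]; rewrite /hinge max_r //.
    have -> : 1 - (1 - v) = v by ring.
    by rewrite mulVf ?gt_eqF //; lra.
rewrite pairingZ //; apply: le_trans (_ : (v^-1%:E * (eta 1 - eta (1 - v) - k * (1 - (1 - v)))%:E <= _)%E).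
  by rewrite lee_pmul2l ?lte_fin ?invr_gt0 // pairing_hinge.
rewrite -EFinM lee_fin.
have v01 : 0 < v < 1 by rewrite v0.
have := HM v v01; have -> : 1 - (1 - v) = v by ring.
move=> q; rewrite ler_pdivrMl //.
have -> : v * (M - k + e) = M * v - k * v + e * v by ring.
have : 0 <= e * v by rewrite mulr_ge0 // ltW.
lra.
Qed.

End WeakDuality.

(** * Convex functions, test functions and distributions on (0, 1) *)

Section Generic.
Context {R : realType}.
Local Notation leb := (@lebesgue_measure R).
Implicit Types (f F T psi : R -> R) (a b d e l s x y z t k M : R).

Lemma deriv01_is_derive f x l : is_derive x 1 f l -> deriv01 f x l.
Proof.
move=> /is_derive1_caratheodory [q [qE cq qx]]; rewrite /deriv01.
apply: cvg_trans (_ : q @ within [set y | 0 <= y <= 1 /\ y != x] (nbhs x) --> l).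
  apply: near_eq_cvg; near=> y.
  have [_ yx] : 0 <= y <= 1 /\ y != x by near: y; exact: withinT.
  by rewrite qE mulfK // subr_eq0.
by rewrite -qx; apply: cvg_within_filter; exact: cq.
Unshelve. all: by end_near. Qed.

Lemma deriv01_at0 f k e : deriv01 f 0 k -> 0 < e ->
  exists2 d, 0 < d & forall y, 0 < y -> y < d -> y <= 1 -> `|f y - f 0 - k * y| <= e * y.
Proof.
move=> df e0; have /cvgrPdist_le /(_ e e0) [d /= d0 Hd] := df.
exists d => // y y0 yd y1.
have y01 : 0 <= y <= 1 by rewrite ltW.
have := Hd y; rewrite /= sub0r normrN gtr0_norm // subr0.
move=> /(_ yd (conj y01 (lt0r_neq0 y0))) h.
have -> : f y - f 0 - k * y = - ((k - (f y - f 0) / y) * y).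
  by rewrite mulrBl mulfVK ?gt_eqF //; ring.
by rewrite normrN normrM (gtr0_norm y0) ler_pM2r.
Qed.

Lemma deriv01_eq f F x l : (forall y, 0 <= y <= 1 -> f y = F y) -> 0 <= x <= 1 ->
  deriv01 f x l -> deriv01 F x l.
Proof.
move=> fF x01 df; rewrite /deriv01; apply/cvgrPdist_le => e e0.
have /cvgrPdist_le /(_ e e0) [d /= d0 Hd] := df.
exists d => //= y yd [y01 yx]; rewrite -!fF //.
exact: Hd y yd (conj y01 yx).
Qed.

Lemma deriv01B f F x l k : deriv01 f x l -> deriv01 F x k ->
  deriv01 (fun y => f y - F y) x (l - k).
Proof.
move=> df dF; rewrite /deriv01; apply/cvgrPdist_le => e e0.
have e2 : 0 < e / 2 by rewrite divr_gt0.
have /cvgrPdist_le /(_ _ e2) [d /= d0 Hd] := df.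
have /cvgrPdist_le /(_ _ e2) [d' /= d0' Hd'] := dF.
exists (Num.min d d') => /= [|y]; first by rewrite lt_min d0.
rewrite /= lt_min => /andP[yd yd'] [y01 yx].
have h1 := Hd y yd (conj y01 yx); have h2 := Hd' y yd' (conj y01 yx).
have -> : l - k - (f y - F y - (f x - F x)) / (y - x) =
  (l - (f y - f x) / (y - x)) - (k - (F y - F x) / (y - x)) by ring.
by apply: le_trans (ler_normB _ _) _; rewrite [e](splitr e) lerD.
Qed.

Definition convex01 f := forall x y t, 0 <= x <= 1 -> 0 <= y <= 1 -> 0 <= t <= 1 ->
  f (t * x + (1 - t) * y) <= t * f x + (1 - t) * f y.

Lemma convex_slope f x y z : convex01 f -> 0 <= x -> x < y -> y < z -> z <= 1 ->
  (f y - f x) * (z - y) <= (f z - f y) * (y - x).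
Proof.
move=> cf x0 xy yz z1; pose t := (z - y) / (z - x).
have zx : 0 < z - x by lra.
have tE : t * (z - x) = z - y by rewrite /t mulfVK ?gt_eqF.
have t01 : 0 <= t <= 1.
  by rewrite /t ler_pdivrMr // divr_ge0 //=; lra.
have hx : 0 <= x <= 1 by lra.
have hz : 0 <= z <= 1 by lra.
have := cf x z t hx hz t01.
have -> : t * x + (1 - t) * z = y by move: tE; rewrite mulrBr; lra.
move=> h.
have h2 : f y * (z - x) <= (t * f x + (1 - t) * f z) * (z - x) by rewrite ler_pM2r.
have e1 : (t * f x + (1 - t) * f z) * (z - x) = (z - y) * f x + (y - x) * f z.
  transitivity ((t * (z - x)) * f x + ((z - x) - t * (z - x)) * f z); first by ring.
  by rewrite tE; ring.
rewrite e1 in h2; lra.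
Qed.

(** Chord slopes increase to the right. With [e] half the supposed defect in slope, chords from 0 to
    points near 0 have slope at least [k - e], and this lower bound carries over to [[a, b]]. *)
Lemma convex_slope0 f k a b : convex01 f -> deriv01 f 0 k -> 0 < a -> a < b -> b < 1 ->
  k * (b - a) <= f b - f a.
Proof.
move=> cf df a0 ab b1; rewrite leNgt; apply/negP => hlt.
have ba : 0 < b - a by rewrite subr_gt0.
pose e := (k * (b - a) - (f b - f a)) / (2 * (b - a)).
have e0 : 0 < e by rewrite /e divr_gt0 ?mulr_gt0 ?subr_gt0.
have eE : 2 * (e * (b - a)) = k * (b - a) - (f b - f a).
  have ban : b - a != 0 by rewrite gt_eqF.
  by rewrite /e; field.
have [d d0 Hd] := deriv01_at0 df e0.
pose y := Num.min (d / 2) (a / 2).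
have y0 : 0 < y by rewrite /y lt_min !divr_gt0.
have yd : y < d by rewrite /y gt_min; apply/orP; left; lra.
have ya : y < a by rewrite /y gt_min; apply/orP; right; lra.
have y1 : y <= 1 by lra.
have := Hd y y0 yd y1; rewrite ler_norml => /andP[h1 _].
have s1 := convex_slope cf (lexx 0) y0 ya (ltW (lt_trans ab b1)).
have s2 := convex_slope cf (ltW y0) ya ab (ltW b1).
have p1 : (k - e) * y * (a - y) <= (f y - f 0) * (a - y).
  by rewrite ler_pM2r ?subr_gt0 //; lra.
have p2 : (k - e) * (a - y) <= f a - f y.
  rewrite -(ler_pM2r y0); apply: le_trans (_ : (k - e) * y * (a - y) <= _).
    by rewrite mulrAC.
  by apply: le_trans p1 _; rewrite subr0 in s1.
have p3 : (k - e) * (a - y) * (b - a) <= (f a - f y) * (b - a) by rewrite ler_pM2r.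
have p4 : (k - e) * (b - a) <= f b - f a.
  rewrite -(@ler_pM2r _ (a - y)) ?subr_gt0 //.
  by apply: le_trans s2; rewrite mulrAC.
have := mulr_gt0 e0 ba.
by rewrite mulrBl in p4; lra.
Qed.

Lemma test_funP psi : test_fun psi -> exists p1 p2 : R -> R,
  [/\ forall x, is_derive x 1 psi (p1 x), forall x, is_derive x 1 p1 (p2 x), continuous p2,
      derive1 psi = p1 /\ derive1 (derive1 psi) = p2 &
      [/\ psi 0 = 0, psi 1 = 0, p1 0 = 0 & p1 1 = 0]].
Proof.
move=> [sm [a [b [a0 [ab [b1 supp]]]]]].
have d0 x : is_derive x 1 psi (derive1 psi x).
  by apply: DeriveDef; [exact: (sm 0%N)|rewrite derive1E].
have d1 x : is_derive x 1 (derive1 psi) (derive1 (derive1 psi) x).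
  by apply: DeriveDef; [exact: (sm 1%N)|rewrite derive1E].
have c2 : continuous (derive1 (derive1 psi)) by apply: derivable_cont; exact: (sm 2%N).
have Z x : ~ (a <= x <= b) -> psi x = 0 by exact: supp.
have p00 : psi 0 = 0 by apply: Z => /andP[]; lra.
have p10 : psi 1 = 0 by apply: Z => /andP[]; lra.
have q0 : derive1 psi 0 = 0.
  apply: is_derive_derive1; apply: (near_eq_is_derive _ (idcst 0 0)); near=> y.
  rewrite Z // => /andP[ay _]; suff : y < a by lra.
  by near: y; apply: lt_nbhsl.
have q1 : derive1 psi 1 = 0.
  apply: is_derive_derive1; apply: (near_eq_is_derive _ (idcst 0 1)); near=> y.
  rewrite Z // => /andP[_ yb]; suff : b < y by lra.
  by near: y; apply: lt_nbhsr.
by exists (derive1 psi), (derive1 (derive1 psi)).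
Unshelve. all: by end_near. Qed.

Lemma integral_oo_cont f F : continuous F -> (forall x, 0 < x < 1 -> f x = F x) ->
  (\int[leb]_(x in `]0%R, 1%R[) (f x)%:E = (RI 0 1 F)%:E)%E.
Proof.
move=> cF fF; rewrite -int_oo; last exact: cont_intble.
by apply: eq_integral => x; rewrite inE /= in_itv /= => x01; rewrite fF.
Qed.

Lemma test_by_parts psi f f1 f2 : test_fun psi ->
  (forall x, is_derive x 1 f (f1 x)) -> (forall x, is_derive x 1 f1 (f2 x)) -> continuous f2 ->
  RI 0 1 (fun x => f x * derive1 (derive1 psi) x) = RI 0 1 (fun x => f2 x * psi x).
Proof.
move=> /test_funP [p1 [p2 [dp dp1 cp2 [E1 E2] [z1 z2 z3 z4]]]] df df1 cf2.
have cf : continuous f by move=> x; exact: is_derive_cont (df x).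
have cp : continuous psi by move=> x; exact: is_derive_cont (dp x).
have c1 : continuous (fun x => f x * p2 x) by move=> x; apply: cvgM; [exact: cf|exact: cp2].
have c2 : continuous (fun x => f2 x * psi x) by move=> x; apply: cvgM; [exact: cf2|exact: cp].
rewrite E2; apply/eqP; rewrite -subr_eq0 -RIB; [|exact: cont_intble|exact: cont_intble].
have dG x : 0 <= x <= 1 -> is_derive x 1 (fun x => f x * p1 x - f1 x * psi x)
    (f x * p2 x - f2 x * psi x).
  by move=> _; apply: is_derive_eq (idB (idM (df x) (dp1 x)) (idM (df1 x) (dp x))) _; ring.
have cc : {within `[0, 1], continuous (fun x => f x * p2 x - f2 x * psi x)}.
  by apply: cont_within => x; apply: cvgB; [exact: c1|exact: c2].
by rewrite (RI_ftc' ler01 cc dG) z1 z2 z3 z4 !mulr0 !subrr.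
Qed.

Lemma convex_of_second f f1 f2 : (forall x, 0 <= x <= 1 -> is_derive x 1 f (f1 x)) ->
  (forall x, 0 <= x <= 1 -> is_derive x 1 f1 (f2 x)) -> (forall x, 0 <= x <= 1 -> 0 <= f2 x) ->
  convex01 f.
Proof.
move=> df df1 f20.
have f1nd x y : 0 <= x -> x < y -> y <= 1 -> f1 x <= f1 y.
  move=> x0 xy y1; have [c [xc cy E]] := mvt01 x0 xy y1 df1.
  rewrite -subr_ge0 E mulr_ge0 //; last by rewrite subr_ge0 ltW.
  by apply: f20; rewrite (le_trans x0 (ltW xc)) (le_trans (ltW cy) y1).
have main x y t : 0 <= x -> x < y -> y <= 1 -> 0 < t -> t < 1 ->
    f (t * x + (1 - t) * y) <= t * f x + (1 - t) * f y.
  move=> x0 xy y1 t0 t1; set m := t * x + (1 - t) * y.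
  have E1 : m - x = (1 - t) * (y - x) by rewrite /m; ring.
  have E2 : y - m = t * (y - x) by rewrite /m; ring.
  have yx : 0 < y - x by rewrite subr_gt0.
  have t1' : 0 < 1 - t by rewrite subr_gt0.
  have xm : x < m by rewrite -subr_gt0 E1 mulr_gt0.
  have my : m < y by rewrite -subr_gt0 E2 mulr_gt0.
  have m0 : 0 <= m by rewrite (le_trans x0 (ltW xm)).
  have m1 : m <= 1 by rewrite (le_trans (ltW my) y1).
  have [c [xc cm Ec]] := mvt01 x0 xm m1 df.
  have [c' [mc cy Ec']] := mvt01 m0 my y1 df.
  have h := f1nd c c' (le_trans x0 (ltW xc)) (lt_trans cm mc) (le_trans (ltW cy) y1).
  have tt : 0 <= t * (1 - t) * (y - x) by rewrite ltW // !mulr_gt0.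
  have h2 : 0 <= t * (1 - t) * (y - x) * (f1 c' - f1 c) by rewrite mulr_ge0 // subr_ge0.
  rewrite -subr_ge0.
  have -> : t * f x + (1 - t) * f y - f m = (1 - t) * (f y - f m) - t * (f m - f x) by ring.
  rewrite Ec Ec' E1 E2.
  suff -> : (1 - t) * (f1 c' * (t * (y - x))) - t * (f1 c * ((1 - t) * (y - x))) =
    t * (1 - t) * (y - x) * (f1 c' - f1 c) by [].
  by ring.
move=> x y t /andP[x0 x1] /andP[y0 y1] /andP[t0 t1].
have [->|tn0] := eqVneq t 0; first by rewrite !mul0r !add0r subr0 !mul1r.
have [->|tn1] := eqVneq t 1; first by rewrite subrr !mul0r !addr0 !mul1r.
have t0' : 0 < t by rewrite lt_def tn0.
have t1' : t < 1 by rewrite lt_def eq_sym tn1.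
have [xy|yx|->] := ltgtP x y; first exact: main.
  have -> : t * x + (1 - t) * y = (1 - t) * y + (1 - (1 - t)) * x by ring.
  have -> : t * f x + (1 - t) * f y = (1 - t) * f y + (1 - (1 - t)) * f x by ring.
  by apply: main => //; lra.
have -> : t * y + (1 - t) * y = y by ring.
by have -> : t * f y + (1 - t) * f y = f y by ring.
Qed.

(* If W'' = 0 in the sense of distributions then W is affine by testing against
   tents; the conditions at 0 and 1 then force W = 0. *)
Lemma distr_affine_eq0 (W : R -> R) : continuous W -> deriv01 W 0 0 -> W 1 = 0 ->
  (forall T, test_fun T -> RI 0 1 (fun x => W x * derive1 (derive1 T) x) = 0) ->
  forall x, 0 <= x <= 1 -> W x = 0.
Proof.
move=> cW dW W1 HW.
have tent a b s c : 0 < a -> a < b -> b < s -> s < c -> c < 1 ->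
    W c - W s = (c - s) / (b - a) * (W b - W a).
  move=> a0 ab bs sc c1; apply/eqP; rewrite -subr_eq0 -normr_le0; apply/ler_addgt0Pr => e e0.
  have [T [tT _ _ _ TI]] := tent_test cW a0 ab bs sc c1 e0.
  by rewrite (HW T tT) sub0r normrN in TI; rewrite add0r.
have const s c : 0 < s -> s < c -> c < 1 -> W c = W s.
  move=> s0 sc c1; apply/eqP; rewrite -subr_eq0 -normr_le0; apply/ler_addgt0Pr => e e0.
  rewrite add0r; have cs : 0 < c - s by rewrite subr_gt0.
  (* The common slope of [W] is read off between [b / 2] and [b]. With [e / 3] the values at these
     points add up to at most [e * b / 2], that is [e * (b - b / 2)]. *)
  have e3 : 0 < e / 3 by rewrite divr_gt0.
  have [d d0 Hd] := deriv01_at0 dW e3.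
  pose b := Num.min (d / 2) (s / 2).
  have b0 : 0 < b by rewrite /b lt_min !divr_gt0.
  have bd : b < d by rewrite /b gt_min; apply/orP; left; lra.
  have bs : b < s by rewrite /b gt_min; apply/orP; right; lra.
  have b20 : 0 < b / 2 by lra.
  have b2 : b / 2 < b by lra.
  have bb : 0 < b - b / 2 by lra.
  rewrite (tent (b / 2) b s c) // normrM (gtr0_norm (divr_gt0 cs bb)).
  have b1 : b <= 1 by lra.
  have b21 : b / 2 <= 1 by lra.
  have b2d : b / 2 < d by lra.
  have := Hd b b0 bd b1; have := Hd _ b20 b2d b21; rewrite !mul0r !subr0.
  rewrite !ler_norml => /andP[h1 h2] /andP[h3 h4].
  have h5 : `|W b - W (b / 2)| <= e * (b - b / 2).
    by rewrite ler_norml; apply/andP; split; lra.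
  apply: (@le_trans _ _ ((c - s) / (b - b / 2) * (e * (b - b / 2)))).
    by rewrite ler_pM2l // divr_gt0.
  have -> : (c - s) / (b - b / 2) * (e * (b - b / 2)) = (c - s) * e.
    by rewrite mulrCA mulfVK ?gt_eqF // mulrC.
  by rewrite -[leRHS]mul1r ler_pM2r //; lra.
have in0 x : 0 < x -> x < 1 -> W x = 0.
  move=> x0 x1; apply/eqP; rewrite -normr_le0; apply/ler_addgt0Pr => e e0; rewrite add0r.
  have /cvgrPdist_le /(_ e e0) [d /= d0 Hd] := cW 1.
  pose c := Num.max ((x + 1) / 2) (1 - d / 2).
  have xc : x < c by rewrite /c lt_max; apply/orP; left; lra.
  have c1 : c < 1 by rewrite /c gt_max; apply/andP; split; lra.
  have dc : 1 - d / 2 <= c by rewrite /c le_max lexx orbT.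
  have hc : `|1 - c| < d by rewrite gtr0_norm; lra.
  by have := Hd c hc; rewrite W1 sub0r normrN (const x c).
move=> x /andP[x0 x1].
have [->|xn1] := eqVneq x 1; first exact: W1.
have x1' : x < 1 by rewrite lt_neqAle xn1.
have [x0'|x0'] := ltP 0 x; first exact: in0.
have -> : x = 0 by apply/le_anti; rewrite x0 x0'.
apply/eqP; rewrite -normr_le0; apply/ler_addgt0Pr => e e0; rewrite add0r.
have /cvgrPdist_le /(_ e e0) [d /= d0 Hd] := cW 0.
pose y := Num.min (d / 2) 2^-1.
have y0 : 0 < y by rewrite /y lt_min; apply/andP; split; [exact: divr_gt0|rewrite invr_gt0 ltr0n].
have y1 : y < 1 by rewrite /y gt_min; apply/orP; right; rewrite invf_lt1 ?ltr1n.
have yd : y < d by rewrite /y gt_min; apply/orP; left; lra.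
have hy : `|0 - y| < d by rewrite sub0r normrN gtr0_norm.
by have := Hd y hy; rewrite (in0 y y0 y1) subr0.
Qed.

End Generic.

(** * Weak duality, its equality case and uniqueness of the maximizer *)

Section Strong.
Context {R : realType}.
Local Notation leb := (@lebesgue_measure R).
Implicit Types (f F T psi : R -> R) (a b d l s x y z t M : R).
Variables (beta : nat -> R) (h : R) (phi X : R -> R) (c : R).
Hypothesis cX : continuous X.
Hypothesis XE : forall x, 0 <= x <= 1 -> X x = xi2 beta x.
Hypothesis X0 : forall x, 0 <= x <= 1 -> 0 <= X x.
Hypothesis Pmin : is_Pmin beta h phi.
Hypothesis c0 : 0 < c.
Hypothesis cphi : forall x, 0 <= x <= 1 -> c <= phi x.
Hypothesis dxi : forall x, 0 <= x <= 1 -> is_derive x 1 (xi beta) (xi1 beta x).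
Hypothesis dxi1 : forall x, 0 <= x <= 1 -> is_derive x 1 (xi1 beta) (X x).
Variables (e0 e1 e2 : R -> R).
Hypothesis ce2 : continuous e2.
Hypothesis de0 : forall x, is_derive x 1 e0 (e1 x).
Hypothesis de1 : forall x, is_derive x 1 e1 (e2 x).
Hypothesis e2w : forall x, 0 <= x -> e2 x = invsq phi x.
Hypothesis e01 : e0 1 = xi beta 1.
Hypothesis e10 : e1 0 = xi1 beta 0 - h ^+ 2.

Let k := xi1 beta 0 - h ^+ 2.
Let p := clamp phi.
Let Cphi : Cset phi := proj1 Pmin.
Let cp : continuous p := clamp_phi_cont Pmin.
Let p_gt0 x : 0 < p x. Proof. exact: (clamp_phi_gt0 c0 cphi). Qed.
Let cpi : continuous (fun x => (p x)^-1) := invphi_cont Pmin c0 cphi.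
Let ce0 : continuous e0. Proof. by move=> x; exact: is_derive_cont (de0 x). Qed.

Lemma dual_Kset : Kset beta h e0.
Proof.
split; first exact: cont_within.
split.
  apply: (@convex_of_second _ e0 e1 e2) => // x /andP[x0 _].
  by rewrite e2w // ltW // (invsq_gt0 c0 cphi).
split.
  exact: (dual_ge cX XE Pmin c0 cphi dxi dxi1 ce2 de0 de1 e2w e01 e10).
split => //; rewrite -e10; apply: deriv01_is_derive; exact: de0.
Qed.

Lemma dual_ac : ac_density e0 e2.
Proof.
split; first by apply: measurable_funTS; exact: continuous_measurable_fun.
split; first by move=> x /andP[x0 _]; rewrite e2w ltW // (invsq_gt0 c0 cphi).
exists mzero, set0; split; first exact: measurable0.
split; first exact: sub0set.
split; first exact: measure0.
split; first by [].
split.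
  move=> a b _ _; split; last by rewrite /mzero ltry.
  by rewrite RI_EFin ?ltry //; exact: cont_intble.
move=> psi tpsi; rewrite integral_measure_zero adde0.
have [p1 [p2 [dp _ cp2 [_ E2] _]]] := test_funP tpsi.
have cpsi : continuous psi by move=> x; exact: is_derive_cont (dp x).
rewrite (@integral_oo_cont _ _ (fun x => e0 x * derive1 (derive1 psi) x)) //; last first.
  by move=> x; apply: cvgM; [exact: ce0|rewrite E2; exact: cp2].
rewrite (@integral_oo_cont _ _ (fun x => e2 x * psi x)) //; last first.
  by move=> x; apply: cvgM; [exact: ce2|exact: cpsi].
by congr EFin; exact: test_by_parts tpsi de0 de1 ce2.
Qed.

Variables (eta g : R -> R) (nus : {measure set R -> \bar R}).
Hypothesis Keta : Kset beta h eta.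
Hypothesis mg : measurable_fun (`]0, 1[ : set R) g.
Hypothesis g0 : forall x, 0 < x < 1 -> 0 <= g x.
Hypothesis ident : forall psi, test_fun psi ->
  (\int[leb]_(x in `]0%R, 1%R[) (eta x * derive1 (derive1 psi) x)%:E = pairing g nus psi)%E.

Let I01 x : `]0, 1[%classic x -> 0 < x < 1. Proof. by rewrite /= in_itv. Qed.

Lemma eta_slope a b : 0 < a -> a < b -> b < 1 -> k * (b - a) <= eta b - eta a.
Proof. by case: Keta => _ [cv [_ [_ d0]]]; exact: convex_slope0. Qed.

Lemma eta_hinge s : 0 < s < 1 ->
  (pairing g nus (hinge s) <= (xi beta 1 - xi beta s - k * (1 - s))%:E)%E.
Proof.
move=> s01; have [ce [_ [ge [E1 _]]]] := Keta.
apply: le_trans (pairing_hinge mg g0 ce eta_slope ident s01) _.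
rewrite lee_fin E1 lerD2r lerD2l lerN2; apply: ge.
by case/andP: s01 => *; apply/andP; split; exact: ltW.
Qed.

(** Since [eta] lies above [xi] and meets it at 1, its difference quotients at 1 are at most those
    of [xi], which convexity of [xi] bounds by [xi1 beta 1]. *)
Lemma eta_one : (pairing g nus (fun=> 1%R) <= (xi1 beta 1 - k)%:E)%E.
Proof.
have [ce [_ [ge [E1 _]]]] := Keta.
apply: (pairing_one mg g0 ce eta_slope ident) => d /andP[d0 d1].
have h1 : 0 <= 1 - d by lra.
have h2 : 1 - d < 1 by lra.
have h3 : 0 <= 1 - d <= 1 by lra.
have [z [z1 z2 E]] := mvt01 h1 h2 (lexx 1) dxi.
have z0 : 0 <= z by lra.
have [z' [z1' z2' E']] := mvt01 z0 z2 (lexx 1) dxi1.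
have Xz : 0 <= X z' by apply: X0; lra.
have hz : xi1 beta z <= xi1 beta 1.
  by rewrite -subr_ge0 E' mulr_ge0 // subr_ge0 ltW.
have := ge _ h3; rewrite E1 => q.
have e : xi beta 1 - xi beta (1 - d) = xi1 beta z * d by rewrite E; congr (_ * _); ring.
have : xi1 beta z * d <= xi1 beta 1 * d by rewrite ler_pM2r.
lra.
Qed.

(** The total mass of [eta''] is finite because its pairing with 1 is; pairings with continuous
    functions are then real numbers. *)
Let oneE : (\int[leb]_(x in `]0%R, 1%R[) (g x * 1)%:E < +oo)%E /\ (nus `]0%R, 1%R[%classic < +oo)%E.
Proof.
have h1 : (0 <= \int[leb]_(x in `]0%R, 1%R[) (g x * 1)%:E)%E.
  by apply: integral_ge0 => x /I01 x01; rewrite lee_fin mulr1 g0.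
have h2 : (\int[nus]_(x in `]0%R, 1%R[) (1%R)%:E = nus `]0%R, 1%R[%classic)%E.
  by rewrite integral_cst // mul1e.
have := le_lt_trans eta_one (ltry _); rewrite /pairing h2 => h3.
split; apply: le_lt_trans h3; first by rewrite leeDl.
by rewrite leeDr.
Qed.

Let gint f : continuous f -> leb.-integrable `]0, 1[ (fun x => (g x * f x)%:E).
Proof.
move=> cf; have mf := continuous_measurable_fun cf.
have [z _ Hz] := @EVT_max R (fun x => `|f x|) 0 1 ler01
  (cont_within (fun x => cvg_norm (@cf x))).
have gi : leb.-integrable `]0, 1[ (fun x => (`|f z| * g x)%:E).
  have gi1 : leb.-integrable `]0, 1[ (EFin \o g).
    apply/integrableP; split; first exact/measurable_EFinP.
    apply: le_lt_trans (proj1 oneE); rewrite le_eqVlt; apply/orP; left; apply/eqP.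
    apply: eq_integral => x; rewrite inE => /I01 x01.
    by rewrite /= mulr1 ger0_norm // g0.
  exact: (integrableZl _ `|f z| gi1).
apply: le_integrable gi => //; first exact: (mgf mg).
move=> x /I01 x01; rewrite !abse_EFin lee_fin !normrM normr_id mulrC ler_wpM2r //.
by apply: Hz; rewrite in_itv /= !ltW //; case/andP: x01.
Qed.

Let nint f : continuous f -> nus.-integrable `]0, 1[ (EFin \o f).
Proof.
move=> cf; have mf := continuous_measurable_fun cf.
have [z _ Hz] := @EVT_max R (fun x => `|f x|) 0 1 ler01
  (cont_within (fun x => cvg_norm (@cf x))).
apply: measurable_bounded_integrable => //; [exact: (proj2 oneE)|exact: measurable_funTS|].
rewrite /bounded_near; near=> N => x /I01 x01.
apply: le_trans (Hz x _) _; first by rewrite in_itv /= !ltW //; case/andP: x01.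
by near: N; apply: nbhs_pinfty_ge; rewrite num_real.
Unshelve. all: by end_near. Qed.

Let Rg f : R := \int[leb]_(x in `]0, 1[) (g x * f x).
Let Rn f : R := \int[nus]_(x in `]0, 1[) f x.

Let RgE f : continuous f -> (\int[leb]_(x in `]0%R, 1%R[) (g x * f x)%:E = (Rg f)%:E)%E.
Proof. by move=> cf; rewrite /Rg /Rintegral fineK //; apply: integrable_fin_num => //; exact: gint. Qed.

Let RnE f : continuous f -> (\int[nus]_(x in `]0%R, 1%R[) (f x)%:E = (Rn f)%:E)%E.
Proof. by move=> cf; rewrite /Rn /Rintegral fineK //; apply: integrable_fin_num => //; exact: nint. Qed.

Let pairingE f : continuous f -> pairing g nus f = (Rg f + Rn f)%:E.
Proof. by move=> cf; rewrite /pairing RgE // RnE. Qed.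

Lemma pairing_linear : sup_cont_linear (fun f => Rg f + Rn f).
Proof.
split.
- move=> f f' cf cf'.
  have -> : Rg (fun x => f x + f' x) = \int[leb]_(x in `]0, 1[) (g x * f x + g x * f' x).
    by apply: eq_Rintegral => x _; rewrite mulrDr.
  rewrite RintegralD //; [|exact: gint|exact: gint].
  by rewrite /Rn RintegralD //; [exact: addrACA|exact: nint|exact: nint].
- move=> r f cf.
  have -> : Rg (fun x => r * f x) = \int[leb]_(x in `]0, 1[) (r * (g x * f x)).
    by apply: eq_Rintegral => x _; rewrite mulrCA.
  rewrite RintegralZl //; last exact: gint.
  by rewrite /Rn RintegralZl // ?mulrDr //; exact: nint.
- have c1 (r : R) : continuous (fun _ : R => r) by move=> x; exact: cvg_cst.
  exists (Rg (fun=> 1) + Rn (fun=> 1)) => f e cf fe.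
  have fe' x : 0 < x < 1 -> `|f x| <= e by move=> /andP[x0 x1]; apply: fe; rewrite !ltW.
  apply: le_trans (ler_normD _ _) _; rewrite mulrDl; apply: lerD.
    apply: (@le_trans _ _ (\int[leb]_(x in `]0, 1[) `|g x * f x|)).
      by apply: le_normr_Rintegral => //; exact: gint.
    rewrite /Rg -RintegralZr //; last exact: (gint (c1 1)).
    apply: le_Rintegral => //.
    - exact: (integrable_abse (gint cf)).
    - exact: (integrableZr _ e (gint (c1 1))).
    - move=> x /I01 x01; rewrite mulr1 normrM (ger0_norm (g0 x01)).
      by rewrite ler_wpM2l ?g0 // fe'.
  apply: (@le_trans _ _ (\int[nus]_(x in `]0, 1[) `|f x|)).
    by apply: le_normr_Rintegral => //; exact: nint.
  rewrite /Rn -RintegralZr //; last exact: (nint (c1 1)).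
  apply: le_Rintegral => //.
  - exact: (integrable_abse (nint cf)).
  - exact: (integrableZr _ e (nint (c1 1))).
  - by move=> x /I01 x01; rewrite mul1r fe'.
Qed.

Let S := RI 0 1 (fun x => (p x)^-1).

(** The functional [L], sending [f] to the integral of [xi'' f] plus [h^2 f(0)] minus the pairing
    with [eta''], is nonnegative on the generators by [eta_one] and [eta_hinge], hence at [phi].
    There the vanishing of [Jvar] turns the first two terms into the integral of [1 / phi]. *)
Lemma weak_duality : Rg p + Rn p <= S.
Proof.
have cw := invsq_cont Pmin c0 cphi.
have lin := sclB 1 (Jvar_linear (h := h) cX Pmin c0 cphi) pairing_linear.
(* Written through [Jvar] so that [sclB] gives linearity and the sup bound; the last term restores
   the [invsq phi] subtracted inside [Jvar]. *)
pose L f := 1 * (1 * Jvar h phi X f - (Rg f + Rn f)) - - 1 * RI 0 1 (fun x => invsq phi x * f x).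
have Llin : sup_cont_linear L.
  rewrite /L; apply: sclB lin _; split.
  - move=> f f' cf cf'; rewrite (RI_eq (g := fun x => invsq phi x * f x + invsq phi x * f' x)); last first.
      by move=> x _; ring.
    rewrite RID; [ring| |]; apply: cont_intble => x; apply: cvgM; try exact: cw; [exact: cf|exact: cf'].
  - move=> r f cf; rewrite (RI_eq (g := fun x => r * (invsq phi x * f x))); last first.
      by move=> x _; ring.
    rewrite RIZ; [ring|]; apply: cont_intble => x; apply: cvgM; [exact: cw|exact: cf].
  - exists (RI 0 1 (invsq phi)) => f e cf fe; rewrite mulN1r normrN.
    have ci : continuous (fun x => invsq phi x * f x).
      by move=> x; apply: cvgM; [exact: cw|exact: cf].
    apply: (@le_trans _ _ (RI 0 1 (fun x => `|invsq phi x * f x|))).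
      by apply: le_normr_Rintegral => //; exact: cont_intble.
    rewrite mulrC -RIZ; last exact: cont_intble.
    apply: RI_le.
    + exact: (integrable_abse (cont_intble 0 1 ci)).
    + exact/intbleZ/cont_intble.
    + move=> x x01; have w0 := invsq_gt0 c0 cphi x.
      by rewrite normrM (gtr0_norm w0) mulrC ler_pM2r // fe.
have h01 : 0 <= (0 : R) <= 1 by rewrite lexx ler01.
have c1 (r : R) : continuous (fun _ : R => r) by move=> x; exact: cvg_cst.
have LE f : continuous f -> L f = RI 0 1 (fun x => X x * f x) + h ^+ 2 * f 0 - (Rg f + Rn f).
  move=> cf; rewrite /L /Jvar (RI_eq (g := fun x => X x * f x - invsq phi x * f x)); last first.
    by move=> x _; ring.
  rewrite RIB; [ring| |]; apply: cont_intble => x; apply: cvgM; try exact: cf; [exact: cX|exact: cw].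
have Lpos s : 0 < s < 1 -> 0 <= RI 0 1 (fun x => X x * hinge s x) + h ^+ 2 * hinge s 0 -
    (Rg (hinge s) + Rn (hinge s)).
  move=> s01; have /andP[s0 s1] := s01.
  have s01' : 0 <= s < 1 by rewrite s1 ltW.
  rewrite (hinge_by_parts dxi dxi1 cX s01').
  have := eta_hinge s01; rewrite pairingE ?lee_fin; last exact: hinge_cont.
  rewrite /hinge (max_r (ltW s0)) /k => q.
  by rewrite subr_ge0; apply: le_trans q _; rewrite le_eqVlt; apply/orP; left; apply/eqP; ring.
have Cc : Cset p by apply: Cset_ext Cphi => x x01; rewrite /p clamp_id.
have Lp : L p = RI 0 1 (fun x => invsq phi x * p x) - (Rg p + Rn p).
  by rewrite /L (Jvar_phi cX XE Pmin c0 cphi); ring.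
clearbody L; have := cone_ge0 Llin Cc cp.
have L1 : 0 <= L (fun=> 1).
  rewrite (LE _ (c1 1)).
  have -> : RI 0 1 (fun x => X x * 1) = xi1 beta 1 - xi1 beta 0.
    rewrite -(RI_ftc' ler01 (cont_within cX) dxi1); apply: RI_eq => x _; exact: mulr1.
  have := eta_one; rewrite (pairingE (c1 1)) lee_fin /k => q.
  by rewrite mulr1 subr_ge0; apply: le_trans q _; lra.
move=> /(_ L1) H.
have [_ _ [B HB]] := Llin; have [LD LZ _] := Llin.
have {}H : 0 <= L p.
  apply: H => s /andP[s0 s1]; rewrite LE; last exact: hinge_cont.
  have [s0'|s0'] := ltP 0 s; first by apply: Lpos; rewrite s0'.
  have -> : s = 0 by apply/le_anti; rewrite s0 s0'.
  rewrite -LE; last exact: hinge_cont.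
  (* [eta_hinge] concerns [0 < s]; the case [s = 0] follows because [hinge r] is within [r] of
     [hinge 0] and [L] is bounded. *)
  rewrite leNgt; apply/negP => neg.
  set L0 := (X in X < 0) in neg.
  pose r := Num.min (2^-1) (- L0 / (2 * (`|B| + 1))).
  have B1 : 0 < 2 * (`|B| + 1) by rewrite mulr_gt0 // ltr_wpDl.
  have r0 : 0 < r by rewrite /r lt_min invr_gt0 ltr0n divr_gt0 // oppr_gt0.
  have r1 : r < 1 by rewrite /r gt_min; apply/orP; left; rewrite invf_lt1 ?ltr1n.
  have rB : r * (2 * (`|B| + 1)) <= - L0 by rewrite -ler_pdivlMr // ge_min lexx orbT.
  have r01 : 0 < r < 1 by rewrite r0.
  have := Lpos r r01; rewrite -LE; last exact: hinge_cont.
  have cd : continuous (fun x => hinge r x + -1 * hinge 0 x).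
    move=> x; apply: cvgD; first exact: hinge_cont.
    by apply: cvgM; [exact: cvg_cst|exact: hinge_cont].
  have dd x : 0 <= x <= 1 -> `|hinge r x + -1 * hinge 0 x| <= r.
    move=> /andP[x0 x1]; rewrite /hinge (max_l x0).
    by have [q|q] := leP x r; rewrite ler_norml; apply/andP; split; lra.
  have := HB _ r cd dd.
  rewrite LD; [|exact: hinge_cont|by move=> x; apply: cvgM; [exact: cvg_cst|exact: hinge_cont]].
  rewrite LZ; last exact: hinge_cont.
  rewrite -/L0; set Lr := (X in X + _).
  have Bn : B * r <= `|B| * r by rewrite ler_pM2r // ler_norm.
  have rB' : r * (2 * (`|B| + 1)) = 2 * (`|B| * r) + 2 * r by ring.
  rewrite ler_norml => /andP[_ q1] q2.
  have v0 : 0 <= `|B| * r by rewrite mulr_ge0 // ltW.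
  rewrite rB' in rB.
  have alg (l l' u v q : R) : l < 0 -> 0 < q -> 0 <= v -> u <= v -> l' + -1 * l <= u ->
    0 <= l' -> 2 * v + 2 * q <= - l -> False by lra.
  exact: (alg L0 Lr (B * r) (`|B| * r) r neg r0 v0 Bn q1 q2 rB).
have E : RI 0 1 (fun x => invsq phi x * p x) = S.
  apply: RI_eq => x _; rewrite /invsq -/p -mulrA mulVf ?mulr1 // gt_eqF //.
by move: H; rewrite Lp E subr_ge0.
Qed.

Hypothesis gmax : (Dval e2 <= Dval g)%E.

Let sqrt_e2 x : 0 < x < 1 -> Num.sqrt (e2 x) = (p x)^-1.
Proof.
move=> /andP[x0 _]; rewrite e2w ?ltW // /invsq -/p -expr2 sqrtr_sqr ger0_norm //.
by rewrite invr_ge0 ltW.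
Qed.

Let msq : measurable_fun (`]0, 1[ : set R) (fun x => Num.sqrt (g x)).
Proof.
have -> : (fun x => Num.sqrt (g x)) = Num.sqrt \o g by [].
by apply: measurableT_comp mg; apply: continuous_measurable_fun; exact: sqrt_continuous.
Qed.

Let amgm x : 0 < x < 1 ->
  g x * p x + (p x)^-1 - 2 * Num.sqrt (g x) = p x * (Num.sqrt (g x) - (p x)^-1) ^+ 2.
Proof.
move=> x01; have pn : p x != 0 by rewrite gt_eqF.
rewrite -{1}[g x]sqr_sqrtr ?g0 //; by field.
Qed.

(** With [S] and [Q] the integrals of [1 / phi] and of [sqrt g], maximality gives [S <= Q], the
    square in [amgm] gives [0 <= Rg p + S - 2 * Q], and weak duality gives [Rg p + Rn p <= S]. So
    the integral of the square vanishes. *)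
Lemma equality_case : Rn p <= 0 /\ ae_eq leb (`]0, 1[%classic : set R) (EFin \o g) (EFin \o e2).
Proof.
have SE : (\int[leb]_(x in `]0%R, 1%R[) (Num.sqrt (e2 x))%:E = S%:E)%E.
  by apply: integral_oo_cont => // x; exact: sqrt_e2.
have ig := gint cp.
have ipi : leb.-integrable `]0, 1[ (fun x => ((p x)^-1)%:E).
  apply: integrableS (cont_intble 0 1 cpi) => //.
  by move=> x /=; rewrite !in_itv /= => /andP[x0 x1]; rewrite !ltW.
have isum : leb.-integrable `]0, 1[ (fun x => (g x * p x + (p x)^-1)%:E).
  exact: (integrableD _ ig ipi).
have sq0 x : 0 < x < 1 -> 2 * Num.sqrt (g x) <= g x * p x + (p x)^-1.
  by move=> x01; rewrite -subr_ge0 amgm // mulr_ge0 ?sqr_ge0 // ltW.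
have i2 : leb.-integrable `]0, 1[ (fun x => (2 * Num.sqrt (g x))%:E).
  apply: le_integrable isum => //.
    by apply/measurable_EFinP; apply: measurable_funM.
  move=> x /I01 x01; rewrite !abse_EFin lee_fin ger0_norm ?mulr_ge0 ?sqrtr_ge0 //.
  exact: le_trans (sq0 x x01) (ler_norm _).
have isq : leb.-integrable `]0, 1[ (fun x => (Num.sqrt (g x))%:E).
  apply: le_integrable i2 => //; first exact/measurable_EFinP.
  move=> x _; rewrite !abse_EFin lee_fin !ger0_norm ?mulr_ge0 ?sqrtr_ge0 //.
  by have := sqrtr_ge0 (g x); lra.
pose Q : R := \int[leb]_(x in `]0, 1[) Num.sqrt (g x).
have QE : (\int[leb]_(x in `]0%R, 1%R[) (Num.sqrt (g x))%:E = Q%:E)%E.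
  by rewrite /Q /Rintegral fineK //; exact: integrable_fin_num.
have SQ : S <= Q.
  move: gmax; rewrite /Dval SE QE -!EFinM lee_fin => q.
  by move: q; rewrite ler_pM2l.
pose E : R := \int[leb]_(x in `]0, 1[) (g x * p x + (p x)^-1 - 2 * Num.sqrt (g x)).
have iE : leb.-integrable `]0, 1[ (fun x => (g x * p x + (p x)^-1 - 2 * Num.sqrt (g x))%:E).
  exact: (integrableB _ isum i2).
have SR : \int[leb]_(x in `]0, 1[) (p x)^-1 = S.
  by rewrite /Rintegral (@integral_oo_cont _ _ (fun x => (p x)^-1)).
have EE : E = Rg p + S - 2 * Q.
  have E1 : E = \int[leb]_(x in `]0, 1[) (g x * p x + (p x)^-1) -
      \int[leb]_(x in `]0, 1[) (2 * Num.sqrt (g x)) by apply: RintegralB.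
  have E2 : \int[leb]_(x in `]0, 1[) (g x * p x + (p x)^-1) = Rg p + S.
    by rewrite -SR; apply: RintegralD.
  by rewrite E1 E2; congr (_ - _); apply: RintegralZl.
have E0 : 0 <= E.
  by apply: Rintegral_ge0 => x /I01 x01; rewrite subr_ge0 sq0.
have wd := weak_duality.
have Rn0 : 0 <= Rn p by apply: Rintegral_ge0 => x _; exact: ltW.
have E00 : E = 0 by lra.
have alg (a b s q : R) : 0 = a + s - 2 * q -> a + b <= s -> s <= q -> b <= 0 by lra.
split; first by apply: alg wd SQ; rewrite -EE.
have : (\int[leb]_(x in `]0%R, 1%R[) `|(g x * p x + (p x)^-1 - 2 * Num.sqrt (g x))%:E| = 0)%E.
  have -> : (0 = E%:E)%E by rewrite E00.
  rewrite /E /Rintegral fineK; last exact: integrable_fin_num.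
  by apply: eq_integral => x; rewrite inE => /I01 x01; rewrite abse_EFin ger0_norm // subr_ge0 sq0.
move=> /(proj1 (ae_eq_integral_abs leb (measurable_itv _) (measurable_int _ iE))).
apply: filterS => x + xI => /(_ xI) /= [] q; congr EFin.
have x01 := I01 xI; move: q; rewrite amgm // => /eqP.
rewrite mulf_eq0 gt_eqF //= sqrf_eq0 subr_eq0 => /eqP q.
have /andP[x0 _] := x01.
by rewrite e2w ?ltW // /invsq -/p -q -expr2 sqr_sqrtr // g0.
Qed.

(** [p >= c] turns [Rn p <= 0] into vanishing of the singular part; then [eta - e0] has zero second
    distributional derivative, value 0 at 1 and slope 0 at 0. *)
Lemma maximizer_unique x : 0 <= x <= 1 -> eta x = e0 x.
Proof.
have [Rn0 ae] := equality_case.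
have [ce [_ [_ [E1 d0]]]] := Keta.
have cpsiE psi : test_fun psi -> continuous psi.
  by move=> /test_funP [p1 [p2 [dp _ _ _ _]]] y; exact: is_derive_cont (dp y).
have nu0 : nus `]0%R, 1%R[%classic = 0%E.
  have : (c%:E * nus `]0%R, 1%R[%classic <= 0)%E.
    apply: (@le_trans _ _ (Rn p)%:E); last by rewrite lee_fin.
    rewrite -RnE // -integral_cst //; apply: ge0_le_integral => //.
    - by move=> y _; rewrite lee_fin ltW.
    - exact: (mf01 (continuous_measurable_fun cp)).
    - by move=> y _; rewrite lee_fin; exact: (clamp_phi_ge cphi).
  move=> q; apply/eqP; rewrite eq_le measure_ge0 andbT.
  by move: q; rewrite pmule_rle0 // lte_fin.
pose W y := clamp eta y - e0 y.
have cW : continuous W by move=> y; apply: cvgB; [exact: clamp_cont|exact: ce0].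
move=> x01; apply/eqP; rewrite -subr_eq0 -(clamp_id eta x01) -/(W x); apply/eqP.
apply: distr_affine_eq0 x01 => //.
- have h01 : 0 <= (0 : R) <= 1 by rewrite lexx ler01.
  have := deriv01B d0 (deriv01_is_derive (de0 0)); rewrite e10 subrr.
  by apply: deriv01_eq => // y y01; rewrite /W clamp_id.
- by rewrite /W clamp_id ?E1 ?e01 ?subrr // lexx ler01.
- move=> T tT; have [p1 [p2 [dp _ cp2 [_ E2] _]]] := test_funP tT.
  have cT := cpsiE T tT.
  have c1 : continuous (fun y => clamp eta y * derive1 (derive1 T) y).
    by move=> y; apply: cvgM; [exact: clamp_cont|rewrite E2; exact: cp2].
  have c2 : continuous (fun y => e0 y * derive1 (derive1 T) y).
    by move=> y; apply: cvgM; [exact: ce0|rewrite E2; exact: cp2].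
  rewrite (RI_eq (g := fun y => clamp eta y * derive1 (derive1 T) y - e0 y * derive1 (derive1 T) y)); last first.
    by move=> y _; rewrite /W mulrBl.
  rewrite RIB; [|exact: cont_intble|exact: cont_intble].
  rewrite (test_by_parts tT de0 de1 ce2); apply/eqP; rewrite subr_eq0; apply/eqP.
  apply: EFin_inj; rewrite -(@integral_oo_cont _ (fun y => eta y * derive1 (derive1 T) y)) //; last first.
    by move=> y /andP[y0 y1]; rewrite clamp_id // !ltW.
  have ci : continuous (fun y => e2 y * T y) by move=> y; apply: cvgM; [exact: ce2|exact: cT].
  rewrite ident // /pairing.
  have -> : (\int[nus]_(y in `]0%R, 1%R[) (T y)%:E = 0)%E.
    apply: null_set_integral => //; exact: (mf01 (continuous_measurable_fun cT)).
  rewrite adde0 -(@integral_oo_cont _ (fun y => e2 y * T y)) //.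
  apply: ae_eq_integral => //.
  - exact: (mgf mg (continuous_measurable_fun cT)).
  - exact: (mf01 (continuous_measurable_fun ci)).
  - by apply: filterS ae => y + yI => /(_ yI) /= [] ->.
Qed.

End Strong.

(** * Distributional derivatives of [phi] and the support of [mu] *)

Section Distributions.
Context {R : realType}.
Local Notation leb := (@lebesgue_measure R).
Implicit Types (f w psi : R -> R) (a b d s x y M : R).

Lemma bounded2 f w : continuous f -> continuous w ->
  exists M, (forall x, 0 <= x <= 1 -> `|f x| <= M) /\ (forall x, 0 <= x <= 1 -> `|w x| <= M).
Proof.
move=> cf cw.
have [z _ Hz] := @EVT_max R (fun x => `|f x|) 0 1 ler01 (cont_within (fun x => cvg_norm (@cf x))).
have [t _ Ht] := @EVT_max R (fun x => `|w x|) 0 1 ler01 (cont_within (fun x => cvg_norm (@cw x))).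
exists (Num.max `|f z| `|w t|); split => x x01; rewrite le_max; apply/orP; [left|right].
  by apply: Hz; rewrite in_itv.
by apply: Ht; rewrite in_itv.
Qed.

Lemma gt0_near f x : continuous f -> 0 < f x ->
  exists2 d, 0 < d & forall y, `|x - y| < d -> 0 < f y.
Proof.
move=> cf f0; have /cvgrPdist_lt /(_ _ f0) [d /= d0 Hd] := cf x.
by exists d => // y yd; have := Hd y yd; rewrite ltr_norml => /andP[_]; lra.
Qed.

Variables (p F : R -> R) (C : R) (mu : {measure set R -> \bar R}).
Hypothesis cp : continuous p.
Hypothesis Fnd : {homo F : x y / x <= y}.
Hypothesis FC : forall x, 0 <= F x <= C.
Hypothesis FA : forall x y, 0 <= x -> x <= y -> y <= 1 -> F x * (y - x) <= p x - p y.
Hypothesis FB : forall x y, 0 <= x -> x <= y -> y <= 1 -> p x - p y <= F y * (y - x).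
Hypothesis muE : forall a b, a <= b -> mu `]a, b]%classic = (F b - F a)%:E.

(** [f] is only asked to agree with [p] on (0, 1), so that the result applies both to [phi] and to
    [1 / sqrt eta'']. *)
Lemma slope_distr_deriv f : (forall x, 0 < x < 1 -> f x = p x) -> distr_deriv f (fun x => - F x).
Proof.
move=> fp psi /test_funP [p1 [p2 [dp dp1 cp2 [E1 E2] [z1 z2 z3 z4]]]].
have cp1 : continuous p1 by move=> x; exact: is_derive_cont (dp1 x).
have cpsi : continuous psi by move=> x; exact: is_derive_cont (dp x).
have [M [M0 M1]] := bounded2 cpsi cp1.
have iF : intble 0 1 (fun x => F x * psi x) by apply: (nd_intble Fnd FC _ _ cpsi M0).
have -> : (\int[leb]_(x in `]0%R, 1%R[) (- F x * psi x)%:E =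
    \int[leb]_(x in `]0%R, 1%R[) (-1 * (F x * psi x))%:E)%E.
  by apply: eq_integral => x _; rewrite mulN1r mulNr.
rewrite (int_oo (intbleZ (-1) iF)).
rewrite RIZ // mulN1r EFinN oppeK E1 (@integral_oo_cont _ _ (fun x => p x * p1 x)).
- by rewrite (slope_by_parts cp cp1 dp M0 M1 Fnd FC FA FB) z1 z2 !mulr0 subrr add0r.
- by move=> x; apply: cvgM; [exact: cp|exact: cp1].
- by move=> x x01; rewrite fp.
Qed.

(** Two integrations by parts: one moves a derivative onto [p] and produces [- F], the other
    identifies the derivative of [F] with [mu]. *)
Lemma slope_distr_deriv2 f : (forall x, 0 < x < 1 -> f x = p x) -> distr_deriv2_neg f mu.
Proof.
move=> fp psi /test_funP [p1 [p2 [dp dp1 cp2 [E1 E2] [z1 z2 z3 z4]]]].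
have cp1 : continuous p1 by move=> x; exact: is_derive_cont (dp1 x).
have cpsi : continuous psi by move=> x; exact: is_derive_cont (dp x).
have [M [M0 M1]] := bounded2 cpsi cp1; have [M' [M1' M2]] := bounded2 cp1 cp2.
rewrite (stieltjes_by_parts cp1 dp M0 M1 Fnd FC muE z1 z2) EFinN oppeK E2.
rewrite (@integral_oo_cont _ _ (fun x => p x * p2 x)).
- by rewrite (slope_by_parts cp cp2 dp1 M1' M2 Fnd FC FA FB) z3 z4 !mulr0 subrr add0r.
- by move=> x; apply: cvgM; [exact: cp|exact: cp2].
- by move=> x x01; rewrite fp.
Qed.

(** On an affine piece the chord bounds on [F x] from the right and from the left of [x]
    coincide. *)
Lemma slope_affine a b x : 0 <= a -> b <= 1 -> a < x -> x < b ->
  (forall t, 0 <= t <= 1 -> p (t * a + (1 - t) * b) = t * p a + (1 - t) * p b) ->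
  F x = (p a - p b) / (b - a).
Proof.
move=> a0 b1 ax xb aff.
have ba : 0 < b - a by lra.
pose t := (b - x) / (b - a).
have tE : t * (b - a) = b - x by rewrite /t mulfVK ?gt_eqF.
have t01 : 0 <= t <= 1 by rewrite /t ler_pdivrMr // divr_ge0 //=; lra.
have x0 : 0 <= x by lra.
have x1 : x <= 1 by lra.
have xE : t * a + (1 - t) * b = x by move: tE; rewrite mulrBr; lra.
have px := aff t t01; rewrite xE in px.
have hA := FA x0 (ltW xb) b1; have hB := FB a0 (ltW ax) x1.
have pa : p a - p b = (p a - p b) / (b - a) * (b - a) by rewrite mulfVK ?gt_eqF.
move: pa; move: (_ / _) => q pa.
have e1 : p x - p b = q * (b - x).
  by rewrite -tE px; transitivity (t * (p a - p b)); [ring|rewrite pa; ring].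
have e2 : p a - p x = q * (x - a).
  have -> : x - a = (1 - t) * (b - a) by rewrite mulrBl tE; ring.
  by rewrite px; transitivity ((1 - t) * (p a - p b)); [ring|rewrite pa; ring].
apply/le_anti/andP; split.
  by rewrite -(@ler_pM2r _ (b - x)) ?subr_gt0 // -e1.
by rewrite -(@ler_pM2r _ (x - a)) ?subr_gt0 // -e2.
Qed.

Lemma mu_bounded (A : set R) : measurable A -> A `<=` `]0, 1] -> (mu A < +oo)%E.
Proof.
move=> mA A01; apply: (@le_lt_trans _ _ (mu `]0%R, 1%R]%classic)).
  by apply: le_measure; rewrite ?inE //; exact: measurable_itv.
by rewrite muE ?ler01 // ltry.
Qed.

(** [F] is constant inside []a, b[]; the smaller interval []a', b'[] has both ends where
    [slope_affine] applies, so its mass is 0. *)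
Lemma msupport_not_affine a b x : 0 <= a -> b <= 1 -> a < x -> x < b ->
  (forall t, 0 <= t <= 1 -> p (t * a + (1 - t) * b) = t * p a + (1 - t) * p b) ->
  ~ msupport mu x.
Proof.
move=> a0 b1 ax xb aff.
pose a' := (a + x) / 2; pose b' := (x + b) / 2.
have aa' : a < a' by rewrite /a'; lra.
have a'x : a' < x by rewrite /a'; lra.
have xb' : x < b' by rewrite /b'; lra.
have b'b : b' < b by rewrite /b'; lra.
have ab' : a' < b' by exact: lt_trans xb'.
move=> /(_ `]a', b'[%classic (itv_open a' b')).
have -> : mu `]a', b'[%classic = 0%E.
  apply/eqP; rewrite eq_le measure_ge0 andbT.
  apply: (@le_trans _ _ (mu `]a', b']%classic)).
    apply: le_measure; rewrite ?inE; [exact: measurable_itv|exact: measurable_itv|].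
    by move=> y /=; rewrite !in_itv /= => /andP[-> /ltW].
  rewrite (muE (ltW ab')) (slope_affine a0 b1 aa' (lt_trans ab' b'b) aff).
  by rewrite (slope_affine a0 b1 (lt_trans aa' ab') b'b aff) subrr.
by rewrite ltxx /= in_itv /= a'x xb' => /(_ isT).
Qed.

End Distributions.

(** * Assembly of the three claims *)

Unset Implicit Arguments.

Theorem theorem1p11 (R : realType) (beta : nat -> R) (h : R) (phi eta : R -> R) :
  is_model beta -> 0 <= h ->
  is_Pmin beta h phi -> is_Dmax beta h eta ->
  (* (1) *)
  ((exists c : R, 0 < c /\ forall t, 0 <= t <= 1 -> c <= phi t) /\
   (exists (g : R -> R) (M : R), measurable_fun (`]0, 1[ : set R) g /\
      (forall t, 0 < t < 1 -> `|g t| <= M) /\ distr_deriv phi g)) /\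
  (exists (eta1 eta2 : R -> R) (mu : {measure set R -> \bar R}),
    (* (2a) *)
    C2_01 eta eta1 eta2 /\
    (* (2b) *)
    (forall t, 0 <= t <= 1 -> 0 < eta2 t) /\
    {within `[0, 1], continuous (fun t => (Num.sqrt (eta2 t))^-1)} /\
    (exists w : R -> R,
       (@lebesgue_measure R).-integrable `]0, 1[ (fun t => (w t)%:E) /\
       (forall x y, 0 < x -> x <= y -> y < 1 -> w y <= w x) /\
       distr_deriv (fun t => (Num.sqrt (eta2 t))^-1) w) /\
    radon01 mu /\
    distr_deriv2_neg (fun t => (Num.sqrt (eta2 t))^-1) mu /\
    (msupport mu `&` `]0, 1[ `<=` [set t | xi beta t = eta t]) /\
    (* (2c) *)
    (forall t, 0 <= t <= 1 -> xi beta t = eta t ->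
       eta1 t = xi1 beta t /\ xi2 beta t <= eta2 t) /\
    (* (2d) *)
    eta1 1 = xi1 beta 1 /\
    (eta 0 = xi beta 0 \/
     (fun t => (phi t - phi 0) / t) @ at_right 0 --> (0 : R)) /\
    (* (3) *)
    distr_deriv2_neg phi mu /\
    (mu `]0%R, 1%R[%classic < +oo)%E).
Proof.
move=> mod _ Pmin [Keta [g [[mg [g0 [nus [N [mN [N01 [lN [nuN [fin ident]]]]]]]]] gmax]]].
have [d [d0 dd xi20 [L L0 XL]]] := model_regular mod.
have in_d x : 0 <= x <= 1 -> `|x| < 1 + d by move=> /andP[x0 x1]; rewrite ger0_norm //; lra.
pose X := clamp (xi2 beta).
have cX : continuous X.
  apply: clamp_cont; apply: continuous_in_subspaceT => x; rewrite inE /= in_itv /= => x01.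
  by have [_ _] := dd x (in_d x x01).
have XE x : 0 <= x <= 1 -> X x = xi2 beta x by move=> x01; rewrite /X clamp_id.
have X0 x : 0 <= x <= 1 -> 0 <= X x by move=> x01; rewrite XE // xi20.
have [B [XB0 _]] := bounded2 cX cX.
have XB x : 0 <= x <= 1 -> X x <= B by move=> x01; exact: le_trans (ler_norm _) (XB0 x x01).
have dxi (x : R) : 0 <= x <= 1 -> is_derive x 1 (xi beta) (xi1 beta x).
  by move=> x01; have [] := dd x (in_d x x01).
have dxi1 (x : R) : 0 <= x <= 1 -> is_derive x 1 (xi1 beta) (X x).
  move=> x01; have [_ q _] := dd x (in_d x x01).
  exact: (is_derive_eq q (esym (XE x x01))).
have XL' x y : 0 <= x -> x <= y -> y <= 1 -> X y - X x <= L * (y - x).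
  move=> x0 xy y1; rewrite !XE; [exact: XL|by rewrite x0 (le_trans xy)|].
  by rewrite y1 (le_trans x0).
have [c c0 cphi] := minimizer_pos cX XE X0 XB Pmin.
have [e0 [e1 [e2 [ce2 de0 de1 e2w [e01 e10]]]]] := dual_exists Pmin c0 cphi.
(* Maximality of [g] is applied to the single competitor [e2], the density of the dual function. *)
have etaE x : 0 <= x <= 1 -> eta x = e0 x.
  apply: (maximizer_unique cX XE X0 Pmin c0 cphi dxi dxi1 ce2 de0 de1 e2w e01 e10 Keta mg g0 ident).
  apply: (gmax e0 e2).
    exact: (dual_Kset cX XE Pmin c0 cphi dxi dxi1 ce2 de0 de1 e2w e01 e10).
  exact: (dual_ac c0 cphi ce2 de0 de1 e2w).
have [C C0 pC] := lipschitz_at1 cX XE Pmin c0 cphi dxi dxi1 ce2 de0 de1 e2w e01 e10 L0 XL'.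
pose p := clamp phi.
have cp : continuous p := clamp_phi_cont Pmin.
have pE x : 0 <= x <= 1 -> p x = phi x by move=> x01; rewrite /p clamp_id.
have oo (x : R) : 0 < x < 1 -> 0 <= x <= 1 by move=> /andP[x0 x1]; rewrite !ltW.
have h01 : 0 <= (0 : R) <= 1 by rewrite lexx ler01.
have h11 : 0 <= (1 : R) <= 1 by rewrite ler01 lexx.
have Cp : Cset p by apply: Cset_ext (proj1 Pmin) => x x01; rewrite /p clamp_id.
have pC' t : 0 <= t <= 1 -> p t - p 1 <= C * (1 - t) by move=> t01; rewrite !pE // pC.
have [F [Fnd Frc FC [F0 F1] [Fl FA FB _]]] := concave_slope Cp pC'.
have [mu [muE mu0]] := stieltjes_measure Fnd Frc F0 F1 Fl.
have phip x : 0 < x < 1 -> phi x = p x by move=> /oo x01; rewrite pE.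
have mFn : measurable_fun (`]0, 1[ : set R) (fun x => - F x).
  by apply: measurable_funN; exact: nondecreasing_measurable.
have sqE x : 0 <= x <= 1 -> (Num.sqrt (e2 x))^-1 = p x.
  move=> /andP[x0 _]; have p0 : 0 < p x := clamp_phi_gt0 c0 cphi x.
  rewrite e2w // /invsq -/p -expr2 sqrtr_sqr ger0_norm ?invrK //.
  by rewrite invr_ge0 ltW.
have e2pos x : 0 <= x <= 1 -> 0 < e2 x.
  by move=> /andP[x0 _]; rewrite e2w // (invsq_gt0 c0 cphi).
pose u x := e0 x - clamp (xi beta) x.
have cu : continuous u.
  move=> x; apply: cvgB; first exact: is_derive_cont (de0 x).
  apply: clamp_cont; apply: continuous_in_subspaceT => y; rewrite inE /= in_itv /= => y01.
  exact: is_derive_cont (dxi y y01).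
have uE x : 0 <= x <= 1 -> u x = e0 x - xi beta x by move=> x01; rewrite /u clamp_id.
have upos x : 0 <= x <= 1 -> xi beta x != e0 x -> 0 < u x.
  move=> x01 ne; rewrite uE // subr_gt0 lt_neqAle ne /=.
  exact: (dual_ge cX XE Pmin c0 cphi dxi dxi1 ce2 de0 de1 e2w e01 e10).
split.
  split; first by exists c.
  exists (fun x => - F x), C; split => //; split.
    by move=> t _; have /andP[q1 q2] := FC t; rewrite normrN ger0_norm.
  exact: (slope_distr_deriv cp Fnd FC FA FB).
exists e1, e2, mu.
split.
  split; first by case: Keta.
  split; first by apply: cont_within => x; exact: is_derive_cont (de1 x).
  split; first exact: cont_within.
  move=> x x01; split; last exact: deriv01_is_derive.
  by apply: (deriv01_eq _ x01 (deriv01_is_derive (de0 x))) => y y01; rewrite etaE.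
split=> //.
split.
  apply: continuous_in_subspaceT => x; rewrite inE /= in_itv /= => x01.
  apply: cvgV; first by rewrite gt_eqF // sqrtr_gt0 e2pos.
  exact: (continuous_comp (ce2 x) (@sqrt_continuous R (e2 x))).
split.
  exists (fun x => - F x); split.
    have iF : intble 0 1 (fun x => - F x).
      apply: (@intble_eq _ 0 1 (fun x => -1 * F x)) => [x _|]; first by rewrite mulN1r.
      by apply: intbleZ; exact: nd_intble1 Fnd FC 0 1.
    by apply: integrableS iF => //; exact: subset_itv_oo_cc.
  split; first by move=> x y _ xy _; rewrite lerN2 Fnd.
  by apply: (slope_distr_deriv cp Fnd FC FA FB) => x /oo; exact: sqE.
split.
  split=> // a b a0 b1; apply: (mu_bounded muE); first exact: measurable_itv.
  move=> x /=; rewrite !in_itv /= => /andP[ax xb].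
  by rewrite (lt_le_trans a0 ax) (le_trans xb (ltW b1)).
split; first by apply: (slope_distr_deriv2 cp Fnd FC FA FB muE) => x /oo; exact: sqE.
split.
  move=> x [supx]; rewrite /= in_itv /= => x01.
  have [//|ne] := eqVneq (xi beta x) (eta x).
  exfalso; rewrite (etaE x (oo x x01)) in ne.
  have [r r0 Hr] := gt0_near cu (upos x (oo x x01) ne).
  have /andP[x0 x1] := x01.
  (* A segment around [x] inside (0, 1) on which [u > 0]; [phi] is affine there, so [x] is not in
     the support of [mu]. *)
  pose a := Num.max (x - r / 2) (x / 2); pose b := Num.min (x + r / 2) ((x + 1) / 2).
  have ax : a < x by rewrite /a gt_max; apply/andP; split; lra.
  have xb : x < b by rewrite /b lt_min; apply/andP; split; lra.
  have ra : x - r / 2 <= a by rewrite /a le_max lexx.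
  have rb : b <= x + r / 2 by rewrite /b ge_min lexx.
  have a0 : 0 <= a by rewrite /a le_max; apply/orP; right; lra.
  have b1 : b <= 1 by rewrite /b ge_min; apply/orP; right; lra.
  have ab : a <= b by exact: ltW (lt_trans ax xb).
  have uab y : a <= y <= b -> 0 < e0 y - xi beta y.
    move=> /andP[ay yb]; rewrite -uE; last by rewrite (le_trans a0 ay) (le_trans yb b1).
    by apply: Hr; rewrite ltr_norml; apply/andP; split; lra.
  apply: (msupport_not_affine FA FB muE a0 b1 ax xb _ supx) => t t01.
  have a1 : a <= 1 by exact: le_trans b1.
  have b0 : 0 <= b by exact: le_trans ab.
  have m01 : 0 <= t * a + (1 - t) * b <= 1.
    have /andP[t0 t1] := t01; have s0 : 0 <= 1 - t by lra.
    have q1 := mulr_ge0 t0 a0; have q2 := mulr_ge0 s0 b0.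
    have q3 : t * a <= t * 1 by rewrite ler_wpM2l.
    have q4 : (1 - t) * b <= (1 - t) * 1 by rewrite ler_wpM2l.
    by apply/andP; split; lra.
  rewrite !pE ?a0 ?b0 //.
  exact: (affine_on cX XE Pmin c0 cphi dxi dxi1 ce2 de0 de1 e2w e01 e10 a0 ab b1 uab t01).
split.
  move=> t t01; rewrite etaE // => E; rewrite -XE //.
  exact: (contact cX XE Pmin c0 cphi dxi dxi1 ce2 de0 de1 e2w e01 e10 t01 E).
split; first exact: (dual_slope1 cX XE Pmin c0 cphi dxi1 ce2 de1 e2w e10).
split.
  (* Without contact at 0, [u > 0] on some [[0, r[], where [phi] is constant, so its difference
     quotients at 0 vanish there. *)
  have [E|ne] := eqVneq (xi beta 0) (e0 0); [left|right]; first by rewrite etaE.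
  have [r r0 Hr] := gt0_near cu (upos 0 h01 ne).
  apply/cvgrPdist_le => e e_gt0; near=> t.
  have t0 : 0 < t by near: t; exact: nbhs_right_gt.
  have t1 : t < 1 by near: t; exact: nbhs_right_lt.
  have tr : t < r by near: t; exact: nbhs_right_lt.
  have -> : phi t = phi 0.
    apply: (const_near0 cX XE Pmin c0 cphi dxi dxi1 ce2 de0 de1 e2w e01 e10 t0 (ltW t1)) => x.
    move=> /andP[x0 xt]; rewrite -uE; last by rewrite x0 (le_trans xt (ltW t1)).
    by apply: Hr; rewrite sub0r normrN ger0_norm // (le_lt_trans xt tr).
  by rewrite subrr mul0r subr0 normr0 ltW.
split; first exact: (slope_distr_deriv2 cp Fnd FC FA FB muE).
apply: (mu_bounded muE); first exact: measurable_itv.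
by move=> x /=; rewrite !in_itv /= => /andP[x0 x1]; rewrite x0 ltW.
Unshelve. all: by end_near. Qed.
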